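(* Let $\delta\ge 0$, $S\in(0,\infty)$, $c>0$, $\sigma>0$, and let $T_u\ge 0$ be a deterministic function of $u$ such that $\lim_{u\to\infty}T_u u^2=T\in[0,\infty)$. Let $\eta(u)$ be the Parisian ruin time of the risk process $R_u^{\delta}$. Then for any $x>0$, as $u\to\infty$, $$\mathbb{P}\left\{u^2(S+T_u-\eta(u))>x\,\big|\,\eta(u)\le S+T_u\right\}\sim\begin{cases}\exp(-ax),&\text{if }\delta>0,\\ \exp(-bx),&\text{if }\delta=0,\end{cases}$$ where $a:=\dfrac{2\delta^2e^{-2\delta S}}{\sigma^2(1-e^{-2\delta S})^2}$ and $b:=\dfrac{1}{2\sigma^2S^2}$.
   Context: Let $B(t)$, $t\in\mathbb{R}$, be a standard (two-sided) Brownian motion with continuous paths and $B(0)=0$. For initial reserve $u\ge 0$, force of interest $\delta\ge 0$, premium rate $c>0$ and volatility $\sigma>0$, the risk process is $$R_u^{\delta}(t)=e^{\delta t}\left(u+c\int_0^t e^{-\delta s}\,ds-\sigma\int_0^t e^{-\delta s}\,dB(s)\right),\quad t\ge 0,$$ so that $R_u^{0}(t)=u+ct-\sigma B(t)$. For a pre-specified time $T_u\ge 0$ (a deterministic function of $u$), the Parisian ruin time is $$\eta(u)=\inf\{t\ge T_u:\ t-\kappa_{t,u}\ge T_u,\ R_u^{\delta}(t)<0\},\qquad \kappa_{t,u}=\sup\{s\in[0,t]:R_u^{\delta}(s)\ge 0\},$$ with the convention $\inf\emptyset=\infty$. The notation $f(u)\sim g(u)$ as $u\to\infty$ means $\lim_{u\to\infty}f(u)/g(u)=1$.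 *)

(* Defs.v *)
From HB Require Import structures.
From mathcomp Require Import all_boot all_order all_algebra.
From mathcomp Require Import all_classical all_reals all_analysis.

Set Implicit Arguments.
Unset Strict Implicit.
Unset Printing Implicit Defensive.

Import Order.TTheory GRing.Theory Num.Theory.
Import numFieldNormedType.Exports.

Local Open Scope classical_set_scope.
Local Open Scope ring_scope.

Section brownian_motion.
Context {d : measure_display} {T : measurableType d} {R : realType}.
Variable P : probability T R.

(* Taking some of the [A i] to be [setT] gives the product rule for every
   subfamily, so this is mutual independence. *)
Definition mutually_independent (n : nat) (X : 'I_n -> T -> R) : Prop :=
  forall A : 'I_n -> set R, (forall i, measurable (A i)) ->
    P (\bigcap_(i in [set: 'I_n]) (X i @^-1` A i)) =
    (\prod_(i < n) P (X i @^-1` A i))%E.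

(* Two-sided: time ranges over all of [R].  The second argument of
   [normal_prob] is the standard deviation. *)
Definition brownian_motion (B : R -> {RV P >-> R}) : Prop :=
  [/\ forall w, B 0 w = 0,
      forall w, continuous (fun t => B t w),
      forall s t, s < t -> forall A : set R, measurable A ->
        P ((fun w => B t w - B s w) @^-1` A) =
        normal_prob 0 (Num.sqrt (t - s)) A
    & forall (n : nat) (t : nat -> R), (forall i, t i <= t i.+1) ->
        mutually_independent
          (fun (i : 'I_n) w => B (t i.+1) w - B (t i) w)].

(* The step function  sum_k a_k 1_{]p_k, q_k]}  is encoded by the list of the
   triples (a_k, p_k, q_k); the intervals may overlap, the integral below being
   additive. *)
Definition step_fun (phi : seq (R * R * R)) (s : R) : R :=
  \sum_(k <- phi) k.1.1 * \1_(`]k.1.2, k.2]) s.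

Definition step_fun_on (t : R) (phi : seq (R * R * R)) : Prop :=
  forall k, k \in phi -> [/\ 0 <= k.1.2, k.1.2 <= k.2 & k.2 <= t].

Definition step_integral (B : R -> T -> R) (phi : seq (R * R * R)) (w : T) : R :=
  \sum_(k <- phi) k.1.1 * (B k.2 w - B k.1.2 w).

(* [X] is (a version of) the Wiener-Ito integral of [f] over [0, t]: the L^2(P)
   limit of the integrals of step functions converging to [f] in L^2([0, t]). *)
Definition is_wiener_integral (B : R -> T -> R) (f : R -> R) (t : R)
    (X : T -> R) : Prop :=
  exists phi : nat -> seq (R * R * R),
    [/\ forall n, step_fun_on t (phi n),
        (fun n => \int[lebesgue_measure]_(s in `[0%R, t])
            (((step_fun (phi n) s - f s) ^+ 2)%R)%:E)%E @ \oo --> 0%E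
      & (fun n => ('E_P[fun w => ((step_integral B (phi n) w - X w) ^+ 2)%R])%E)
            @ \oo --> 0%E].

(* The stochastic integral process  t |-> int_0^t f(s) dB(s), t >= 0, in its
   version with continuous paths starting from 0. *)
Definition wiener_integral_process (B : R -> {RV P >-> R}) (f : R -> R)
    (J : R -> {RV P >-> R}) : Prop :=
  [/\ forall w, J 0 w = 0,
      forall w, {within `[0, +oo[, continuous (fun t => J t w)}
    & forall t, 0 <= t -> is_wiener_integral B f t (J t)].

(* The value is 0 when [B] is null. *)
Definition cond_prob (A B : set T) : R := fine (P (A `&` B)) / fine (P B).

End brownian_motion.

Section parisian_ruin.
Context {R : realType}.

(* [J t] stands for  int_0^t e^{-delta s} dB(s). *)
Definition risk_process {T : Type} (c sigma delta : R) (J : R -> T -> R)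
    (u t : R) (w : T) : R :=
  expR (delta * t) *
  (u + c * (\int[lebesgue_measure]_(s in `[0, t]) expR (- (delta * s)))
     - sigma * J t w).

(* [X] is a path of the risk process, with [X 0 >= 0] so that the set is
   nonempty. *)
Definition kappa (X : R -> R) (t : R) : R :=
  sup [set s | [/\ 0 <= s, s <= t & 0 <= X s]].

(* [ereal_inf set0 = +oo] *)
Definition parisian_ruin_time (Tu : R) (X : R -> R) : \bar R :=
  ereal_inf (EFin @` [set t | [/\ Tu <= t, Tu <= t - kappa X t & X t < 0]]).

End parisian_ruin.

(* Main.v *)
Require Import Defs.
From HB Require Import structures.
From mathcomp Require Import all_boot all_order all_algebra.
From mathcomp Require Import all_classical all_reals all_analysis.
From mathcomp Require Import measurable_realfun ring lra.

Set Implicit Arguments.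
Unset Strict Implicit.
Unset Printing Implicit Defensive.

Import Order.TTheory GRing.Theory Num.Theory.
Import numFieldNormedType.Exports.

Local Open Scope classical_set_scope.
Local Open Scope ring_scope.

(** Discounting does not change signs, so Parisian ruin is a window of length [T_u]
    on which [u + c m(t) - sigma J(t)] is negative, where [J(t)] is the integral of
    [exp (- delta s)] against the Brownian motion, a Gaussian variable of variance
    [v(t) = int_0^t exp (- 2 delta s) ds], and [m] is the primitive of
    [exp (- delta s)]. The event [eta(u) < s + T_u] says that such a window starts
    before [s]. On the exponential scale its probability is
    [exp (- u^2 / (2 sigma^2 v(s)))], and moving the horizon from [S] to
    [S + alpha / u^2] multiplies it by [exp (a alpha)] in the limit, where [- a] is
    the derivative of [1 / (2 sigma^2 v)] at [S] ([ruin_ratio]). The event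
    [u^2 (S + T_u - eta(u)) > x] is ruin before [S - x / u^2], and the conditioning
    event lies between ruin before [S] and ruin before [S + g / u^2] for every
    [g > 0]; the quotient of their probabilities tends to [exp (- a x)]
    ([cond_ruin_time_cvg]).

    The ratio is obtained without the asymptotics of either probability. For the
    horizon [S + alpha / u^2], look at the process at the time
    [r = S - h + alpha / u^2], where [h] is small and fixed: the remaining time [h]
    does not depend on [alpha]. By the Markov property ([past_future_law]) the
    probability of ruin in the remaining time, given the position [z] at time [r],
    does not depend on [alpha] either, so only the density of the position matters
    ([local_ruin_compare]). That density is explicit, and for [z] at most a small
    multiple of [u] the quotient of the densities for [alpha] and [beta] is at most
    [exp (a (alpha - beta) + eps)] ([position_density_ratio]). What is left out is
    negligible compared with the probability of ruin ([ruin_lower_bound]): ruin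
    before [r], because [v] increases ([early_ruin_bound]), and ruin from a position
    higher than that multiple of [u], because the process moves little in the time
    [h] ([restarted_sup_tail]). Since [T_u] tends to [0], the window intervenes only
    through the lower bound: elsewhere the same window stands on both sides of the
    comparison.

    The process [J] is only given by mean square limits. The Markov property needs
    the integral after time [r] as a function of the Brownian path after [r]: it is
    the almost sure limit of Riemann sums along dyadic subdivisions
    ([ae_riem_restarted]), and windows are visible at dyadic times
    ([has_window_dyad]), which makes ruin after [r] a measurable event in the space
    of paths. *)

(** * Gaussian laws *)

(** The measure structure of a pushforward takes a proof of measurability;
    carrying it as an argument lets the result be passed as a bundled measure. *)
Definition image_measure d d' (T1 : measurableType d) (T2 : measurableType d')
    (R : realType) (m : {measure set T1 -> \bar R}) (f : T1 -> T2)
    (mf : measurable_fun [set: T1] f) : {measure set T2 -> \bar R} :=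
  measure_function_pushforward__canonical__measure_function_Measure m mf.

Lemma normal_peakE {R : realType} (s : R) : 0 < s ->
  normal_peak s = s^-1 * (Num.sqrt (pi *+ 2))^-1.
Proof.
by move=> s0; rewrite /normal_peak -mulrnAr sqrtrM ?sqr_ge0// sqrtr_sqr gtr0_norm// invfM.
Qed.

Section affine.
Context {R : realType}.
Notation mu := (@lebesgue_measure R).

Lemma measurable_affine (a b : R) : measurable_fun [set: R] (fun x => a * x + b).
Proof. by apply: measurable_funD => //; apply: measurable_funM. Qed.

(** The rescaled pushforward and the Lebesgue measure agree on intervals. *)
Lemma lebesgue_measure_affine (a b : R) (A : set R) : a != 0 -> measurable A ->
  (mu ((fun x => a * x + b)%R @^-1` A) = (`|a|^-1)%:E * mu A)%E.
Proof.
move=> a0 mA; have na0 : 0 < `|a| by rewrite normr_gt0.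
pose f := (fun x : R => a * x + b).
have mf : measurable_fun [set: R] f by exact: measurable_affine.
pose k : {nonneg R} := NngNum (normr_ge0 a).
pose m : {measure set (measurableTypeR R) -> \bar R} :=
  mscale k (@image_measure _ _ (measurableTypeR R) (measurableTypeR R) R mu f mf).
have -> : mu A = m A.
  apply: lebesgue_measure_unique => // X [[x y] _ <-] /=.
  rewrite /m /= /mscale /= /pushforward /=.
  have [xy|yx] := ltP x y; last first.
    rewrite lebesgue_measure_itv /= lte_fin ltNge yx /=.
    rewrite (_ : f @^-1` `]x, y] = set0) ?measure0 ?mule0//.
    rewrite -subset0 => z /=; rewrite in_itv/= => /andP[h1 h2].
    by have := lt_le_trans h1 h2; rewrite ltNge yx.
  rewrite lebesgue_measure_itv /= lte_fin xy.
  have [ap|an] := ltP 0 a.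
    rewrite (_ : f @^-1` `]x, y] = `](x - b) / a, (y - b) / a]%classic); last first.
      apply/seteqP; split => z /=; rewrite !in_itv/= /f.
        move=> /andP[h1 h2]; rewrite ltr_pdivrMr// ler_pdivlMr//.
        by apply/andP; split; lra.
      rewrite ltr_pdivrMr// ler_pdivlMr// => /andP[h1 h2].
      by apply/andP; split; lra.
    rewrite lebesgue_measure_itv /= lte_fin ltr_pM2r ?invr_gt0// ltrD2r xy.
    rewrite (gtr0_norm ap) -!EFinB -EFinM; congr EFin.
    by field; rewrite gt_eqF.
  have {}an : a < 0 by rewrite lt_neqAle a0.
  rewrite (_ : f @^-1` `]x, y] = `[(y - b) / a, (x - b) / a[%classic); last first.
    apply/seteqP; split => z /=; rewrite !in_itv/= /f.
      move=> /andP[h1 h2]; rewrite ltr_ndivlMr// ler_ndivrMr//.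
      by apply/andP; split; lra.
    rewrite ltr_ndivlMr// ler_ndivrMr// => /andP[h1 h2].
    by apply/andP; split; lra.
  rewrite lebesgue_measure_itv /= lte_fin ltr_nM2r ?invr_lt0// ltrD2r xy.
  rewrite (ltr0_norm an) -!EFinB -EFinM; congr EFin.
  by field; rewrite lt_eqF.
rewrite /m /= /mscale /= /pushforward muleA -EFinM mulVf ?mul1e//.
by rewrite gt_eqF.
Qed.

Lemma ge0_integral_affine (a b : R) (A : set R) (g : R -> R) : a != 0 ->
  measurable A -> measurable_fun [set: R] g -> (forall x, 0 <= g x) ->
  (\int[mu]_(x in A) (g x)%:E =
   \int[mu]_(x in (fun x => a * x + b)%R @^-1` A) (`|a| * g (a * x + b)%R)%:E)%E.
Proof.
move=> a0 mA mg g0; have na0 : 0 < `|a| by rewrite normr_gt0.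
pose f := (fun x : R => a * x + b).
have mf : measurable_fun [set: R] f by exact: measurable_affine.
pose k : {nonneg R} := NngNum (normr_ge0 a).
rewrite (@eq_measure_integral _ (measurableTypeR R) R A
  (mscale k (@image_measure _ _ (measurableTypeR R) (measurableTypeR R) R mu f mf))); last first.
  move=> X mX _; rewrite /= /mscale /= /pushforward /=.
  by rewrite lebesgue_measure_affine// muleA -EFinM divff ?mul1e// gt_eqF.
rewrite ge0_integral_mscale//; last 2 first.
  by apply/measurable_EFinP; exact: measurable_funTS.
  by move=> x _; rewrite lee_fin.
rewrite ge0_integral_pushforward//; last 2 first.
  by apply/measurable_EFinP; exact: measurable_funTS.
  by move=> x _; rewrite lee_fin.
under [RHS]eq_integral do rewrite EFinM.
rewrite ge0_integralZl_EFin//.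
- by rewrite -[_ @^-1` _]setTI; exact: mf.
- by move=> x _; rewrite lee_fin.
- apply/measurable_EFinP; apply: measurable_funTS.
  exact: (measurableT_comp mg mf).
Qed.

Lemma normal_prob_affine (m s a b : R) (A : set R) : 0 < s -> a != 0 ->
  measurable A ->
  normal_prob m s ((fun x => a * x + b) @^-1` A) =
  normal_prob (a * m + b) (`|a| * s) A.
Proof.
move=> s0 a0 mA; have na0 : 0 < `|a| by rewrite normr_gt0.
rewrite [RHS]/normal_prob (ge0_integral_affine b a0)//; last 2 first.
  exact: measurable_normal_pdf.
  by move=> x; exact: normal_pdf_ge0.
apply: eq_integral => x _; congr EFin.
rewrite !normal_pdfE ?mulf_neq0 ?gt_eqF//.
rewrite /normal_peak /normal_fun mulrA; congr (_ * _).
  rewrite exprMn real_normK ?num_real// -(mulrA (a ^+ 2)) -(mulrnAr (a ^+ 2)).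
  rewrite sqrtrM ?sqr_ge0// sqrtr_sqr invfM mulrA divff ?mul1r//.
  by rewrite gt_eqF.
congr expR; rewrite exprMn real_normK ?num_real//.
by field; rewrite a0 gt_eqF.
Qed.

End affine.

Section normal_integral.
Context {R : realType}.
Notation mu := (@lebesgue_measure R).
Local Open Scope ereal_scope.

(** [normal_prob m s] is given by its density, which is therefore its
    Radon-Nikodym derivative almost everywhere. *)
Lemma ge0_integral_normal_prob (m s : R) (f : R -> \bar R) :
  measurable_fun [set: R] f -> (forall x, 0 <= f x) ->
  \int[normal_prob m s]_x f x = \int[mu]_x (f x * (normal_pdf m s x)%:E).
Proof.
move=> mf f0; have dom := normal_prob_dominates m s.
rewrite -(Radon_Nikodym_SigmaFinite.change_of_variables dom)//=.
apply: ae_eq_integral => //.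
- apply: emeasurable_funM => //; apply: (measurable_int mu).
  exact: Radon_Nikodym_SigmaFinite.f_integrable.
- apply: emeasurable_funM => //; apply/measurable_EFinP.
  exact: measurable_normal_pdf.
- apply: ae_eqe_mul2l; apply: integral_ae_eq => //.
  + exact: Radon_Nikodym_SigmaFinite.f_integrable.
  + by apply/measurable_EFinP; exact: measurable_normal_pdf.
  + by move=> E _ mE; rewrite -Radon_Nikodym_SigmaFinite.f_integral.
Qed.

End normal_integral.

Section convolution.
Context {R : realType}.
Notation mu := (@lebesgue_measure R).

(** Completing the square: the product of the two densities factors as the
    density of the sum times a normal density in the remaining variable, which
    integrates to one. *)
Lemma normal_pdf_mul (s1 s2 x y : R) : 0 < s1 -> 0 < s2 ->
  let s := Num.sqrt (s1 ^+ 2 + s2 ^+ 2) in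
  normal_pdf 0 s1 x * normal_pdf x s2 y =
  normal_pdf 0 s y * normal_pdf (s1 ^+ 2 / s ^+ 2 * y) (s1 * s2 / s) x.
Proof.
move=> s10 s20 s.
have ss : s ^+ 2 = s1 ^+ 2 + s2 ^+ 2 by rewrite sqr_sqrtr// addr_ge0 ?sqr_ge0.
have s0 : 0 < s by rewrite sqrtr_gt0 addr_gt0 ?exprn_gt0.
have t0 : 0 < s1 * s2 / s by rewrite divr_gt0 ?mulr_gt0.
rewrite !normal_pdfE ?gt_eqF// !normal_peakE// /normal_fun.
set q := Num.sqrt (pi *+ 2); have q0 : 0 < q.
  by rewrite sqrtr_gt0 mulrn_wgt0 ?pi_gt0.
rewrite mulrACA -expRD [RHS]mulrACA -expRD; congr (_ * expR _).
  by field; rewrite !gt_eqF.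
rewrite !exprMn !exprVn ss.
have p0 : s1 ^+ 2 + s2 ^+ 2 != 0 by rewrite gt_eqF// addr_gt0 ?exprn_gt0.
by field; rewrite p0 !gt_eqF.
Qed.

(** Integrate [normal_pdf_mul] first in the remaining variable. *)
Lemma normal_prob_convolution (s1 s2 : R) (A : set R) : 0 < s1 -> 0 < s2 ->
  measurable A ->
  (normal_prob 0 s1 \x normal_prob 0 s2)%E ((fun p => p.1 + p.2) @^-1` A) =
  normal_prob 0 (Num.sqrt (s1 ^+ 2 + s2 ^+ 2)) A.
Proof.
move=> s10 s20 mA; set s := Num.sqrt _.
have s0 : 0 < s by rewrite sqrtr_gt0 addr_gt0 ?exprn_gt0.
set D := _ @^-1` A.
have mD : measurable D.
  by rewrite -[D]setTI; apply: (measurable_funD measurable_fst measurable_snd).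
rewrite /product_measure1/= ge0_integral_normal_prob//; last first.
  exact: measurable_fun_xsection.
have E x : normal_prob 0 s2 (xsection D x) =
    (\int[mu]_y (\1_A y * normal_pdf x s2 y)%:E)%E.
  rewrite (_ : xsection D x = (fun y => 1 * y + x) @^-1` A); last first.
    by apply/seteqP; split => y; rewrite /xsection/= inE/= mul1r addrC.
  rewrite normal_prob_affine// mul1r add0r normr1 mul1r /normal_prob.
  rewrite integral_mkcond/=; apply: eq_integral => y _.
  rewrite patchE /indic; case: ifPn => yA; rewrite ?mul1r//.
  by rewrite mul0r.
pose F (p : R * R) := ((\1_A p.2 * normal_pdf p.1 s2 p.2) * normal_pdf 0 s1 p.1)%:E.
have F0 p : (0 <= F p)%E.
  by rewrite lee_fin !mulr_ge0// normal_pdf_ge0.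
have mF : measurable_fun [set: R * R] F.
  apply/measurable_EFinP; apply: measurable_funM; last first.
    exact: (measurableT_comp (measurable_normal_pdf 0 s1) measurable_fst).
  apply: measurable_funM.
    by apply: (measurableT_comp _ measurable_snd); exact: measurable_indic.
  rewrite (_ : (fun x => _) = (fun p : R * R => normal_pdf 0 s2 (p.2 - p.1))).
    apply: (measurableT_comp (measurable_normal_pdf 0 s2)).
    exact: measurable_funB.
  apply/funext => p; rewrite !normal_pdfE ?gt_eqF//.
  by rewrite /normal_fun subr0.
transitivity (\int[mu]_x \int[mu]_y F (x, y))%E.
  apply: eq_integral => x _; rewrite E -ge0_integralZr//.
  - apply/measurable_EFinP; apply: measurable_funM => //.
    exact: measurable_normal_pdf.
  - by move=> y _; rewrite lee_fin mulr_ge0// normal_pdf_ge0.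
  - by rewrite lee_fin normal_pdf_ge0.
rewrite (@fubini_tonelli _ _ _ _ _ mu mu F mF F0).
rewrite /normal_prob [RHS]integral_mkcond/=; apply: eq_integral => y _.
transitivity (\int[mu]_x ((\1_A y * normal_pdf 0 s y)%:E *
    (normal_pdf (s1 ^+ 2 / s ^+ 2 * y) (s1 * s2 / s) x)%:E))%E.
  apply: eq_integral => x _; rewrite /F/= -EFinM; congr EFin.
  by rewrite -mulrA (mulrC (normal_pdf x s2 y)) normal_pdf_mul// mulrA.
rewrite ge0_integralZl_EFin//.
- by rewrite integral_normal_pdf mule1 patchE /indic; case: ifPn => yA;
    rewrite ?mul1r ?mul0r.
- by move=> x _; rewrite lee_fin normal_pdf_ge0.
- by apply/measurable_EFinP; exact: measurable_normal_pdf.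
- by rewrite mulr_ge0// normal_pdf_ge0.
Qed.

End convolution.

(** * Almost everywhere limits and equality of laws *)

Section real_laws.
Context {R : realType}.

(** The closed half-lines to the right form a pi-system that generates the Borel
    sets. *)
Lemma eq_measure_rays (m1 m2 : {measure set R -> \bar R}) :
  (forall y, m1 `[y, +oo[%classic = m2 `[y, +oo[%classic) ->
  (forall y, (m1 `[y, +oo[%classic < +oo)%E) ->
  forall A, measurable A -> m1 A = m2 A.
Proof.
move=> m12 moo A mA.
apply: (@g_sigma_algebra_measure_unique _ _ _ (@RGenCInfty.G R) _
  (fun k => `[- k%:R, +oo[%classic)) => //.
- by move=> _ [y ->]; exact: measurable_itv.
- by move=> k; eexists.
- rewrite -subTset => z _; exists (Num.truncn `|z|).+1 => //=.
  rewrite in_itv/= andbT lerNl (le_trans (ler_norm _))// normrN ltW//.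
  exact: truncnS_gt.
- move=> _ _ [y ->] [z ->]; exists (Num.max y z).
  by apply/seteqP; split => x /=; rewrite !in_itv/= !andbT ge_max;
    [move=> [-> ->]|move=> /andP[]].
- by move=> _ [y ->].
- suff -> : <<s @RGenCInfty.G R >> = (@ocitv R).-sigma.-measurable by exact: mA.
  by rewrite RGenCInfty.measurableE.
Qed.

End real_laws.

Lemma ge0_integral_mrestr d (T : measurableType d) (R : realType)
    (m : {measure set T -> \bar R}) (E : set T) (mE : measurable E)
    (f : T -> \bar R) : measurable_fun [set: T] f -> (forall x, 0 <= f x)%E ->
  (\int[mrestr m mE]_x f x = \int[m]_(x in E) f x)%E.
Proof.
move=> mf f0; rewrite -(setUv E) ge0_integral_setU//=; last 3 first.
- exact: measurableC.
- by rewrite setUv.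
- by rewrite disj_set2E setICr.
rewrite [X in _ + X]null_set_integral//=; last 3 first.
- exact: measurableC.
- exact: measurable_funTS.
- by rewrite /mrestr setICl measure0.
rewrite adde0; apply: eq_measure_integral => A mA AE.
by rewrite /= /mrestr setIidl.
Qed.

Section limit_law.
Context d (T : measurableType d) (R : realType) (P : probability T R).
Variables (X : nat -> T -> R) (Y : T -> R) (E : set T).
Hypotheses (mX : forall n, measurable_fun [set: T] (X n))
  (mY : measurable_fun [set: T] Y) (mE : measurable E).
Hypothesis XY : {ae P, forall w, X ^~ w @ \oo --> Y w}.
Hypothesis eqX : forall n A, measurable A ->
  P (X n @^-1` A `&` E) = P (X 0%N @^-1` A `&` E).

Let mpre (Z : T -> R) (A : set R) : measurable_fun [set: T] Z -> measurable A ->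
  measurable (Z @^-1` A).
Proof. by move=> mZ mA; rewrite -[_ @^-1` _]setTI; exact: mZ. Qed.

(** Restricting to an event [E] makes a statement about laws also carry the
    independence from [E]. *)
Let law (Z : T -> R) (mZ : measurable_fun [set: T] Z) : {measure set R -> \bar R} :=
  image_measure (mrestr P mE) mZ.

Let lawE Z mZ A : @law Z mZ A = P (Z @^-1` A `&` E). Proof. by []. Qed.

(** Continuous functions that decrease, as [k] grows, to the indicator of
    [[y, +oo[]. *)
Let ramp (y : R) (k : nat) (x : R) : R :=
  Num.min 1 (Num.max 0 (1 + k%:R * (x - y))).

Let ramp01 y k x : 0 <= ramp y k x <= 1.
Proof. by rewrite /ramp le_min ler01 le_max lexx/= ge_min lexx. Qed.

Let ramp_cts y k : continuous (ramp y k).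
Proof.
move=> x.
apply: (@continuous_min R R (cst 1)
  (cst 0 \max (fun x => 1 + k%:R * (x - y)))); first exact: cvg_cst.
apply: (@continuous_max R R (cst 0)); first exact: cvg_cst.
apply: cvgD; first exact: cvg_cst.
apply: cvgM; first exact: cvg_cst.
by apply: cvgB; [exact: cvg_id|exact: cvg_cst].
Qed.

Let mramp y k : measurable_fun [set: R] (ramp y k).
Proof. exact: continuous_measurable_fun. Qed.

Let ramp_lim y x : ramp y ^~ x @ \oo --> (\1_`[y, +oo[ x : R).
Proof.
rewrite indicE mem_setE in_itv/= andbT; have [yx|xy] := leP y x.
  apply: cvg_near_cst; apply: nearW => k; rewrite /ramp.
  have h : 0 <= k%:R * (x - y) by rewrite mulr_ge0// subr_ge0.
  by rewrite max_r ?addr_ge0// min_l// lerDl.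
have d0 : 0 < y - x by rewrite subr_gt0.
apply: cvg_near_cst; exists (Num.truncn (y - x)^-1).+1 => // k /= hk.
have kx : 1 <= k%:R * (y - x).
  rewrite -ler_pdivrMr// mul1r (le_trans (ltW (truncnS_gt _)))// ler_nat.
  exact: hk.
rewrite /ramp max_l ?min_r//.
by rewrite -opprB mulrN subr_le0.
Qed.

Let int_ramp_lim y Z : measurable_fun [set: T] Z ->
  (\int[P]_(w in E) (ramp y k (Z w))%:E)%E @[k --> \oo] -->
  P (Z @^-1` `[y, +oo[ `&` E).
Proof.
move=> mZ.
have -> : P (Z @^-1` `[y, +oo[ `&` E) =
    (\int[P]_(w in E) (\1_`[y, +oo[ (Z w))%:E)%E.
  rewrite -integral_indic//; last by exact: mpre.
have [] // := @dominated_convergence _ _ _ P E mE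
  (fun k w => (ramp y k (Z w))%:E) (fun w => (\1_`[y, +oo[ (Z w))%:E) (cst 1%E).
- move=> k; apply/measurable_EFinP; apply: measurable_funTS.
  exact: (measurableT_comp (mramp y k)).
- apply/measurable_EFinP; apply: measurable_funTS.
  by apply: (measurableT_comp _ mZ); exact: measurable_indic.
- apply: aeW => w _; apply: cvg_EFin; first exact: nearW.
  exact: ramp_lim.
- by apply: finite_measure_integrable_cst.
- apply: aeW => w k _; rewrite /= lee_fin ger0_norm; case/andP: (ramp01 y k (Z w)) => //.
Qed.

Let int_ramp_eq y k : (\int[P]_(w in E) (ramp y k (Y w))%:E =
  \int[P]_(w in E) (ramp y k (X 0%N w))%:E)%E.
Proof.
have [] := @dominated_convergence _ _ _ P E mE
  (fun n w => (ramp y k (X n w))%:E) (fun w => (ramp y k (Y w))%:E) (cst 1%E).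
- move=> n; apply/measurable_EFinP; apply: measurable_funTS.
  exact: (measurableT_comp (mramp y k)).
- apply/measurable_EFinP; apply: measurable_funTS.
  exact: (measurableT_comp (mramp y k)).
- move: XY; apply: filterS => w Xw _; apply: cvg_EFin; first exact: nearW.
  apply: (cvg_comp _ _ Xw); exact: ramp_cts.
- by apply: finite_measure_integrable_cst.
- by apply: aeW => w n _; rewrite /= lee_fin ger0_norm; case/andP: (ramp01 y k (X n w)).
move=> _ _; set s := (X in X @ _ --> _) => h.
rewrite -(cvg_lim _ h)//; apply/cvg_lim => //; apply: cvg_near_cst.
apply: nearW => n; rewrite /s/=.
have intE Z (mZ : measurable_fun [set: T] Z) :
    (\int[P]_(w in E) (ramp y k (Z w))%:E = \int[law mZ]_x (ramp y k x)%:E)%E.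
  rewrite ge0_integral_pushforward//; last 2 first.
  - by apply/measurable_EFinP; exact: mramp.
  - by move=> x _; rewrite lee_fin; case/andP: (ramp01 y k x).
  rewrite preimage_setT ge0_integral_mrestr//.
  - by apply/measurable_EFinP; exact: (measurableT_comp (mramp y k)).
  - by move=> x; rewrite lee_fin; case/andP: (ramp01 y k (Z x)).
rewrite (intE _ (mX n)) (intE _ (mX 0%N)).
by apply: eq_measure_integral => A mA _; rewrite !lawE eqX.
Qed.

(** Bounded continuous functions of [X n] have integrals that do not depend on
    [n], and dominated convergence passes this to the limit [Y]; the ramps reduce
    half-lines to such functions. *)
Lemma ae_cvg_eq_law A : measurable A ->
  P (Y @^-1` A `&` E) = P (X 0%N @^-1` A `&` E).
Proof.
move=> mA; rewrite -(lawE mY) -(lawE (mX 0%N)).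
apply: eq_measure_rays => //; [move=> y|].
  rewrite !lawE -(cvg_lim _ (@int_ramp_lim y _ mY))//.
  under eq_fun do rewrite int_ramp_eq.
  exact: (cvg_lim _ (@int_ramp_lim y _ (mX 0%N))).
move=> y; rewrite lawE (le_lt_trans (probability_le1 _ _)) ?ltry//.
by apply: measurableI => //; exact: mpre.
Qed.

End limit_law.

(** * Sums of independent Gaussian variables *)

Lemma measurable_preimage d d' (T : measurableType d) (T' : measurableType d')
    (f : T -> T') (A : set T') :
  measurable_fun [set: T] f -> measurable A -> measurable (f @^-1` A).
Proof. by move=> mf mA; rewrite -[_ @^-1` _]setTI; exact: mf. Qed.

(** Uniqueness of the product measure, applied to the law conditioned on [E];
    the case [P E = 0] is separate because one divides by [P E]. *)
Lemma joint_law_product d d1 d2 (T : measurableType d) (T1 : measurableType d1)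
    (T2 : measurableType d2) (R : realType) (P : probability T R)
    (m1 : probability T1 R) (m2 : probability T2 R) (X : T -> T1) (Y : T -> T2)
    (E : set T) :
  measurable_fun [set: T] X -> measurable_fun [set: T] Y -> measurable E ->
  (forall A B, measurable A -> measurable B ->
    P (X @^-1` A `&` (Y @^-1` B `&` E)) = (m1 A * (m2 B * P E))%E) ->
  forall D, measurable D ->
    P ((fun w => (X w, Y w)) @^-1` D `&` E) = ((m1 \x m2)%E D * P E)%E.
Proof.
move=> mX mY mE XY D mD.
have mXY : measurable_fun [set: T] (fun w => (X w, Y w)) by exact: measurable_fun_pair.
have [E0|E0] := eqVneq (P E) 0%E.
  rewrite E0 mule0; apply/eqP; rewrite eq_le measure_ge0 andbT -E0.
  apply: le_measure => //; rewrite inE//.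
  by apply: measurableI => //; exact: measurable_preimage.
have Efin : P E \is a fin_num by exact: fin_num_measure.
have p0 : (0 < fine (P E))%R by rewrite fine_gt0// lt0e E0 measure_ge0/= -ge0_fin_numE.
have q0 : 0 < (fine (P E))^-1 by rewrite invr_gt0.
pose k' : {nonneg R} := NngNum (ltW q0).
pose m' : {measure set (T1 * T2) -> \bar R} :=
  mscale k' (image_measure (mrestr P mE) mXY).
have -> : (m1 \x m2)%E D = m' D.
  apply: product_measure_unique => // A B mA mB.
  rewrite /m' /= /mscale /= /pushforward /= /mrestr.
  have -> : (fun w => (X w, Y w)) @^-1` (A `*` B) `&` E =
      X @^-1` A `&` (Y @^-1` B `&` E) by rewrite setIA.
  rewrite XY// (muleA (m1 A)) (muleC (m1 A * m2 B)%E) muleA.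
  by rewrite -[P E]fineK// -EFinM mulVf ?mul1e// gt_eqF.
rewrite /m' /= /mscale /= /pushforward /= /mrestr muleC muleA.
by rewrite -[X in (X * _ * _)%E]fineK// -EFinM mulfV ?mul1e// gt_eqF.
Qed.

(** One step of the summation of independent Gaussian variables: their joint law
    is a product by [joint_law_product], and its image under the sum is a
    convolution. *)
Lemma gaussian_merge d (T : measurableType d) (R : realType)
    (P : probability T R) (X Y : T -> R) (E : set T) (s1 s2 a : R) :
  measurable_fun [set: T] X -> measurable_fun [set: T] Y -> measurable E ->
  0 < s1 -> 0 < s2 -> a != 0 ->
  (forall A B, measurable A -> measurable B ->
    P (X @^-1` A `&` (Y @^-1` B `&` E)) =
    (normal_prob 0 s1 A * (normal_prob 0 s2 B * P E))%E) ->
  forall A, measurable A ->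
    P ((fun w => X w + a * Y w) @^-1` A `&` E) =
    (normal_prob 0 (Num.sqrt (s1 ^+ 2 + a ^+ 2 * s2 ^+ 2)) A * P E)%E.
Proof.
move=> mX mY mE s10 s20 a0 XY A mA.
have na0 : 0 < `|a| by rewrite normr_gt0.
pose Y' w := a * Y w + 0.
have mY' : measurable_fun [set: T] Y'.
  exact: (measurableT_comp (measurable_affine a 0)).
have msum : measurable_fun [set: R * R] (fun p : R * R => p.1 + p.2).
  exact: (measurable_funD measurable_fst measurable_snd).
rewrite (_ : _ @^-1` A = (fun w => (X w, Y' w)) @^-1` ((fun p => p.1 + p.2) @^-1` A)); last first.
  by apply/seteqP; split => w; rewrite /preimage/= /Y' addr0.
have s20' : 0 < `|a| * s2 by rewrite mulr_gt0.
pose D := (fun p : R * R => p.1 + p.2) @^-1` A.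
have mD : measurable D by exact: measurable_preimage.
have XY' A' B' : measurable A' -> measurable B' ->
    P (X @^-1` A' `&` (Y' @^-1` B' `&` E)) =
    (normal_prob 0 s1 A' * (normal_prob 0 (`|a| * s2) B' * P E))%E.
  move=> mA' mB'.
  rewrite (_ : Y' @^-1` B' = Y @^-1` ((fun x => a * x + 0) @^-1` B'))//.
  have mB'' := measurable_preimage (measurable_affine a 0) mB'.
  by rewrite (XY _ _ mA' mB'') (normal_prob_affine 0 0 s20 a0 mB') mulr0 addr0.
have J := @joint_law_product _ _ _ _ _ _ _ P (normal_prob 0 s1)
  (normal_prob 0 (`|a| * s2)) _ _ _ mX mY' mE XY' _ mD.
transitivity ((normal_prob 0 s1 \x normal_prob 0 (`|a| * s2))%E D * P E)%E.
  exact: J.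
rewrite (normal_prob_convolution s10 s20' mA) exprMn real_normK//.
exact: num_real.
Qed.

Section gaussian_sums.
Context d (T : measurableType d) (R : realType) (P : probability T R).
Variables (X : nat -> T -> R) (L : nat).
Hypothesis mX : forall i, measurable_fun [set: T] (X i).
Hypothesis indX : mutually_independent P (fun i : 'I_L => X i).

(** The lower index [k] lets an induction move the variables from the event into
    a sum, one at a time. *)
Definition tail_event (A : nat -> set R) (k : nat) : set T :=
  [set w | forall i, (k <= i < L)%N -> A i (X i w)].

Lemma measurable_tail_event A k : (forall i, measurable (A i)) ->
  measurable (tail_event A k).
Proof.
move=> mA; rewrite (_ : tail_event A k =
    \bigcap_(i in [set i | (k <= i < L)%N]) X i @^-1` A i); last first.
  by apply/seteqP; split => w h i; exact: h.
by apply: bigcap_measurableType => i _; exact: measurable_preimage.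
Qed.

Lemma prob_tail_event A k : (forall i, measurable (A i)) ->
  P (tail_event A k) = (\prod_(k <= i < L) P (X i @^-1` A i))%E.
Proof.
move=> mA; pose A' i := if (k <= i)%N then A i else setT.
have mA' i : measurable (A' i) by rewrite /A'; case: ifP.
have -> : tail_event A k =
    \bigcap_(i in [set: 'I_L]) (X i @^-1` A' i).
  apply/seteqP; split => w h.
    by move=> i _ /=; rewrite /A'; case: ifP => // ki; apply: h; rewrite ki /=.
  move=> i /andP[ki iL]; have := h (Ordinal iL) I.
  by rewrite /= /A' ki.
rewrite (indX (A := fun i : 'I_L => A' i))//.
rewrite -(big_mkord xpredT (fun i => P (X i @^-1` A' i))).
have [kL|Lk] := leqP k L; last first.
  rewrite [RHS]big_geq 1?ltnW// big_nat big1// => i /andP[_ iL].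
  by rewrite /A' leqNgt (ltn_trans iL Lk)/= preimage_setT probability_setT.
rewrite (@big_cat_nat _ _ _ k)//= big_nat big1 ?mul1e.
  by apply: eq_big_nat => i /andP[ki _]; rewrite /A' ki.
by move=> i /andP[_ ik]; rewrite /A' leqNgt ik/= preimage_setT probability_setT.
Qed.

Lemma tail_eventS A k : (k < L)%N ->
  tail_event A k = X k @^-1` A k `&` tail_event A k.+1.
Proof.
move=> kL; apply/seteqP; split => w.
  move=> h; split => /=; first by apply: h; rewrite leqnn.
  by move=> i /andP[ki iL]; apply: h; rewrite iL ltnW.
move=> [h1 h2] i /andP[]; rewrite leq_eqVlt => /predU1P[<-//|ki] iL.
by apply: h2; rewrite ki.
Qed.

Lemma prob_tail_eventS A k : (k < L)%N -> (forall i, measurable (A i)) ->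
  P (X k @^-1` A k `&` tail_event A k.+1) =
  (P (X k @^-1` A k) * P (tail_event A k.+1))%E.
Proof.
by move=> kL mA; rewrite -tail_eventS// !prob_tail_event// big_ltn.
Qed.

Lemma eq_tail_event A A' k : (forall i, (k <= i)%N -> A i = A' i) ->
  tail_event A k = tail_event A' k.
Proof.
move=> AA'; apply/seteqP; split => w h i ki.
  by rewrite -AA'; [exact: h|case/andP: ki].
by rewrite AA'; [exact: h|case/andP: ki].
Qed.

Variables (s a : nat -> R) (n : nat).
Hypotheses (nL : (n <= L)%N) (s0 : forall i, 0 < s i) (a0 : forall i, a i != 0).
Hypothesis lawX : forall i A, (i < n)%N -> measurable A ->
  P (X i @^-1` A) = normal_prob 0 (s i) A.

Lemma measurable_weighted_sum k :
  measurable_fun [set: T] (fun w => \sum_(i < k) a i * X i w).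
Proof. by apply: measurable_sum => i; exact: measurable_funM. Qed.

(** The variables of index at least [k] are kept in the event, so that the law of
    the sum comes with its independence from them. *)
Lemma gaussian_weighted_sum A_ k A : (forall i, measurable (A_ i)) ->
  (0 < k <= n)%N -> measurable A ->
  P ((fun w => \sum_(i < k) a i * X i w) @^-1` A `&` tail_event A_ k) =
  (normal_prob 0 (Num.sqrt (\sum_(i < k) a i ^+ 2 * s i ^+ 2)) A *
   P (tail_event A_ k))%E.
Proof.
case: k => // k; elim: k A_ A => [|k IH] A_ A mA_ /= kn mA.
  pose A' i := if i == 0%N then (fun x => a 0%N * x + 0) @^-1` A else A_ i.
  have mA' i : measurable (A' i).
    by rewrite /A'; case: ifP => // _; exact: measurable_preimage (measurable_affine _ _) _.
  rewrite (_ : _ @^-1` A = X 0%N @^-1` A' 0%N); last first.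
    by apply/seteqP; split => w; rewrite /preimage/= big_ord1 /A' /= addr0.
  rewrite (@eq_tail_event A_ A'); last by case.
  rewrite prob_tail_eventS//; last exact: leq_trans kn nL.
  rewrite (lawX kn (mA' 0%N)) /A'/= (normal_prob_affine 0 0 (s0 0%N) (a0 0%N) mA).
  by rewrite mulr0 addr0 big_ord1 -exprMn sqrtr_sqr normrM (gtr0_norm (s0 0)).
rewrite (_ : (fun w => _) = (fun w => \sum_(i < k.+1) a i * X i w + a k.+1 * X k.+1 w)); last first.
  by apply/funext => w; rewrite big_ord_recr.
have sum0 : 0 < \sum_(i < k.+1) a i ^+ 2 * s i ^+ 2.
  rewrite big_ord_recl ltr_pwDl//.
    by apply: mulr_gt0; [rewrite exprn_even_gt0//=|exact: exprn_gt0].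
  by rewrite sumr_ge0// => i _; rewrite mulr_ge0// sqr_ge0.
have sq0 : 0 < Num.sqrt (\sum_(i < k.+1) a i ^+ 2 * s i ^+ 2) by rewrite sqrtr_gt0.
pose W w := \sum_(i < k.+1) a i * X i w.
pose sW := Num.sqrt (\sum_(i < k.+1) a i ^+ 2 * s i ^+ 2).
have H C C' : measurable C -> measurable C' ->
    P (W @^-1` C `&` (X k.+1 @^-1` C' `&` tail_event A_ k.+2)) =
    (normal_prob 0 sW C * (normal_prob 0 (s k.+1) C' * P (tail_event A_ k.+2)))%E.
  move=> mC mC'; pose A' i := if i == k.+1 then C' else A_ i.
  have mA' i : measurable (A' i) by rewrite /A'; case: ifP.
  have E : tail_event A_ k.+2 = tail_event A' k.+2.
    by apply: eq_tail_event => i ki; rewrite /A' gtn_eqF.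
  have C'E : C' = A' k.+1 by rewrite /A' eqxx.
  have kL : (k.+1 < L)%N by exact: leq_trans kn nL.
  rewrite E C'E -tail_eventS// (IH A' C mA' (ltnW kn) mC).
  by rewrite tail_eventS// prob_tail_eventS// lawX.
have mW : measurable_fun [set: T] W by exact: measurable_weighted_sum.
have -> := gaussian_merge mW (mX k.+1) (measurable_tail_event k.+2 mA_) sq0
  (s0 k.+1) (a0 k.+1) H mA.
have -> // : sW ^+ 2 + a k.+1 ^+ 2 * s k.+1 ^+ 2 =
    \sum_(i < k.+2) a i ^+ 2 * s i ^+ 2.
by rewrite [RHS]big_ord_recr /sW sqr_sqrtr//; exact: ltW.
Qed.

End gaussian_sums.

(** * The isometry for step functions *)

Section has_int.
Context d (T : measurableType d) (R : realType) (mu : {measure set T -> \bar R}).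
Variables (D : set T) (mD : measurable D).
Implicit Types f g : T -> R.

(** Existence and value of an integral together, so that identities between
    integrals of signed functions combine without integrability side conditions. *)
Definition has_int f (r : R) : Prop :=
  mu.-integrable D (EFin \o f) /\ (\int[mu]_(x in D) (f x)%:E = r%:E)%E.

Lemma has_intD f g r r' : has_int f r -> has_int g r' ->
  has_int (fun x => f x + g x) (r + r').
Proof.
move=> [fi fr] [gi gr]; split.
  rewrite (_ : _ \o _ = (EFin \o f) \+ (EFin \o g))%E; last exact/funext.
  exact: integrableD.
by under eq_integral do rewrite EFinD; rewrite integralD// fr gr.
Qed.

Lemma has_intZ (k : R) f r : has_int f r -> has_int (fun x => k * f x) (k * r).
Proof.
move=> [fi fr]; split.
  rewrite (_ : _ \o _ = (fun x => k%:E * (EFin \o f) x))%E; last exact/funext.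
  exact: integrableZl.
by under eq_integral do rewrite EFinM; rewrite integralZl// fr.
Qed.

Lemma has_int0 : has_int (fun=> 0) 0.
Proof. by split; [exact: integrable0|rewrite integral0]. Qed.

Lemma has_int_sum (I : eqType) (s : seq I) (F : I -> T -> R) (c : I -> R) :
  (forall i, i \in s -> has_int (F i) (c i)) ->
  has_int (fun x => \sum_(i <- s) F i x) (\sum_(i <- s) c i).
Proof.
elim: s => [_|i s IH h].
  by under eq_fun do rewrite big_nil; rewrite big_nil; exact: has_int0.
under eq_fun do rewrite big_cons.
rewrite big_cons; apply: has_intD; first by apply: h; rewrite mem_head.
by apply: IH => j js; apply: h; rewrite in_cons js orbT.
Qed.

Lemma eq_has_int f g r : (forall x, f x = g x) -> has_int f r -> has_int g r.
Proof. by move=> /funext ->. Qed.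

End has_int.

(** The square norm of a step function in [L^2], and up to a constant that of its
    integral: the scalar product of the indicators of two intervals, and the
    covariance of the two Brownian increments, in polarised form. *)
Definition step_form {R : realType} (phi : seq (R * R * R)) : R :=
  \sum_(k <- phi) \sum_(l <- phi) k.1.1 * l.1.1 *
    (2^-1 * (`|k.2 - l.1.2| + `|k.1.2 - l.2| - `|k.2 - l.2| - `|k.1.2 - l.1.2|)).

Section isometry.
Context d (T : measurableType d) (R : realType) (mu : {measure set T -> \bar R}).
Variables (D : set T) (mD : measurable D) (H : R -> T -> R) (K t : R).
Hypothesis HK : forall x y, 0 <= x <= t -> 0 <= y <= t ->
  has_int mu D (fun w => (H x w - H y w) ^+ 2) (K * `|x - y|).

(** The square norm of a combination of increments of a curve only depends on
    the square norms of its increments, by polarisation. Applied to a Brownian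
    motion and to the indicators of intervals, this is the Ito isometry. *)
Lemma has_int_step_sqr (phi : seq (R * R * R)) : step_fun_on t phi ->
  has_int mu D (fun w => (\sum_(k <- phi) k.1.1 * (H k.2 w - H k.1.2 w)) ^+ 2)
    (K * step_form phi).
Proof.
move=> ht; have h k : k \in phi -> (0 <= k.1.2 <= t) && (0 <= k.2 <= t).
  move=> /ht[h1 h2 h3]; rewrite h1 h3 (le_trans h2 h3) (le_trans h1 h2).
  by [].
rewrite /step_form mulr_sumr.
apply: (@eq_has_int _ _ _ _ _ (fun w => \sum_(k <- phi) \sum_(l <- phi)
    (k.1.1 * l.1.1 * 2^-1) * ((H k.2 w - H l.1.2 w) ^+ 2
     + ((H k.1.2 w - H l.2 w) ^+ 2 + (-1 * (H k.2 w - H l.2 w) ^+ 2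
     + -1 * (H k.1.2 w - H l.1.2 w) ^+ 2))))).
  move=> w; rewrite expr2 big_distrlr/=; apply: eq_bigr => k _.
  by apply: eq_bigr => l _; field.
apply: has_int_sum => // k kphi; rewrite mulr_sumr.
apply: has_int_sum => // l lphi.
have /andP[k1 k2] := h _ kphi; have /andP[l1 l2] := h _ lphi.
rewrite (_ : K * _ = k.1.1 * l.1.1 * 2^-1 * (K * `|k.2 - l.1.2| +
  (K * `|k.1.2 - l.2| + (-1 * (K * `|k.2 - l.2|) + -1 * (K * `|k.1.2 - l.1.2|)))));
  last by ring.
apply: has_intZ => //; apply: has_intD => //; first exact: HK.
apply: has_intD => //; first exact: HK.
by apply: has_intD => //; apply: has_intZ => //; exact: HK.
Qed.

End isometry.

Section indicator_isometry.
Context (R : realType).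
Notation mu := (@lebesgue_measure R).

(** With [H x] the indicator of [[0, x]] this is the hypothesis of
    [has_int_step_sqr] for functions on the line. *)
Lemma has_int_indic_sqr (t x y : R) : 0 <= x <= t -> 0 <= y <= t ->
  has_int mu `[0, t] (fun s => ((\1_(`]0, x]) s : R) - \1_(`]0, y]) s) ^+ 2)
    (1 * `|x - y|).
Proof.
wlog xy : x y / x <= y.
  move=> hw hx hy; have [xy|yx] := leP x y; first exact: hw.
  rewrite distrC; move: (hw _ _ (ltW yx) hy hx).
  by apply: eq_has_int => s; rewrite -sqrrN opprB.
move=> /andP[x0 xt] /andP[y0 yt].
suff : has_int mu `[0, t] (\1_(`]x, y]) : R -> R) (1 * `|x - y|).
  apply: eq_has_int => s; rewrite !indicE !mem_setE !in_itv/=.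
  have [s0|s0] := ltP 0 s => /=; last first.
    rewrite subrr expr0n/=; case: ltP => //= xs.
    by have := lt_le_trans xs s0; rewrite ltNge x0.
  have [sx|sx] := leP s x => /=.
    by rewrite (le_trans sx xy) subrr expr0n.
  by rewrite sub0r sqrrN; case: (s <= y); rewrite /= ?expr1n ?expr0n.
rewrite mul1r; split.
  exact: integrableS (integrable_indic_itv _ _ _ _).
rewrite integral_indic//= setIidl; last first.
  move=> s /=; rewrite !in_itv/= => /andP[h1 h2].
  by rewrite (le_trans x0 (ltW h1)) (le_trans h2 yt).
rewrite lebesgue_measure_itv/= lte_fin; case: ltP => [h|h].
  by rewrite ltr0_norm ?subr_lt0// opprB.
have -> : x = y by apply/eqP; rewrite eq_le xy h.
by rewrite subrr normr0.
Qed.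

Lemma has_int_step_fun_sqr (t : R) phi : step_fun_on t phi ->
  has_int mu `[0, t] (fun s => (step_fun phi s) ^+ 2) (step_form phi).
Proof.
move=> ht; rewrite -[step_form phi]mul1r.
have := has_int_step_sqr _ (@has_int_indic_sqr t) ht.
move=> /(_ (measurable_itv _)); apply: eq_has_int => s; congr (_ ^+ 2).
rewrite /step_fun; apply: eq_big_seq => k /ht[k1 k2 _]; congr (_ * _).
rewrite !indicE !mem_setE !in_itv/=.
have [s0|s0] := ltP 0 s => /=; last first.
  rewrite subrr; case: ltP => //= ks.
  by have := lt_le_trans ks s0; rewrite ltNge k1.
have [sp|sp] := leP s k.1.2 => /=; first by rewrite (le_trans sp k2) subrr.
by rewrite subr0.
Qed.

End indicator_isometry.

Section second_moment.
Context (R : realType).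
Notation mu := (@lebesgue_measure R).

Let msqr : measurable_fun [set: R] (fun x : R => (x ^+ 2)%:E).
Proof. by apply/measurable_EFinP; exact: exprn_measurable. Qed.

(** A wider Gaussian density dominates the square, hence the finiteness of the
    second moment. *)
Let sqr_pdf_le (x : R) :
  x ^+ 2 * normal_pdf 0 1 x <= 4 * Num.sqrt 2 * normal_pdf 0 (Num.sqrt 2) x.
Proof.
have q0 : 0 < Num.sqrt 2 :> R by rewrite sqrtr_gt0.
rewrite !normal_pdfE ?gt_eqF//.
rewrite !normal_peakE// invr1 mul1r; set p := (Num.sqrt (pi *+ 2))^-1.
have p0 : 0 <= p by rewrite invr_ge0 sqrtr_ge0.
have -> : 4 * Num.sqrt 2 * ((Num.sqrt 2)^-1 * p * normal_fun 0 (Num.sqrt 2) x) =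
  p * (4 * normal_fun 0 (Num.sqrt 2) x) by field; rewrite gt_eqF.
rewrite mulrCA.
apply: ler_wpM2l => //; rewrite /normal_fun !subr0 sqr_sqrtr// expr1n.
have -> : - x ^+ 2 / (1 *+ 2) = - (x ^+ 2 / 4) + (- x ^+ 2 / (2 *+ 2)) by field.
rewrite expRD mulrA; apply: ler_wpM2r; first exact: expR_ge0.
rewrite expRN ler_pdivrMr ?expR_gt0//.
have : x ^+ 2 / 4 <= expR (x ^+ 2 / 4).
  by apply: le_trans (expR_ge1Dx _); rewrite lerDr.
by move=> h; lra.
Qed.

(** The second moment enters as a constant only: the isometry is used up to a
    multiplicative constant. *)
Definition normal_moment2 : R := fine (\int[normal_prob 0 1]_x ((x : R) ^+ 2)%:E)%E.

Lemma normal_moment2_ge0 : 0 <= normal_moment2.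
Proof. by apply: fine_ge0; apply: integral_ge0 => x _; rewrite lee_fin sqr_ge0. Qed.

Let normal_moment2_fin :
  (\int[normal_prob 0 1]_x ((x : R) ^+ 2)%:E < +oo)%E.
Proof.
rewrite (ge0_integral_normal_prob 0 1 msqr); last by move=> x; rewrite lee_fin sqr_ge0.
apply: (@le_lt_trans _ _ (\int[mu]_x ((4 * Num.sqrt 2)%:E * (normal_pdf 0 (Num.sqrt 2) x)%:E))%E).
  apply: ge0_le_integral => //.
  - by move=> x _; rewrite -EFinM lee_fin mulr_ge0 ?sqr_ge0 ?normal_pdf_ge0.
  - apply/measurable_EFinP; apply: measurable_funM; first exact: exprn_measurable.
    exact: measurable_normal_pdf.
  - apply/measurable_EFinP; apply: measurable_funM => //.
    exact: measurable_normal_pdf.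
  - by move=> x _; rewrite -!EFinM lee_fin sqr_pdf_le.
rewrite ge0_integralZl_EFin//.
- by rewrite integral_normal_pdf mule1 ltry.
- by move=> x _; rewrite lee_fin normal_pdf_ge0.
- by apply/measurable_EFinP; exact: measurable_normal_pdf.
Qed.

Lemma normal_moment2E (s : R) : 0 < s ->
  (\int[normal_prob 0 s]_x ((x : R) ^+ 2)%:E = (s ^+ 2 * normal_moment2)%:E)%E.
Proof.
move=> s0; have mf := @measurable_affine R s 0.
rewrite (@eq_measure_integral _ (measurableTypeR R) R setT
  (@image_measure _ _ (measurableTypeR R) (measurableTypeR R) R (normal_prob 0 1) _ mf)); last first.
  move=> A mA _; rewrite /image_measure /= /pushforward/=.
  have := @normal_prob_affine R 0 1 s 0 A ltr01 (lt0r_neq0 s0) mA.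
  by move=> ->; rewrite mulr0 addr0 mulr1 gtr0_norm.
have p x : (0 <= ((x : R) ^+ 2)%:E)%E by rewrite lee_fin sqr_ge0.
rewrite ge0_integral_pushforward//.
rewrite preimage_setT /=.
transitivity (\int[normal_prob 0 1]_x ((s ^+ 2)%:E * ((x : R) ^+ 2)%:E))%E.
  by apply: eq_integral => x _; rewrite addr0 exprMn EFinM.
rewrite ge0_integralZl_EFin//; last exact: sqr_ge0.
rewrite [RHS]EFinM; congr (_ * _)%E; rewrite /normal_moment2 fineK// ge0_fin_numE ?normal_moment2_fin//.
by apply: integral_ge0 => x _; exact: p.
Qed.

End second_moment.

Section brownian_moments.
Context d (T : measurableType d) (R : realType) (P : probability T R).
Variables (B : R -> {RV P >-> R}).
Hypothesis hB : brownian_motion B.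
Notation C0 := (normal_moment2 R).

Lemma measurable_incr s t : measurable_fun [set: T] (fun w => B t w - B s w).
Proof. exact: measurable_funB. Qed.

Lemma has_int_brownian_sqr x y :
  has_int P [set: T] (fun w => (B x w - B y w) ^+ 2) (C0 * `|x - y|).
Proof.
wlog yx : x y / y < x.
  move=> hw; have [/hw//|xy|->] := ltgtP y x.
    rewrite distrC; move: (hw _ _ xy).
    by apply: eq_has_int => w; rewrite -sqrrN opprB.
  rewrite subrr normr0 mulr0.
  move: (has_int0 P [set: T]).
  by apply: eq_has_int => w; rewrite subrr expr0n.
have mf := measurable_incr y x.
have d0 : 0 < Num.sqrt (x - y) by rewrite sqrtr_gt0 subr_gt0.
have E : (\int[P]_w ((B x w - B y w) ^+ 2)%:E = (C0 * `|x - y|)%:E)%E.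
  have := normal_moment2E d0; rewrite sqr_sqrtr ?subr_ge0 ?ltW// => h.
  rewrite gtr0_norm ?subr_gt0// mulrC -h.
  rewrite (@eq_measure_integral _ (measurableTypeR R) R setT
    (@image_measure _ _ _ (measurableTypeR R) R P _ mf)); last first.
    by move=> A mA _; case: hB => _ _ h3 _; exact/esym/(h3 _ _ yx _ mA).
  rewrite ge0_integral_pushforward//.
  - by apply/measurable_EFinP; exact: exprn_measurable.
  - by move=> z _; rewrite lee_fin sqr_ge0.
split => //; apply/integrableP; split.
  by apply/measurable_EFinP; exact: (measurableT_comp (@exprn_measurable R setT 2)).
rewrite (eq_integral (fun w => ((B x w - B y w) ^+ 2)%:E)) ?E ?ltry//.
by move=> w _; rewrite /= ger0_norm// sqr_ge0.
Qed.

(** Both sides are multiples of the same quadratic form [step_form]. *)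
Lemma step_integral_isometry t phi : step_fun_on t phi ->
  (\int[P]_w ((step_integral B phi w) ^+ 2)%:E =
   C0%:E * \int[lebesgue_measure]_(s in `[0%R, t]) ((step_fun phi s) ^+ 2)%:E)%E.
Proof.
move=> ht; have [_ ->] := has_int_step_fun_sqr ht; rewrite -EFinM.
by have [] := has_int_step_sqr (@measurableT _ T)
  (fun x y _ _ => has_int_brownian_sqr x y) ht.
Qed.

End brownian_moments.

(** * The integral process as a limit of Riemann sums *)

Lemma integral_sqr_le3 d (T : measurableType d) (R : realType)
    (mu : {measure set T -> \bar R}) (D : set T) (f a b c : T -> R) :
  measurable D -> measurable_fun D f -> measurable_fun D a ->
  measurable_fun D b -> measurable_fun D c ->
  (forall x, D x -> `|f x| <= `|a x| + `|b x| + `|c x|) ->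
  (\int[mu]_(x in D) ((f x) ^+ 2)%:E <=
   3%:E * (\int[mu]_(x in D) ((a x) ^+ 2)%:E + \int[mu]_(x in D) ((b x) ^+ 2)%:E
    + \int[mu]_(x in D) ((c x) ^+ 2)%:E))%E.
Proof.
move=> mD mf ma mb mc le3.
have msq (g : T -> R) : measurable_fun D g -> measurable_fun D (fun x => (g x ^+ 2)%:E).
  by move=> mg; apply/measurable_EFinP; exact: measurable_funX.
have sq0 (g : T -> R) x : (0 <= ((g x) ^+ 2)%:E)%E by rewrite lee_fin sqr_ge0.
rewrite -ge0_integralD//; [|exact: msq|exact: msq].
rewrite -ge0_integralD//; last 3 first.
- by move=> x _; rewrite adde_ge0.
- by apply: emeasurable_funD; exact: msq.
- exact: msq.
rewrite -ge0_integralZl_EFin//; last 2 first.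
- by move=> x _; rewrite !adde_ge0.
- by do 2?[apply: emeasurable_funD]; exact: msq.
apply: ge0_le_integral => //.
- exact: msq.
- by apply: measurable_funeM; do 2?[apply: emeasurable_funD]; exact: msq.
move=> x Dx; rewrite -!EFinD -EFinM lee_fin.
have := le3 x Dx; rewrite -(real_normK (num_real (f x))) -(real_normK (num_real (a x)))
  -(real_normK (num_real (b x))) -(real_normK (num_real (c x))).
have := normr_ge0 (f x); have := normr_ge0 (a x).
have := normr_ge0 (b x); have := normr_ge0 (c x).
move: (`|a x|) (`|b x|) (`|c x|) (`|f x|) => p q s z s0 q0 p0 z0 h.
apply: (@le_trans _ _ ((p + q + s) ^+ 2)).
  by rewrite ler_sqr ?nnegrE ?addr_ge0.
have := sqr_ge0 (p - q); have := sqr_ge0 (p - s); have := sqr_ge0 (q - s).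
by move=> h1 h2 h3; nra.
Qed.

(** The function [x |-> exp (- delta x)] has derivative at most [delta] in
    absolute value on the half-line. *)
Lemma discount_lip {R : realType} (delta x y : R) : 0 <= delta -> 0 <= x -> 0 <= y ->
  `|expR (- (delta * x)) - expR (- (delta * y))| <= delta * `|x - y|.
Proof.
move=> d0; wlog xy : x y / x <= y.
  move=> hw x0 y0; have [xy|/ltW yx] := leP x y; first exact: hw.
  by rewrite distrC (distrC x); exact: hw.
move=> x0 y0; rewrite (distrC x) !ger0_norm ?subr_ge0//; last first.
  by rewrite ler_expR lerN2 ler_wpM2l.
have -> : expR (- (delta * y)) = expR (- (delta * x)) * expR (- (delta * (y - x))).
  by rewrite -expRD; congr expR; ring.
have e1 : expR (- (delta * x)) <= 1 by rewrite -[leRHS]expR0 ler_expR oppr_le0 mulr_ge0.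
have e0 := expR_gt0 (- (delta * x)).
have := expR_ge1Dx (- (delta * (y - x))).
have : 0 <= delta * (y - x) by rewrite mulr_ge0// subr_ge0.
move: (expR (- (delta * x))) e0 e1 (delta * (y - x)) (expR _) => e e0 e1 z g z0 h.
by nra.
Qed.

Section riemann_sums.
Context {R : realType}.
Implicit Types (delta t r s : R) (f : R -> R).

(** The left Riemann-Stieltjes sum of [int_0^t e^{-delta s} df(s)] over the
    dyadic subdivision of [[0, t]] of order [N]. *)
Definition riem delta f t (N : nat) : R :=
  \sum_(0 <= k < 2 ^ N) expR (- (delta * (t * k%:R / (2 ^ N)%:R))) *
    (f (t * k.+1%:R / (2 ^ N)%:R) - f (t * k%:R / (2 ^ N)%:R)).

(** The step function behind [riem], for the path shifted by [r]. *)
Definition riem_steps delta r t (N : nat) : seq (R * R * R) :=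
  [seq (expR (- (delta * (r + t * k%:R / (2 ^ N)%:R))),
        r + t * k%:R / (2 ^ N)%:R, r + t * k.+1%:R / (2 ^ N)%:R)
  | k <- index_iota 0 (2 ^ N)].

Lemma step_integral_riem d (T : measurableType d) (B : R -> T -> R) delta r t N w :
  step_integral B (riem_steps delta r t N) w =
  expR (- (delta * r)) * riem delta (fun s => B (r + s) w - B r w) t N.
Proof.
rewrite /step_integral big_map /riem mulr_sumr; apply: eq_bigr => k _ /=.
rewrite mulrA -expRD; congr (expR _ * _); first by ring.
by rewrite opprB addrA subrK.
Qed.

Let n2_gt0 N : 0 < (2 ^ N)%:R :> R. Proof. by rewrite ltr0n expn_gt0. Qed.

Lemma riem_steps_on delta r t N : 0 <= r -> 0 <= t ->
  step_fun_on (r + t) (riem_steps delta r t N).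
Proof.
move=> r0 t0 _ /mapP[k + ->] /=; rewrite mem_index_iota /= => kn.
split; first by rewrite addr_ge0// divr_ge0// mulr_ge0.
  by rewrite lerD2l ler_pM2r ?invr_gt0// ler_wpM2l// ler_nat.
by rewrite lerD2l ler_pdivrMr// ler_wpM2l// ler_nat.
Qed.

Lemma riem_steps_approx delta r t N s : 0 <= delta -> 0 <= r -> 0 <= t ->
  `|step_fun (riem_steps delta r t N) s -
    expR (- (delta * s)) * ((s <= r + t)%R%:R - (s <= r)%R%:R)|
  <= delta * t / (2 ^ N)%:R.
Proof.
move=> d0 r0 t0; set n := (2 ^ N)%N; have n0 : 0 < n%:R :> R by exact: n2_gt0.
pose p k : R := r + t * k%:R / n%:R.
have p_nd k : p k <= p k.+1.
  by rewrite lerD2l ler_pM2r ?invr_gt0// ler_wpM2l// ler_nat.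
pose ind k : R := (s <= p k.+1)%R%:R - (s <= p k)%R%:R.
have indE k : \1_(`]p k, p k.+1]) s = ind k.
  rewrite indicE mem_setE in_itv/= /ind.
  have [sp|sp] := leP s (p k); first by rewrite (le_trans sp (p_nd _)) subrr.
  by rewrite subr0.
have ind0 k : 0 <= ind k by rewrite -indE.
have sum_ind : \sum_(0 <= k < n) ind k = (s <= r + t)%R%:R - (s <= r)%R%:R.
  rewrite telescope_sumr// /p mulr0 mul0r addr0 mulfK//; exact: lt0r_neq0.
rewrite /step_fun big_map -sum_ind mulr_sumr -sumrB.
under eq_bigr do rewrite /= -/(p _) -/(p _) indE -mulrBl.
apply: le_trans (ler_norm_sum _ _ _) _.
apply: (@le_trans _ _ (\sum_(0 <= k < n) (delta * t / n%:R) * ind k)).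
  apply: ler_sum_nat => k _; rewrite normrM (ger0_norm (ind0 k)).
  have [sp|sp] := leP s (p k).
    by rewrite /ind sp (le_trans sp (p_nd _)) subrr !mulr0.
  have [sp'|sp'] := leP s (p k.+1); last first.
    suff -> : ind k = 0 by rewrite !mulr0.
    by rewrite /ind !leNgt sp sp' subrr.
  have pk : 0 <= p k by rewrite addr_ge0// divr_ge0// mulr_ge0.
  have pks := ltW sp.
  apply: ler_wpM2r => //; apply: le_trans (discount_lip d0 pk (le_trans pk pks)) _.
  rewrite -mulrA; apply: ler_wpM2l => //; rewrite distrC ger0_norm ?subr_ge0// lerBlDl.
  apply: le_trans sp' _; rewrite /p -addrA lerD2l -mulrDl -[leRHS]/_.
  by rewrite -[X in _ <= (_ + X) / _]mulr1 -mulrDr -natr1.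
rewrite -mulr_sumr sum_ind ler_piMr//.
  by rewrite divr_ge0 ?mulr_ge0// ltW.
by case: (s <= r + t); case: (s <= r) => /=; lra.
Qed.

End riemann_sums.

(** The first Borel-Cantelli argument in integrated form: a geometric bound on
    the integrals makes the series of the functions finite almost everywhere. *)
Lemma ae_cvg0_geometric d (T : measurableType d) (R : realType)
    (mu : {measure set T -> \bar R}) (f : nat -> T -> R) (K z : R) :
  (forall n, measurable_fun [set: T] (f n)) -> (forall n x, 0 <= f n x) ->
  0 <= K -> 0 <= z < 1 ->
  (forall n, \int[mu]_x (f n x)%:E <= (K * z ^+ n)%:E)%E ->
  {ae mu, forall x, f ^~ x @ \oo --> 0}.
Proof.
move=> mf f0 K0 /andP[z0 z1] fK.
pose g x := (\sum_(n <oo) (f n x)%:E)%E.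
have mfE n : measurable_fun [set: T] (fun x => (f n x)%:E).
  by apply/measurable_EFinP.
have mg : measurable_fun [set: T] g.
  by apply: ge0_emeasurable_sum => // n x _ _; rewrite lee_fin.
have g0 x : (0 <= g x)%E by apply: nneseries_ge0 => n _ _; rewrite lee_fin.
have ig : mu.-integrable [set: T] g.
  apply/integrableP; split=> //.
  under eq_integral do rewrite gee0_abs//.
  rewrite /g integral_nneseries//; last by move=> n x _; rewrite lee_fin.
  apply: (@le_lt_trans _ _ (K / (1 - z))%:E); last exact: ltry.
  apply: lime_le; first by apply: is_cvg_nneseries => n _ _; apply: integral_ge0 => x _; rewrite lee_fin.
  apply: nearW => n; apply: (@le_trans _ _ (\sum_(0 <= k < n) (K * z ^+ k)%:E)%E).
    exact: lee_sum.
  rewrite sumEFin lee_fin -mulr_sumr; apply: ler_wpM2l => //.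
  have E : (\sum_(0 <= k < n) z ^+ k) * (1 - z) = 1 - z ^+ n.
    elim: n => [|n IH]; first by rewrite big_geq// mul0r expr0 subrr.
    by rewrite big_nat_recr//= mulrDl IH exprS; ring.
  rewrite -[leRHS]mul1r ler_pdivlMr ?subr_gt0// E.
  by rewrite gerBl exprn_ge0.
move: (integrable_ae measurableT ig); apply: filterS => x /(_ I) gx.
apply: cvg_series_cvg_0; apply: nondecreasing_is_cvgn.
  by apply: nondecreasing_series => n _ _.
exists (fine (g x)) => _ [n _ <-]; rewrite -lee_fin fineK// /series/= -sumEFin.
by apply: nneseries_lim_ge => k _ _; rewrite lee_fin.
Qed.

Section wiener_riemann.
Context d (T : measurableType d) (R : realType) (P : probability T R).
Variables (B J : R -> {RV P >-> R}) (delta : R).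
Hypotheses (delta0 : 0 <= delta) (hB : brownian_motion B).
Hypothesis hJ : wiener_integral_process B (fun s => expR (- (delta * s))) J.
Notation C0 := (normal_moment2 R).
Notation mu := (@lebesgue_measure R).

(** The increment of the integral process after time [r], brought back to the
    scale of a process started afresh. *)
Definition restarted (r t : R) (w : T) : R :=
  expR (delta * r) * (J (r + t) w - J r w).

Lemma measurable_step_integral phi :
  measurable_fun [set: T] (step_integral B phi).
Proof.
apply: measurable_sum => k; apply: measurable_funM => //.
exact: measurable_funB.
Qed.

Lemma measurable_step_fun phi : measurable_fun [set: R] (@step_fun R phi).
Proof.
by apply: measurable_sum => k; apply: measurable_funM.
Qed.

Let neg (phi : seq (R * R * R)) : seq (R * R * R) :=
  [seq (- k.1.1, k.1.2, k.2) | k <- phi].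

Let step_integral_neg phi w : step_integral B (neg phi) w = - step_integral B phi w.
Proof.
by rewrite /step_integral big_map -sumrN; apply: eq_bigr => k _; rewrite /= mulNr.
Qed.

Let step_fun_neg phi s : step_fun (neg phi) s = - step_fun phi s :> R.
Proof.
by rewrite /step_fun big_map -sumrN; apply: eq_bigr => k _; rewrite /= mulNr.
Qed.

Lemma step_fun_out t phi s : step_fun_on t phi -> t < s -> step_fun phi s = 0 :> R.
Proof.
move=> ht ts; rewrite /step_fun big_seq big1// => k /ht[_ _ kt].
by rewrite indicE mem_setE in_itv/= [s <= _]leNgt (le_lt_trans kt ts) andbF mulr0.
Qed.

(** [J (r + t)] and [J r] are replaced by integrals of step functions; the isometry
    turns what remains into an [L^2] distance between the corresponding step
    functions, all of which are close to the exponential on their supports. *)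
Let riem_restarted_approx r t N phi psi : 0 <= r -> 0 <= t ->
  step_fun_on (r + t) phi -> step_fun_on r psi ->
  (\int[P]_w ((expR (- (delta * r)) * (riem delta (fun s => B (r + s) w - B r w) t N
      - restarted r t w)) ^+ 2)%:E <=
   3%:E * (C0%:E * (3%:E * (((delta * t / (2 ^ N)%:R) ^+ 2 * (r + t))%:E
      + \int[mu]_(s in `[0%R, (r + t)%R]) ((step_fun phi s - expR (- (delta * s))) ^+ 2)%:E
      + \int[mu]_(s in `[0%R, r]) ((step_fun psi s - expR (- (delta * s))) ^+ 2)%:E))
    + 'E_P[fun w => ((step_integral B phi w - J (r + t) w) ^+ 2)%R]
    + 'E_P[fun w => ((step_integral B psi w - J r w) ^+ 2)%R]))%E.
Proof.
move=> r0 t0 hphi hpsi; have rt : r <= r + t by rewrite lerDl.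
pose all3 := riem_steps delta r t N ++ neg phi ++ psi.
have all3on : step_fun_on (r + t) all3.
  move=> k; rewrite !mem_cat => /or3P[|/mapP[l /hphi + ->]|/hpsi[? ? ?]] //.
    exact: riem_steps_on.
  by split => //; exact: le_trans rt.
have I3 w : step_integral B all3 w = step_integral B (riem_steps delta r t N) w
    - step_integral B phi w + step_integral B psi w.
  by rewrite -step_integral_neg /step_integral !big_cat/= addrA.
have S3 s : step_fun all3 s = step_fun (riem_steps delta r t N) s
    - step_fun phi s + step_fun psi s.
  by rewrite -step_fun_neg /step_fun !big_cat/= addrA.
have mS := measurable_step_fun.
have mI := measurable_step_integral.
have mexp : measurable_fun [set: R] (fun s => expR (- (delta * s))).
  apply: (measurableT_comp (@measurable_expR R)).
  exact: (measurableT_comp (@oppr_measurable R setT)).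
have mri : measurable_fun [set: T] (fun w => expR (- (delta * r)) *
    (riem delta (fun s => B (r + s) w - B r w) t N - restarted r t w)).
  apply: measurable_funM => //; apply: measurable_funB.
    apply: measurable_sum => k; apply: measurable_funM => //.
    by apply: measurable_funB; exact: measurable_funB.
  by apply: measurable_funM => //; exact: measurable_funB.
apply: le_trans (@integral_sqr_le3 _ _ _ P setT _ (step_integral B all3)
  (fun w => step_integral B phi w - J (r + t) w)
  (fun w => step_integral B psi w - J r w) _ _ _ _ _ _) _ => //.
- by apply: measurable_funB.
- by apply: measurable_funB.
- move=> w _; rewrite mulrBr -(step_integral_riem (fun x => B x)) /restarted mulrA -expRD addNr.
  rewrite expR0 mul1r I3.
  set a := step_integral B (riem_steps _ _ _ _) w.
  have -> : a - (J (r + t) w - J r w) =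
    (a - step_integral B phi w + step_integral B psi w)
    + (step_integral B phi w - J (r + t) w) - (step_integral B psi w - J r w) by ring.
  by rewrite (le_trans (ler_normB _ _))// lerD2r ler_normD.
rewrite unlock lee_pmul2l//; apply: leeD => //; apply: leeD => //.
rewrite (step_integral_isometry hB all3on).
apply: lee_wpmul2l; first by rewrite lee_fin normal_moment2_ge0.
pose a s := step_fun (riem_steps delta r t N) s -
    expR (- (delta * s)) * ((s <= r + t)%R%:R - (s <= r)%R%:R).
pose b s := step_fun phi s - expR (- (delta * s)).
pose c s := (step_fun psi s - expR (- (delta * s))) * \1_(`[0, r]) s.
have mle u : measurable_fun [set: R] (fun s : R => (s <= u)%R%:R : R).
  rewrite (_ : (fun s => _) = \1_(`]-oo, u])).
    exact: measurable_indic.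
  by apply/funext => s; rewrite indicE mem_setE in_itv.
have ma : measurable_fun [set: R] a.
  apply: measurable_funB => //; apply: measurable_funM => //.
  exact: measurable_funB.
have mb : measurable_fun [set: R] b by exact: measurable_funB.
have mc : measurable_fun [set: R] c.
  by apply: measurable_funM; [exact: measurable_funB|exact: measurable_indic].
have mD : measurable (`[0, r + t]%classic : set R) by exact: measurable_itv.
have bnd s : `[0, r + t]%classic s ->
    `|step_fun all3 s| <= `|a s| + `|b s| + `|c s|.
  rewrite /= in_itv/= => /andP[s0 srt].
  rewrite S3.
  have -> : step_fun (riem_steps delta r t N) s - step_fun phi s + step_fun psi s =
      a s - b s + c s.
    rewrite /a /b /c srt indicE mem_setE in_itv/= s0/=.
    have [sr|rs] := leP s r; first by rewrite /=; ring.
    by rewrite (step_fun_out hpsi rs) /=; ring.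
  by rewrite (le_trans (ler_normD _ _))// lerD2r ler_normB.
apply: (le_trans (integral_sqr_le3 mu mD (measurable_funTS (mS all3))
  (measurable_funTS ma) (measurable_funTS mb) (measurable_funTS mc) bnd)).
rewrite lee_pmul2l//; apply: leeD; first apply: leeD => //.
- apply: (@le_trans _ _ (\int[mu]_(s in `[0%R, (r + t)%R]) ((delta * t / (2 ^ N)%:R) ^+ 2)%:E)%E).
    apply: ge0_le_integral => //.
    + by move=> s _; rewrite lee_fin sqr_ge0.
    + by apply/measurable_EFinP; apply: measurable_funX; exact: measurable_funTS.
    + move=> s _; rewrite lee_fin -(real_normK (num_real (a s))).
      rewrite ler_sqr ?nnegrE ?divr_ge0 ?mulr_ge0//.
      exact: riem_steps_approx.
  rewrite integral_cst//= lebesgue_measure_itv/= lte_fin.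
  case: ifPn => _; first by rewrite oppr0 adde0.
  by rewrite mule0 lee_fin mulr_ge0 ?sqr_ge0// addr_ge0.
- rewrite -[X in (_ <= integral _ X _)%E](@setIidl _ _ `[0, r + t]%classic); last first.
    move=> s /=; rewrite !in_itv/= => /andP[-> h]; exact: le_trans rt.
  rewrite integral_mkcondl le_eqVlt; apply/orP; left; apply/eqP.
  apply: eq_integral => s _; rewrite patchE /c indicE; case: ifPn => h.
    by rewrite mulr1.
  by rewrite mulr0 expr0n.
Qed.

(** [riem_restarted_approx] in the limit of better and better approximations,
    which leaves the error of the Riemann sum alone. *)
Lemma integral_riem_restarted r t N : 0 <= r -> 0 <= t ->
  (\int[P]_w ((expR (- (delta * r)) * (riem delta (fun s => B (r + s) w - B r w) t N
      - restarted r t w)) ^+ 2)%:E <=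
   (9 * C0 * ((delta * t / (2 ^ N)%:R) ^+ 2 * (r + t)))%:E)%E.
Proof.
move=> r0 t0; have [_ _ wJ] := hJ.
have [phi [hphi cphi ephi]] := wJ _ (addr_ge0 r0 t0).
have [psi [hpsi cpsi epsi]] := wJ _ r0.
pose x n := (\int[mu]_(s in `[0%R, (r + t)%R])
  ((step_fun (phi n) s - expR (- (delta * s))) ^+ 2)%:E)%E.
pose y n := (\int[mu]_(s in `[0%R, r]) ((step_fun (psi n) s - expR (- (delta * s))) ^+ 2)%:E)%E.
pose z n := ('E_P[fun w => ((step_integral B (phi n) w - J (r + t) w) ^+ 2)%R])%E.
pose v n := ('E_P[fun w => ((step_integral B (psi n) w - J r w) ^+ 2)%R])%E.
pose e := ((delta * t / (2 ^ N)%:R) ^+ 2 * (r + t))%:E : \bar R.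
have lim : (fun n => (3%:E * (C0%:E * (3%:E * (e + x n + y n)) + z n + v n))%E) @ \oo -->
    (3%:E * (C0%:E * (3%:E * (e + 0 + 0)) + 0 + 0))%E.
  apply: cvgeZl => //; apply: cvgeD => //; apply: cvgeD => //.
  apply: cvgeZl => //; apply: cvgeZl => //; apply: cvgeD => //; apply: cvgeD => //.
  exact: cvg_cst.
have -> : ((9 * C0 * ((delta * t / (2 ^ N)%:R) ^+ 2 * (r + t)))%:E =
    3%:E * (C0%:E * (3%:E * (e + 0 + 0)) + 0 + 0))%E.
  by rewrite !adde0 /e -!EFinM; congr EFin; ring.
rewrite -(cvg_lim _ lim)//; apply: lime_ge; first by apply/cvg_ex; eexists; exact: lim.
apply: nearW => n; exact: riem_restarted_approx.
Qed.

(** The mean square error is of order [4^-N], so that [ae_cvg0_geometric] applies.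
    This makes the integral after time [r] a function of the Brownian path after
    [r]. *)
Lemma ae_riem_restarted r t : 0 <= r -> 0 <= t ->
  {ae P, forall w, riem delta (fun s => B (r + s) w - B r w) t @ \oo --> restarted r t w}.
Proof.
move=> r0 t0.
pose D N w := expR (- (delta * r)) *
  (riem delta (fun s => B (r + s) w - B r w) t N - restarted r t w).
have mD N : measurable_fun [set: T] (D N).
  apply: measurable_funM => //; apply: measurable_funB.
    apply: measurable_sum => k; apply: measurable_funM => //.
    by apply: measurable_funB; exact: measurable_funB.
  by apply: measurable_funM => //; exact: measurable_funB.
have h1 N : measurable_fun [set: T] (fun w => D N w ^+ 2) by exact: measurable_funX.
have h2 N w : 0 <= D N w ^+ 2 by exact: sqr_ge0.
have h3 : 0 <= 9 * C0 * ((delta * t) ^+ 2 * (r + t)).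
  by rewrite !mulr_ge0 ?sqr_ge0 ?addr_ge0 ?normal_moment2_ge0.
have h4 : 0 <= (4^-1 : R) < 1 by apply/andP; split; lra.
have h5 N : (\int[P]_w (D N w ^+ 2)%:E <=
    (9 * C0 * ((delta * t) ^+ 2 * (r + t)) * 4^-1 ^+ N)%:E)%E.
  apply: le_trans (integral_riem_restarted N r0 t0) _; rewrite lee_fin.
  rewrite le_eqVlt; apply/orP; left; apply/eqP.
  have -> : 4^-1 ^+ N = ((2 ^ N)%:R^-1) ^+ 2 :> R.
    by rewrite natrX -exprVn -exprM mulnC exprM; congr (_ ^+ N); lra.
  by rewrite exprMn; ring.
have Q := ae_cvg0_geometric h1 h2 h3 h4 h5.
apply: (filterS _ Q) => w Dw.
have {}Dw : D ^~ w @ \oo --> 0.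
  apply/norm_cvg0P; rewrite -[X in _ --> X]sqrtr0.
  under eq_fun do rewrite -sqrtr_sqr.
  by apply: (cvg_comp _ _ Dw); exact: sqrt_continuous.
have Y : (fun N => expR (delta * r) * D N w + restarted r t w) @ \oo -->
    expR (delta * r) * 0 + restarted r t w.
  by apply: cvgD; [apply: cvgM => //; exact: cvg_cst|exact: cvg_cst].
rewrite mulr0 add0r in Y; apply: cvg_trans Y; apply: near_eq_cvg.
by apply: nearW => N; rewrite /D mulrA -expRD subrr expR0 mul1r subrK.
Qed.

End wiener_riemann.

(** * Integrals of exponentials *)

Section exp_primitive.
Context {R : realType}.
Implicit Types lambda p q t : R.

(** The integral of [exp (- lambda s)] over [[0, t]], in closed form. *)
Definition exp_primitive lambda t : R :=
  if lambda == 0 then t else (1 - expR (- (lambda * t))) / lambda.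

Lemma exp_primitive0 lambda : exp_primitive lambda 0 = 0.
Proof.
by rewrite /exp_primitive; case: ifP => // _; rewrite mulr0 oppr0 expR0 subrr mul0r.
Qed.

Lemma exp_primitive_bounds lambda p q : 0 <= lambda -> p <= q ->
  expR (- (lambda * q)) * (q - p) <= exp_primitive lambda q - exp_primitive lambda p
    <= expR (- (lambda * p)) * (q - p).
Proof.
move=> l0 pq; rewrite /exp_primitive; have [->|ln0] := eqVneq lambda 0.
  by rewrite !mul0r oppr0 expR0 !mul1r lexx.
have {}l0 : 0 < lambda by rewrite lt_neqAle eq_sym ln0.
rewrite -mulrBl (_ : 1 - expR (- (lambda * q)) - (1 - expR (- (lambda * p))) =
  expR (- (lambda * p)) - expR (- (lambda * q))); last by ring.
have e1 : expR (- (lambda * q)) = expR (- (lambda * p)) * expR (- (lambda * (q - p))).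
  by rewrite -expRD; congr expR; ring.
have e2 : expR (- (lambda * p)) = expR (- (lambda * q)) * expR (lambda * (q - p)).
  by rewrite -expRD; congr expR; ring.
have h1 := expR_ge1Dx (- (lambda * (q - p))).
have h2 := expR_ge1Dx (lambda * (q - p)).
apply/andP; split.
  rewrite ler_pdivlMr// [in leRHS]e2 -[X in _ <= _ - X]mulr1 -mulrBr -mulrA.
  by apply: ler_wpM2l; [exact: expR_ge0|lra].
rewrite ler_pdivrMr// [in leLHS]e1 -[X in X - _ <= _]mulr1 -mulrBr -mulrA.
by apply: ler_wpM2l; [exact: expR_ge0|lra].
Qed.

Lemma exp_primitive_lt lambda p q : 0 <= lambda -> p < q ->
  exp_primitive lambda p < exp_primitive lambda q.
Proof.
move=> l0 pq; have /andP[h _] := exp_primitive_bounds l0 (ltW pq).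
by rewrite -subr_gt0; apply: lt_le_trans h; rewrite mulr_gt0 ?expR_gt0 ?subr_gt0.
Qed.

Lemma exp_primitive_le lambda p q : 0 <= lambda -> p <= q ->
  exp_primitive lambda p <= exp_primitive lambda q.
Proof. by move=> l0; rewrite le_eqVlt => /predU1P[->//|/exp_primitive_lt/ltW]; apply. Qed.

Lemma exp_primitive_ge0 lambda t : 0 <= lambda -> 0 <= t -> 0 <= exp_primitive lambda t.
Proof. by move=> l0 t0; rewrite -(exp_primitive0 lambda) exp_primitive_le. Qed.

Lemma exp_primitive_gt0 lambda t : 0 <= lambda -> 0 < t -> 0 < exp_primitive lambda t.
Proof. by move=> l0 t0; rewrite -(exp_primitive0 lambda) exp_primitive_lt. Qed.

Lemma exp_primitiveB lambda p q : 0 <= lambda -> 0 <= p -> p <= q ->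
  exp_primitive lambda q - exp_primitive lambda p <= q - p.
Proof.
move=> l0 p0 pq; have /andP[_ h] := exp_primitive_bounds l0 pq.
apply: (le_trans h); rewrite ler_piMl ?subr_ge0//.
by rewrite -expR0 ler_expR oppr_le0 mulr_ge0.
Qed.

Lemma exp_primitive_id lambda t : 0 <= lambda -> 0 <= t -> exp_primitive lambda t <= t.
Proof.
move=> l0 t0; have := exp_primitiveB l0 (lexx 0) t0.
by rewrite exp_primitive0 !subr0.
Qed.

Lemma exp_primitiveD lambda p q :
  exp_primitive lambda (p + q) =
  exp_primitive lambda p + expR (- (lambda * p)) * exp_primitive lambda q.
Proof.
rewrite /exp_primitive; have [->|ln0] := eqVneq lambda 0.
  by rewrite mul0r oppr0 expR0 mul1r.
rewrite mulrDr opprD expRD; by field.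
Qed.

(** The variance of the dyadic Riemann sum of order [N] over [0, r]. *)
Definition riem_var delta r (N : nat) : R :=
  \sum_(0 <= k < 2 ^ N) expR (- (2 * delta * (r * k%:R / (2 ^ N)%:R))) * (r / (2 ^ N)%:R).

(** On each cell the error is at most [2 * delta] times the square of its width. *)
Lemma cvg_riem_var delta r : 0 <= delta -> 0 <= r ->
  riem_var delta r N @[N --> \oo] --> exp_primitive (2 * delta) r.
Proof.
move=> d0 r0; have d20 : 0 <= 2 * delta by rewrite mulr_ge0.
have bnd N : `|riem_var delta r N - exp_primitive (2 * delta) r| <=
    2 * delta * r ^+ 2 * (2^-1) ^+ N.
  have n0 : 0 < (2 ^ N)%:R :> R by rewrite ltr0n expn_gt0.
  pose p k : R := r * k%:R / (2 ^ N)%:R.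
  have pS k : p k.+1 - p k = r / (2 ^ N)%:R by rewrite /p -natr1; field; rewrite gt_eqF.
  have p0 k : 0 <= p k by rewrite divr_ge0 ?mulr_ge0// ltW.
  have pp k : p k <= p k.+1 by rewrite -subr_ge0 pS divr_ge0// ltW.
  have -> : exp_primitive (2 * delta) r =
      \sum_(0 <= k < 2 ^ N) (exp_primitive (2 * delta) (p k.+1) - exp_primitive (2 * delta) (p k)).
    rewrite telescope_sumr// /p mulr0 mul0r exp_primitive0 subr0 mulfK//.
  rewrite /riem_var -sumrB; apply: le_trans (ler_norm_sum _ _ _) _.
  apply: (@le_trans _ _ (\sum_(0 <= k < 2 ^ N) (2 * delta * (r / (2 ^ N)%:R) ^+ 2))).
    apply: ler_sum_nat => k _; rewrite -/(p k) -(pS k).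
    have /andP[h1 h2] := exp_primitive_bounds d20 (pp k).
    rewrite ger0_norm ?subr_ge0//.
    have e1 : expR (- (2 * delta * p k.+1)) =
        expR (- (2 * delta * p k)) * expR (- (2 * delta * (p k.+1 - p k))).
      by rewrite -expRD; congr expR; ring.
    have h3 := expR_ge1Dx (- (2 * delta * (p k.+1 - p k))).
    have h4 : expR (- (2 * delta * p k)) <= 1.
      by rewrite -[leRHS]expR0 ler_expR oppr_le0; apply: mulr_ge0; [exact: d20|exact: p0].
    have h5 := expR_gt0 (- (2 * delta * p k)).
    have h6 : 0 <= p k.+1 - p k by rewrite subr_ge0.
    have h7 : 0 <= 2 * delta * (p k.+1 - p k) by rewrite mulr_ge0.
    apply: (@le_trans _ _ ((expR (- (2 * delta * p k)) - expR (- (2 * delta * p k.+1))) * (p k.+1 - p k))).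
      by rewrite mulrBl lerD2l lerN2.
    rewrite expr2 mulrA; apply: ler_wpM2r => //; rewrite e1.
    move: h3 h4 h5 h7; set z := 2 * delta * (p k.+1 - p k).
    set e := expR (- (2 * delta * p k)); set e' := expR (- z) => h3 h4 h5 h7.
    have h8 : 0 <= e * (e' - (1 - z)) by rewrite mulr_ge0 ?subr_ge0// ltW.
    have h9 : 0 <= (1 - e) * z by rewrite mulr_ge0// subr_ge0.
    by lra.
  rewrite big_const_nat subn0 iter_addr_0 -[leLHS]mulr_natl.
  rewrite le_eqVlt; apply/orP; left; apply/eqP.
  have -> : 2^-1 ^+ N = ((2 ^ N)%:R)^-1 :> R by rewrite natrX exprVn.
  move: n0; move: ((2 ^ N)%:R : R) => n n0.
  by field; rewrite gt_eqF.
apply/cvgrPdist_le => e e0.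
have c : (fun N => 2 * delta * r ^+ 2 * (2^-1) ^+ N) @ \oo --> (0 : R).
  rewrite -[X in _ --> X](mulr0 (2 * delta * r ^+ 2)); apply: cvgM; first exact: cvg_cst.
  by apply: cvg_expr; rewrite ger0_norm; lra.
move/cvgrPdist_le : c => /(_ _ e0); apply: filterS => N.
rewrite sub0r normrN => h; rewrite distrC; apply: le_trans (bnd N) _.
exact: le_trans (ler_norm _) h.
Qed.

End exp_primitive.

(** * Independence of the past integral and the future path *)

Section gaussian_past.
Context d (T : measurableType d) (R : realType) (P : probability T R).
Variables (B J : R -> {RV P >-> R}) (delta : R).
Hypotheses (delta0 : 0 <= delta) (hB : brownian_motion B).
Hypothesis hJ : wiener_integral_process B (fun s => expR (- (delta * s))) J.
Variables (r : R) (t : nat -> R) (m : nat) (A : nat -> set R).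
Hypotheses (r0 : 0 < r) (t0 : t 0%N = 0) (t_nd : forall i, t i <= t i.+1).
Hypothesis mA : forall i, measurable (A i).

Definition incr_event (r : R) : set T :=
  [set w | forall i, (i < m)%N -> A i (B (r + t i.+1) w - B (r + t i) w)].

(** The [n] equal cells of [[0, r]] followed by the grid [t] shifted by [r]: one
    nondecreasing sequence for the past and the future. *)
Let tau n i : R := if (i < n)%N then r * i%:R / n%:R else r + t (i - n).

Let tau_past n i : (i <= n)%N -> (0 < n)%N -> tau n i = r * i%:R / n%:R.
Proof.
rewrite /tau leq_eqVlt => /predU1P[->|->//] n0; rewrite ltnn subnn t0 addr0.
by rewrite mulfK// pnatr_eq0 -lt0n.
Qed.

Let tau_future n i : tau n (n + i) = r + t i.
Proof. by rewrite /tau ltnNge leq_addr/= addKn. Qed.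

Let tau_nd n i : (0 < n)%N -> tau n i <= tau n i.+1.
Proof.
move=> n0; have [ni|iN] := leqP n i.
  by rewrite -(subnKC ni) -addnS !tau_future lerD2l.
rewrite !tau_past// 1?ltnW//.
by rewrite ler_pM2r ?invr_gt0 ?ltr0n// ler_wpM2l ?ler_nat// ltW.
Qed.

Let X n i w := B (tau n i.+1) w - B (tau n i) w.

Let mX n i : measurable_fun [set: T] (X n i).
Proof. exact: measurable_funB. Qed.

Let indX n : (0 < n)%N -> mutually_independent P (fun i : 'I_(n + m) => X n i).
Proof. by move=> n0; case: hB => _ _ _ h; apply: h => i; exact: tau_nd. Qed.

Let incr_tail n : incr_event r =
  tail_event (X n) (n + m) (fun i => A (i - n)) n.
Proof.
apply/seteqP; split => w h i.
  move=> /andP[ni inm]; rewrite /X -(subnKC ni) -addnS !tau_future addKn.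
  by apply: h; rewrite ltn_subLR.
move=> im; have := h (n + i)%N; rewrite leq_addr ltn_add2l im => /(_ isT).
by rewrite /X -addnS !tau_future addKn.
Qed.

Lemma measurable_incr_event : measurable (incr_event r).
Proof. by rewrite (incr_tail 1); apply: measurable_tail_event => //; exact: mX. Qed.

Let riem_incr N w : riem delta (fun s => B (0 + s) w - B 0 w) r N =
  \sum_(i < 2 ^ N) expR (- (delta * (r * i%:R / (2 ^ N)%:R))) * X (2 ^ N) i w.
Proof.
rewrite /riem -(big_mkord xpredT (fun i =>
  expR (- (delta * (r * i%:R / (2 ^ N)%:R))) * X (2 ^ N) i w)).
apply: eq_big_nat => i /andP[_ iN]; congr (_ * _).
by rewrite /X !tau_past ?expn_gt0// 1?ltnW// !add0r opprB addrA subrK.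
Qed.

Let riem_var_gt0 N : 0 < riem_var delta r N.
Proof.
have n0 : 0 < (2 ^ N)%:R :> R by rewrite ltr0n expn_gt0.
have h k : 0 < expR (- (2 * delta * (r * k%:R / (2 ^ N)%:R))) * (r / (2 ^ N)%:R).
  by rewrite mulr_gt0 ?expR_gt0 ?divr_gt0.
rewrite /riem_var big_ltn ?expn_gt0//.
apply: ltr_pwDl (h 0%N) _.
by apply: sumr_ge0 => i _; apply: ltW; apply: h.
Qed.

(** A Riemann sum over [[0, r]] is a weighted sum of increments, and the increments
    after [r] belong to the same independent family. *)
Let riem_law N C : measurable C ->
  P ((fun w => riem delta (fun s => B (0 + s) w - B 0 w) r N) @^-1` C `&` incr_event r) =
  (normal_prob 0 (Num.sqrt (riem_var delta r N)) C * P (incr_event r))%E.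
Proof.
move=> mC; have n0 : (0 < 2 ^ N)%N by rewrite expn_gt0.
have nR : 0 < (2 ^ N)%:R :> R by rewrite ltr0n.
under [X in X @^-1` C]eq_fun do rewrite riem_incr.
have lawX i C' : (i < 2 ^ N)%N -> measurable C' ->
    P (X (2 ^ N) i @^-1` C') = normal_prob 0 (Num.sqrt (r / (2 ^ N)%:R)) C'.
  move=> iN mC'; case: hB => _ _ h _.
  have E : tau (2 ^ N) i.+1 - tau (2 ^ N) i = r / (2 ^ N)%:R.
    rewrite !tau_past// 1?ltnW// -natr1; by field; rewrite gt_eqF.
  have L : tau (2 ^ N) i < tau (2 ^ N) i.+1 by rewrite -subr_gt0 E divr_gt0.
  by rewrite (h _ _ L _ mC') E.
rewrite (incr_tail (2 ^ N)).
have mA' i : measurable (A (i - 2 ^ N)) by exact: mA.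
have s0 (i : nat) : 0 < Num.sqrt (r / (2 ^ N)%:R) by rewrite sqrtr_gt0 divr_gt0.
have a0 (i : nat) : expR (- (delta * (r * i%:R / (2 ^ N)%:R))) != 0.
  by rewrite gt_eqF ?expR_gt0.
have kn : (0 < 2 ^ N <= 2 ^ N)%N by rewrite n0 leqnn.
have := @gaussian_weighted_sum _ _ _ P (X (2 ^ N)) (2 ^ N + m) (mX (2 ^ N))
  (indX n0) (fun=> Num.sqrt (r / (2 ^ N)%:R))
  (fun i => expR (- (delta * (r * i%:R / (2 ^ N)%:R)))) (2 ^ N)
  (leq_addr _ _) s0 a0 lawX _ _ _ mA' kn mC.
have -> : \sum_(i < 2 ^ N) expR (- (delta * (r * i%:R / (2 ^ N)%:R))) ^+ 2 *
    Num.sqrt (r / (2 ^ N)%:R) ^+ 2 = riem_var delta r N.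
  rewrite /riem_var big_mkord; apply: eq_bigr => i _.
  rewrite sqr_sqrtr ?divr_ge0 ?ltW//; congr (_ * _).
  by rewrite expr2 -expRD; congr (expR _); ring.
exact.
Qed.

(** The integral up to time [r] is Gaussian and independent of the increments
    of the Brownian motion after [r]: this holds for the Riemann sums and passes
    to the limit. *)
Lemma gaussian_past C : measurable C ->
  P (J r @^-1` C `&` incr_event r) =
  (normal_prob 0 (Num.sqrt (exp_primitive (2 * delta) r)) C * P (incr_event r))%E.
Proof.
move=> mC; set v := exp_primitive _ _.
have d20 : 0 <= 2 * delta by rewrite mulr_ge0.
have v0 : 0 < v by exact: exp_primitive_gt0.
have sv0 : 0 < Num.sqrt v by rewrite sqrtr_gt0.
pose Z N w := (Num.sqrt (riem_var delta r N))^-1 *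
  riem delta (fun s => B (0 + s) w - B 0 w) r N + 0.
pose Y w := (Num.sqrt v)^-1 * J r w + 0.
have sN0 N : 0 < Num.sqrt (riem_var delta r N) by rewrite sqrtr_gt0.
have inv0 (s : R) : 0 < s -> s^-1 != 0 by move=> s0; rewrite invr_eq0 gt_eqF.
have mriem N : measurable_fun [set: T] (fun w => riem delta (fun s => B (0 + s) w - B 0 w) r N).
  apply: measurable_sum => k; apply: measurable_funM => //.
  by apply: measurable_funB; exact: measurable_funB.
have mZ N : measurable_fun [set: T] (Z N).
  exact: (measurableT_comp (measurable_affine _ _) (mriem N)).
have mY : measurable_fun [set: T] Y.
  exact: (measurableT_comp (measurable_affine _ _)).
have mE := measurable_incr_event.
have norm1 (s : R) C' : 0 < s -> measurable C' ->
    normal_prob 0 s ((fun x => s^-1 * x + 0) @^-1` C') = normal_prob 0 1 C'.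
  move=> s0 mC'; rewrite (normal_prob_affine 0 0 s0 (inv0 _ s0) mC') mulr0 addr0.
  have -> // : `|s^-1| * s = 1 by rewrite gtr0_norm ?invr_gt0// mulVf// lt0r_neq0.
have lawZ N C' : measurable C' ->
    P (Z N @^-1` C' `&` incr_event r) = (normal_prob 0 1 C' * P (incr_event r))%E.
  move=> mC'; rewrite -(norm1 _ C' (sN0 N) mC').
  exact: (riem_law N (measurable_preimage (measurable_affine _ _) mC')).
have ZY : {ae P, forall w, Z ^~ w @ \oo --> Y w}.
  have Q := ae_riem_restarted delta0 hB hJ (lexx 0) (ltW r0).
  apply: (filterS _ Q) => w Qw.
  have -> : Y w = (Num.sqrt v)^-1 * restarted J delta 0 r w + 0.
    rewrite /Y /restarted mulr0 expR0 mul1r add0r; case: hJ => J0 _ _.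
    by rewrite J0 subr0.
  apply: cvgD; last exact: cvg_cst.
  apply: cvgM => //; apply: cvgV; first exact: lt0r_neq0.
  have := cvg_riem_var delta0 (ltW r0) => cv.
  by apply: (cvg_comp _ _ cv); exact: sqrt_continuous.
have lawY C' : measurable C' ->
    P (Y @^-1` C' `&` incr_event r) = (normal_prob 0 1 C' * P (incr_event r))%E.
  move=> mC'; rewrite -(lawZ 0%N C' mC').
  apply: (ae_cvg_eq_law mZ mY mE ZY) => // N A' mA'.
  by rewrite !lawZ.
have mC2 := measurable_preimage (measurable_affine (Num.sqrt v) 0) mC.
have -> : J r @^-1` C = Y @^-1` ((fun x => Num.sqrt v * x + 0) @^-1` C).
  apply/seteqP; split => w; rewrite /preimage/= /Y !addr0 mulrA mulfV ?mul1r//;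
    by rewrite gt_eqF.
rewrite (lawY _ mC2) (normal_prob_affine 0 0 ltr01 (lt0r_neq0 sv0) mC).
by rewrite mulr0 addr0 mulr1 gtr0_norm.
Qed.

End gaussian_past.

(** The uniqueness theorem for measures on a pi-system, applied to the two
    pushforwards. *)
Lemma eq_preimage_generated d1 d2 (T1 : measurableType d1) (T2 : measurableType d2)
    (R : realType) (m1 : {measure set T1 -> \bar R}) (m2 : {measure set T2 -> \bar R})
    (M : pointedType) (G : set (set M)) (F1 : T1 -> M) (F2 : T2 -> M) :
  setI_closed G -> G setT -> (m1 setT < +oo)%E ->
  (forall E, G E -> measurable (F1 @^-1` E)) ->
  (forall E, G E -> measurable (F2 @^-1` E)) ->
  (forall E, G E -> m1 (F1 @^-1` E) = m2 (F2 @^-1` E)) ->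
  forall E, <<s G >> E -> m1 (F1 @^-1` E) = m2 (F2 @^-1` E).
Proof.
move=> GI GT m1oo mF1 mF2 m12 E GE.
pose S := g_sigma_algebraType G.
have mf1 : measurable_fun [set: T1] (F1 : T1 -> S).
  by apply: (@measurability _ _ T1 S setT F1 G) => // _ [A GA <-]; rewrite setTI; exact: mF1.
have mf2 : measurable_fun [set: T2] (F2 : T2 -> S).
  by apply: (@measurability _ _ T2 S setT F2 G) => // _ [A GA <-]; rewrite setTI; exact: mF2.
apply: (@g_sigma_algebra_measure_unique _ R S G _ (fun=> setT) _ _
  (image_measure m1 mf1) (image_measure m2 mf2)) => //.
- by move=> A GA; exact: sub_sigma_algebra.
- by apply/seteqP; split => // x _; exists 0%N.
Qed.

Section path_space.
Context {R : realType}.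

Definition dyad (N i : nat) : R := i%:R / (2 ^ N)%:R.

Lemma dyad0 N : dyad N 0 = 0. Proof. by rewrite /dyad mul0r. Qed.

Lemma dyad_lt N i : dyad N i < dyad N i.+1.
Proof. by rewrite ltr_pM2r ?invr_gt0 ?ltr0n ?expn_gt0// ltr_nat. Qed.

Lemma dyad_ge0 N i : 0 <= dyad N i. Proof. by rewrite divr_ge0. Qed.

Lemma dyad_refine N k i : dyad N i = dyad (N + k) (i * 2 ^ k).
Proof.
rewrite /dyad expnD !natrM; field.
by rewrite !pnatr_eq0 -!lt0n !expn_gt0.
Qed.

Lemma dyad_floor (t : R) : 0 <= t ->
  exists i : nat -> nat, [/\ forall N, dyad N (i N) <= t,
     forall N, t < dyad N (i N).+1 &
    (fun N => dyad N (i N)) @ \oo --> t].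
Proof.
move=> t0; pose i N := Num.truncn (t * (2 ^ N)%:R).
have n0 N : 0 < (2 ^ N)%:R :> R by rewrite ltr0n expn_gt0.
have x0 N : 0 <= t * (2 ^ N)%:R by rewrite mulr_ge0// ltW.
have le N : dyad N (i N) <= t by rewrite ler_pdivrMr// truncn_le.
have lt N : t < dyad N (i N).+1 by rewrite ltr_pdivlMr// truncnS_gt.
exists i; split => //; apply/cvgrPdist_le => e e0.
have c : (fun N => (2^-1) ^+ N) @ \oo --> (0 : R).
  by apply: cvg_expr; rewrite ger0_norm; lra.
move/cvgrPdist_le : c => /(_ _ e0); apply: filterS => N.
rewrite sub0r normrN => hN; rewrite ger0_norm ?subr_ge0//.
apply: le_trans (le_trans (ler_norm _) hN).
have -> : 2^-1 ^+ N = ((2 ^ N)%:R)^-1 :> R by rewrite natrX exprVn.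
have := ltW (lt N); rewrite /dyad -natr1 mulrDl mul1r.
by move=> h; lra.
Qed.

(** Finite-dimensional cylinders, along a dyadic grid, for paths seen from their
    starting point. Cylinders over a grid are cylinders over every finer one,
    which makes them a pi-system. *)
Definition path_cylinders : set (set (R -> R)) :=
  [set E | exists N m (A : nat -> set R), (forall i, measurable (A i)) /\
    E = [set f | forall i, (i < m)%N -> A i (f (dyad N i) - f 0)]].

Lemma path_cylinder_refine N k m (A : nat -> set R) : (forall i, measurable (A i)) ->
  exists2 A' : nat -> set R, (forall i, measurable (A' i)) &
  [set f : R -> R | forall i, (i < m)%N -> A i (f (dyad N i) - f 0)] =
  [set f : R -> R | forall j, (j < m * 2 ^ k)%N -> A' j (f (dyad (N + k) j) - f 0)].
Proof.
move=> mA; have k0 : (0 < 2 ^ k)%N by rewrite expn_gt0.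
exists (fun j => if (2 ^ k %| j)%N then A (j %/ 2 ^ k)%N else setT).
  by move=> j; case: ifP.
apply/seteqP; split => f h j.
  move=> jm; case: ifP => // /dvdnP[i ji]; move: jm; rewrite ji ltn_pmul2r// => im.
  by rewrite mulnK// -dyad_refine; exact: h.
move=> jm; have := h (j * 2 ^ k)%N; rewrite ltn_pmul2r// dvdn_mull// mulnK//.
by rewrite -dyad_refine; exact.
Qed.

Lemma path_cylinders_setI : setI_closed path_cylinders.
Proof.
move=> _ _ [N [m [A [mA ->]]]] [N' [m' [A' [mA' ->]]]].
have [C mC ->] := @path_cylinder_refine N N' m A mA.
have [C' mC' ->] := @path_cylinder_refine N' N m' A' mA'.
rewrite (addnC N' N).
set l := (m * 2 ^ N')%N; set l' := (m' * 2 ^ N)%N.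
exists (N + N')%N, (maxn l l'), (fun i => (if (i < l)%N then C i else setT) `&`
  (if (i < l')%N then C' i else setT)); split.
  by move=> i; apply: measurableI; case: ifP.
apply/seteqP; split => f.
  by move=> [h1 h2] i _; split; case: ifP => // ?; [exact: h1|exact: h2].
by move=> h; split => i il; have := h i; rewrite leq_max il ?orbT => /(_ isT)[].
Qed.

Lemma path_cylinders_setT : path_cylinders setT.
Proof.
exists 0%N, 0%N, (fun=> setT); split; first by [].
by apply/seteqP; split.
Qed.

Definition path_space := g_sigma_algebraType path_cylinders.

Lemma measurable_path_incr N i :
  measurable_fun [set: path_space] (fun f : path_space => f (dyad N i) - f 0).
Proof.
move=> _ A mA; rewrite setTI; apply: sub_sigma_algebra.
exists N, i.+1, (fun j => if j == i then A else setT); split.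
  by move=> j; case: ifP.
apply/seteqP; split => f /=.
  by move=> h j ji; case: eqP => // ->.
by move=> /(_ i (ltnSn _)); rewrite eqxx.
Qed.

Lemma measurable_map_path d (T : measurableType d) (F : R -> T -> R) :
  (forall s, measurable_fun [set: T] (F s)) ->
  measurable_fun [set: T] ((fun w s => F s w) : T -> path_space).
Proof.
move=> mF; apply: (@measurability _ _ T path_space setT _ path_cylinders) => //.
move=> _ [_ [N [m [A [mA ->]]]] <-]; rewrite setTI.
rewrite (_ : _ @^-1` _ = \bigcap_(i in [set i | (i < m)%N])
    ((fun w => F (dyad N i) w - F 0 w) @^-1` A i)); last first.
  by apply/seteqP; split.
apply: bigcap_measurableType => i _; apply: measurable_preimage => //.
exact: measurable_funB.
Qed.

(** Independence of the increments gives the probability of these sets, and they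
    generate the cylinders of [path_cylinders]. *)
Definition incr_cylinders (N : nat) : set (set (R -> R)) :=
  [set E | exists m (A : nat -> set R), (forall i, measurable (A i)) /\
    E = [set f | forall i, (i < m)%N -> A i (f (dyad N i.+1) - f (dyad N i))]].

Lemma incr_cylinders_setI N : setI_closed (incr_cylinders N).
Proof.
move=> _ _ [m [C [mC ->]]] [m' [C' [mC' ->]]].
exists (maxn m m'), (fun i => (if (i < m)%N then C i else setT) `&`
  (if (i < m')%N then C' i else setT)); split.
  by move=> i; apply: measurableI; case: ifP.
apply/seteqP; split => f.
  by move=> [h1 h2] i _; split; case: ifP => // ?; [exact: h1|exact: h2].
by move=> h; split => i il; have := h i; rewrite leq_max il ?orbT => /(_ isT)[].
Qed.

Lemma incr_cylinders_setT N : incr_cylinders N setT.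
Proof.
exists 0%N, (fun=> setT); split; first by [].
by apply/seteqP; split.
Qed.

(** The value of a path at a grid point is the sum of the preceding increments. *)
Lemma path_cylinder_incr N m (A : nat -> set R) : (forall i, measurable (A i)) ->
  <<s incr_cylinders N >> [set f | forall i, (i < m)%N -> A i (f (dyad N i) - f 0)].
Proof.
move=> mA; pose S := g_sigma_algebraType (incr_cylinders N).
have mi i : measurable_fun [set: S] (fun f : S => f (dyad N i.+1) - f (dyad N i)).
  move=> _ C mC; rewrite setTI; apply: sub_sigma_algebra.
  exists i.+1, (fun j => if j == i then C else setT); split.
    by move=> j; case: ifP.
  apply/seteqP; split => f /=.
    by move=> h j ji; case: eqP => // ->.
  by move=> /(_ i (ltnSn _)); rewrite eqxx.
have mv i : measurable_fun [set: S] (fun f : S => f (dyad N i) - f 0).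
  rewrite (_ : (fun f => _) = (fun f : S => \sum_(0 <= j < i) (f (dyad N j.+1) - f (dyad N j)))).
    by apply: measurable_sum => j; exact: mi.
  by apply/funext => f; rewrite telescope_sumr// dyad0.
rewrite (_ : [set f | _] = \bigcap_(i in [set i | (i < m)%N])
    ((fun f : S => f (dyad N i) - f 0) @^-1` A i)); last first.
  by apply/seteqP; split.
apply: (@bigcap_measurableType _ S) => i _.
by rewrite -[_ @^-1` _]setTI; exact: mv.
Qed.

End path_space.
Arguments path_space : clear implicits.

Section markov.
Context d (T : measurableType d) (R : realType) (P : probability T R).
Variables (B J : R -> {RV P >-> R}) (delta : R).
Hypotheses (delta0 : 0 <= delta) (hB : brownian_motion B).
Hypothesis hJ : wiener_integral_process B (fun s => expR (- (delta * s))) J.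

Definition future (r : R) (w : T) : path_space R := fun s => B (r + s) w - B r w.

Lemma measurable_future r : measurable_fun [set: T] (future r).
Proof.
apply: (@measurable_map_path _ _ _ (fun s w => B (r + s) w - B r w)) => s.
exact: measurable_funB.
Qed.

Let incr_eventE r N m A :
  future r @^-1` [set f | forall i, (i < m)%N -> A i (f (dyad N i.+1) - f (dyad N i))] =
  incr_event B (dyad N) m A r.
Proof.
apply/seteqP; split => w h i im; have := h i im;
  by rewrite /future /= opprB addrA subrK.
Qed.

Let incr_event_stationary r N m A : (forall i, measurable (A i)) ->
  P (incr_event B (dyad N) m A r) = P (incr_event B (dyad N) m A 0).
Proof.
move=> mA; suff H r' : P (incr_event B (dyad N) m A r') =
    (\prod_(0 <= i < m) normal_prob 0 (Num.sqrt (dyad N i.+1 - dyad N i)) (A i))%E.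
  by rewrite !H.
pose X i w := B (r' + dyad N i.+1) w - B (r' + dyad N i) w.
have -> : incr_event B (dyad N) m A r' = tail_event X m A 0.
  by apply/seteqP; split => w h i; [move=> /andP[_]|move=> im]; exact: h.
have indX : mutually_independent P (fun i : 'I_m => X i).
  case: hB => _ _ _ h; apply: (h m (fun i => r' + dyad N i)) => i.
  by rewrite lerD2l; exact/ltW/dyad_lt.
rewrite (prob_tail_event indX 0 mA).
apply: eq_bigr => i _; case: hB => _ _ h _.
have L : r' + dyad N i < r' + dyad N i.+1 by rewrite ltrD2l dyad_lt.
by rewrite /X (h _ _ L _ (mA i)) (_ : _ - _ = dyad N i.+1 - dyad N i)//; ring.
Qed.

(** The Markov property. [gaussian_past] gives the events determined by finitely
    many increments after [r], whose probability is the same for every [r], and the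
    uniqueness of measures extends it to the whole path. *)
Lemma past_future_law r C E : 0 < r -> measurable C -> measurable E ->
  P (J r @^-1` C `&` future r @^-1` E) =
  (normal_prob 0 (Num.sqrt (exp_primitive (2 * delta) r)) C * P (future 0 @^-1` E))%E.
Proof.
move=> r0 mC mE.
have mJC : measurable (J r @^-1` C) by exact: measurable_preimage.
set nu := normal_prob 0 _.
have nuC : nu C \is a fin_num by exact: fin_num_measure.
pose k : {nonneg R} := NngNum (fine_ge0 (measure_ge0 nu C)).
pose m1 : {measure set T -> \bar R} := mrestr P mJC.
pose m2 : {measure set T -> \bar R} := mscale k P.
have m1oo : (m1 setT < +oo)%E.
  by rewrite /m1 /= /mrestr (le_lt_trans (probability_le1 _ _)) ?ltry//; exact: measurableI.
have m2E F : m2 F = (nu C * P F)%E by rewrite /m2 /= /mscale /= fineK.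
have t_nd N i : dyad N i <= dyad N i.+1 :> R by exact/ltW/dyad_lt.
have step1 N F : <<s incr_cylinders N >> F ->
    m1 (future r @^-1` F) = m2 (future 0 @^-1` F).
  apply: eq_preimage_generated => //.
  - exact: incr_cylinders_setI.
  - exact: incr_cylinders_setT.
  - by move=> _ [m [A [mA ->]]]; rewrite incr_eventE; exact: measurable_incr_event.
  - by move=> _ [m [A [mA ->]]]; rewrite incr_eventE; exact: measurable_incr_event.
  move=> _ [m [A [mA ->]]]; rewrite !incr_eventE m2E /m1 /= /mrestr setIC.
  have := @gaussian_past _ _ _ P B J delta delta0 hB hJ r (dyad N) m A r0
    (dyad0 N) (t_nd N) mA C mC.
  by move=> ->; rewrite (incr_event_stationary r N m mA).
suff : m1 (future r @^-1` E) = m2 (future 0 @^-1` E).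
  by rewrite m2E /m1 /= /mrestr setIC.
have mcyl r' F : path_cylinders F -> measurable (future r' @^-1` F).
  move=> cF; apply: (measurable_preimage (measurable_future r')).
  exact: sub_sigma_algebra.
apply: (@eq_preimage_generated _ _ _ _ _ m1 m2 _ path_cylinders) => //.
- exact: path_cylinders_setI.
- exact: path_cylinders_setT.
- exact: mcyl.
- exact: mcyl.
- by move=> _ [N [m [A [mA ->]]]]; apply: step1; exact: path_cylinder_incr.
Qed.

Let future0_mfun : {mfun T >-> path_space R} :=
  HB.pack (future 0) (isMeasurableFun.Build _ _ _ _ _ (measurable_future 0)).

Definition path_law : probability (path_space R) R := distribution P future0_mfun.

Lemma joint_past_future_law r a b D : 0 < r -> a != 0 -> measurable D ->
  P ((fun w => (a * J r w + b, future r w)) @^-1` D) =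
  (normal_prob b (`|a| * Num.sqrt (exp_primitive (2 * delta) r)) \x path_law)%E D.
Proof.
move=> r0 a0 mD.
have d20 : 0 <= 2 * delta by rewrite mulr_ge0.
have v0 : 0 < Num.sqrt (exp_primitive (2 * delta) r).
  by rewrite sqrtr_gt0 exp_primitive_gt0.
pose X w := a * J r w + b.
have mX : measurable_fun [set: T] X.
  exact: (measurableT_comp (measurable_affine a b)).
have H A F : measurable A -> measurable F ->
    P (X @^-1` A `&` (future r @^-1` F `&` setT)) =
    (normal_prob b (`|a| * Num.sqrt (exp_primitive (2 * delta) r)) A *
      (path_law F * P setT))%E.
  move=> mA mF; rewrite setIT.
  have mA' := measurable_preimage (measurable_affine a b) mA.
  have -> := past_future_law r0 mA' mF.
  rewrite (normal_prob_affine 0 b v0 a0 mA) mulr0 add0r.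
  by rewrite probability_setT mule1.
have := @joint_law_product _ _ _ _ _ _ _ P
  (normal_prob b (`|a| * Num.sqrt (exp_primitive (2 * delta) r))) path_law
  _ _ _ mX (measurable_future r) (@measurableT _ T) H _ mD.
by rewrite setIT probability_setT mule1.
Qed.

End markov.

(** * Gaussian tails and oscillation *)

Section normal_tails.
Context {R : realType}.
Notation mu := (@lebesgue_measure R).
Implicit Types s y theta : R.

(** Giving up the part [1 - theta] of the exponent leaves the density of a wider
    Gaussian law, which integrates to one. *)
Lemma normal_tail_le theta s y : 0 <= theta < 1 -> 0 < s -> 0 <= y ->
  (normal_prob 0 s `[y, +oo[ <=
   ((Num.sqrt (1 - theta))^-1 * expR (- (theta * y ^+ 2 / (2 * s ^+ 2))))%:E)%E.
Proof.
move=> /andP[th0 th1] s0 y0; set q := Num.sqrt (1 - theta).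
have q0 : 0 < q by rewrite sqrtr_gt0 subr_gt0.
have qq : q ^+ 2 = 1 - theta by rewrite sqr_sqrtr// subr_ge0 ltW.
have s'0 : 0 < s / q by rewrite divr_gt0.
set c := q^-1 * _; have c0 : 0 <= c by rewrite mulr_ge0 ?expR_ge0// invr_ge0 ltW.
have le_pdf x : y <= x -> normal_pdf 0 s x <= c * normal_pdf 0 (s / q) x.
  move=> yx; rewrite !normal_pdfE ?gt_eqF// !normal_peakE// /normal_fun !subr0 /c invf_div.
  set p := (Num.sqrt (pi *+ 2))^-1.
  have -> : q^-1 * expR (- (theta * y ^+ 2 / (2 * s ^+ 2))) *
      (q / s * p * expR (- x ^+ 2 / ((s / q) ^+ 2 *+ 2))) =
      s^-1 * p * (expR (- (theta * y ^+ 2 / (2 * s ^+ 2))) *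
      expR (- x ^+ 2 / ((s / q) ^+ 2 *+ 2))).
    by field; rewrite !gt_eqF.
  apply: ler_wpM2l.
    by rewrite mulr_ge0// invr_ge0 ?sqrtr_ge0// ltW.
  rewrite -expRD ler_expR expr_div_n qq.
  rewrite -subr_ge0.
  have -> : - (theta * y ^+ 2 / (2 * s ^+ 2)) + - x ^+ 2 / (s ^+ 2 / (1 - theta) *+ 2)
      - - x ^+ 2 / (s ^+ 2 *+ 2) = theta * (x ^+ 2 - y ^+ 2) / (2 * s ^+ 2).
    by field; rewrite !gt_eqF// subr_gt0.
  apply: divr_ge0; last by rewrite mulr_ge0// sqr_ge0.
  apply: mulr_ge0 => //; rewrite subr_ge0 ler_sqr ?nnegrE//.
  exact: le_trans yx.
rewrite /normal_prob; apply: (@le_trans _ _ (\int[mu]_(x in `[y, +oo[) (c%:E * (normal_pdf 0 (s / q) x)%:E))%E).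
  apply: ge0_le_integral => //.
  - by move=> x _; rewrite lee_fin normal_pdf_ge0.
  - by apply/measurable_EFinP; apply: measurable_funTS; exact: measurable_normal_pdf.
  - apply/measurable_EFinP; apply: measurable_funM => //.
    by apply: measurable_funTS; exact: measurable_normal_pdf.
  - by move=> x; rewrite /= in_itv/= andbT => yx; rewrite -EFinM lee_fin le_pdf.
rewrite ge0_integralZl_EFin//; last 2 first.
- by move=> x _; rewrite lee_fin normal_pdf_ge0.
- by apply/measurable_EFinP; apply: measurable_funTS; exact: measurable_normal_pdf.
rewrite -[leRHS]mule1; apply: lee_wpmul2l; first by rewrite lee_fin.
rewrite -(integral_normal_pdf 0 (s / q)); apply: ge0_subset_integral => //.
- by apply/measurable_EFinP; exact: measurable_normal_pdf.
- by move=> x _; rewrite lee_fin normal_pdf_ge0.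
Qed.

(** The density decreases on [[y, y + 1]]. *)
Lemma normal_tail_ge s y : 0 < s -> 0 <= y ->
  ((normal_pdf 0 s (y + 1))%:E <= normal_prob 0 s `[y, +oo[)%E.
Proof.
move=> s0 y0.
apply: (@le_trans _ _ (\int[mu]_(x in `[y, (y + 1)%R]) (normal_pdf 0 s (y + 1))%:E)%E).
  rewrite integral_cst//= lebesgue_measure_itv/= lte_fin ltrDl ltr01 -EFinB.
  by rewrite addrAC subrr add0r mule1.
apply: (@le_trans _ _ (\int[mu]_(x in `[y, (y + 1)%R]) (normal_pdf 0 s x)%:E)%E).
  apply: ge0_le_integral => //.
  - by move=> x _; rewrite lee_fin normal_pdf_ge0.
  - by apply/measurable_EFinP; apply: measurable_funTS; exact: measurable_normal_pdf.
  move=> x; rewrite /= in_itv/= => /andP[yx xy1]; rewrite lee_fin.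
  rewrite !normal_pdfE ?gt_eqF//; apply: ler_wpM2l; first exact: normal_peak_ge0.
  rewrite ler_expR !subr0 !mulNr lerN2 ler_pM2r ?invr_gt0 ?mulrn_wgt0 ?exprn_gt0//.
  by rewrite ler_sqr ?nnegrE ?(le_trans y0 yx)// addr_ge0.
apply: ge0_subset_integral => //.
- by apply/measurable_EFinP; apply: measurable_funTS; exact: measurable_normal_pdf.
- by move=> x _; rewrite lee_fin normal_pdf_ge0.
- by move=> x; rewrite /= !in_itv/= andbT => /andP[].
Qed.

End normal_tails.

(** Chaining over the dyadic grid: a path is controlled by its increments over
    the grid cells at all scales. *)
Lemma dyadic_chaining {R : realType} (f : R -> R) (b : nat -> R) (h : R) :
  f 0 = 0 ->
  (forall N i, (i < 2 ^ N)%N ->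
    `|f (h * i.+1%:R / (2 ^ N)%:R) - f (h * i%:R / (2 ^ N)%:R)| <= b N) ->
  forall N i, (i <= 2 ^ N)%N ->
    `|f (h * i%:R / (2 ^ N)%:R)| <= \sum_(0 <= k < N.+1) b k.
Proof.
move=> f0 fb; elim=> [|N IH] i iN.
  rewrite big_nat1; move: iN; rewrite expn0 leq_eqVlt => /predU1P[->|].
    by have := fb 0%N 0%N isT; rewrite mulr0 mul0r f0 subr0.
  rewrite ltnS leqn0 => /eqP ->; rewrite mulr0 mul0r f0 normr0.
  exact: le_trans (fb 0%N 0%N isT).
have half j : h * (j.*2)%:R / (2 ^ N.+1)%:R = h * j%:R / (2 ^ N)%:R.
  rewrite expnS -muln2 !natrM; field.
  by rewrite pnatr_eq0 -lt0n expn_gt0.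
have b0 : 0 <= b N.+1 by apply: le_trans (fb N.+1 0%N _); rewrite ?expn_gt0.
rewrite big_nat_recr//=.
move: iN; rewrite -(odd_double_half i); set j := i./2; case: (odd i) => /=.
  rewrite add1n => jN.
  have jN' : (j <= 2 ^ N)%N.
    by move: (ltnW jN); rewrite expnS mul2n leq_double.
  have h1 := IH j jN'; have := fb N.+1 j.*2 jN; rewrite half => h2.
  have -> : f (h * (j.*2.+1)%:R / (2 ^ N.+1)%:R) = f (h * j%:R / (2 ^ N)%:R) +
    (f (h * (j.*2.+1)%:R / (2 ^ N.+1)%:R) - f (h * j%:R / (2 ^ N)%:R)) by rewrite addrC subrK.
  by apply: le_trans (ler_normD _ _) _; exact: lerD.
rewrite add0n => jN2; have jN : (j <= 2 ^ N)%N.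
  by move: jN2; rewrite expnS mul2n leq_double.
rewrite half.
by apply: le_trans (IH j jN) _; rewrite lerDl.
Qed.

(** Summation by parts bounds the Riemann sums of a decreasing weight by the
    supremum of the path. *)
Lemma abel_sum_le {R : realType} (w f : nat -> R) (a : R) n :
  (forall k, 0 <= w k.+1 <= w k) -> w 0%N <= 1 -> f 0%N = 0 ->
  (forall k, (k <= n)%N -> `|f k| <= a) ->
  `|\sum_(0 <= k < n) w k * (f k.+1 - f k)| <= a.
Proof.
move=> hw w1 f0 fa; have a0 : 0 <= a by apply: le_trans (fa 0%N _).
have wge0 k : 0 <= w k.
  by case: k => [|k]; [case/andP: (hw 0%N) => h1 h2; exact: le_trans h2|case/andP: (hw k)].
suff H : forall m, (m <= n)%N ->
    `|\sum_(0 <= k < m) w k * (f k.+1 - f k) - w m * f m| <= (w 0%N - w m) * a.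
  have h1 := H n (leqnn n).
  have h2 : `|w n * f n| <= w n * a.
    by rewrite normrM (ger0_norm (wge0 n)); apply: ler_wpM2l => //; exact: fa.
  rewrite -[X in `|X|](subrK (w n * f n)).
  apply: le_trans (ler_normD _ _) _; apply: le_trans (lerD h1 h2) _.
  by rewrite -mulrDl subrK ler_piMl.
elim=> [|m IH] mn; first by rewrite big_geq// f0 mulr0 subrr normr0 subrr mul0r.
have -> : \sum_(0 <= k < m.+1) w k * (f k.+1 - f k) - w m.+1 * f m.+1 =
    (\sum_(0 <= k < m) w k * (f k.+1 - f k) - w m * f m) + (w m - w m.+1) * f m.+1.
  by rewrite big_nat_recr//=; ring.
apply: le_trans (ler_normD _ _) _.
have -> : (w 0%N - w m.+1) * a = (w 0%N - w m) * a + (w m - w m.+1) * a by ring.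
apply: lerD; first exact/IH/ltnW.
have /andP[_ h] := hw m.
by rewrite normrM ger0_norm ?subr_ge0//; apply: ler_wpM2l; [rewrite subr_ge0|exact: fa].
Qed.

Section dyadic_density.
Context {R : realType}.

Lemma dyadic_approx (h t : R) : 0 < h -> 0 <= t <= h ->
  exists i : nat -> nat, [/\ forall N, (i N <= 2 ^ N)%N,
    forall N, h * (i N)%:R / (2 ^ N)%:R <= t &
    (fun N => h * (i N)%:R / (2 ^ N)%:R) @ \oo --> t].
Proof.
move=> h0 /andP[t0 th]; have [i [le _ cv]] := dyad_floor (divr_ge0 t0 (ltW h0)).
have E N : h * (i N)%:R / (2 ^ N)%:R = h * dyad N (i N) by rewrite /dyad mulrA.
exists i; split => [N|N|].
- rewrite -(ler_nat R) -[leRHS]mul1r -ler_pdivrMr ?ltr0n ?expn_gt0//.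
  by apply: le_trans (le N) _; rewrite ler_pdivrMr// mul1r.
- by rewrite E mulrC -ler_pdivlMr.
- under eq_fun do rewrite E.
  have -> : t = h * (t / h) by rewrite mulrC divfK// gt_eqF.
  by apply: cvgM => //; exact: cvg_cst.
Qed.

Lemma within_continuous_cvg (A : set R) (g : R -> R) (u : nat -> R) (x : R) :
  {within A, continuous g} -> A x -> (forall n, A (u n)) ->
  u @ \oo --> x -> (g \o u) @ \oo --> g x.
Proof.
move=> /subspace_continuousP gc Ax Au ux V /(gc x Ax) /= h.
have : \forall n \near \oo, A (u n) -> V (g (u n)) by exact: (ux _ h).
by apply: filterS => n; apply.
Qed.

End dyadic_density.

Section oscillation.
Context d (T : measurableType d) (R : realType) (P : probability T R).
Variables (B J : R -> {RV P >-> R}) (delta : R).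
Hypotheses (delta0 : 0 <= delta) (hB : brownian_motion B).
Hypothesis hJ : wiener_integral_process B (fun s => expR (- (delta * s))) J.

Lemma brownian_incr_tail s t b : s < t -> 0 <= b ->
  (P [set w | (b <= `|B t w - B s w|)%R] <=
   (4 * expR (- (b ^+ 2 / (4 * (t - s)))))%:E)%E.
Proof.
move=> st b0; have sd0 : 0 < Num.sqrt (t - s) by rewrite sqrtr_gt0 subr_gt0.
pose X w := B t w - B s w.
have law C : measurable C -> P (X @^-1` C) = normal_prob 0 (Num.sqrt (t - s)) C.
  by move=> mC; case: hB => _ _ h _; exact: h.
have mX : measurable_fun [set: T] X by exact: measurable_funB.
have -> : [set w | (b <= `|B t w - B s w|)%R] =
    X @^-1` `[b, +oo[ `|` X @^-1` `]-oo, - b].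
  apply/seteqP; split => w /=; rewrite /preimage/= !in_itv/= andbT ler_normr lerNr.
    by move=> /orP[]; [left|right].
  by case=> ->; rewrite ?orbT.
have m1 : measurable (X @^-1` `[b, +oo[) by exact: measurable_preimage.
have m2 : measurable (X @^-1` `]-oo, - b]) by exact: measurable_preimage.
suff H : (P (X @^-1` `[b, +oo[) + P (X @^-1` `]-oo, (- b)%R]) <=
    (4 * expR (- (b ^+ 2 / (4 * (t - s)))))%:E)%E.
  exact: (le_trans (measureU2 _ m1 m2) H).
rewrite (law _ (measurable_itv _)) (law _ (measurable_itv _)).
have -> : normal_prob 0 (Num.sqrt (t - s)) `]-oo, - b] =
    normal_prob 0 (Num.sqrt (t - s)) `[b, +oo[.
  have a1 : -1 != 0 :> R by rewrite oppr_eq0 oner_eq0.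
  have mI : measurable (`[b, +oo[%classic : set R) by exact: measurable_itv.
  have := normal_prob_affine 0 0 sd0 a1 mI.
  rewrite mulr0 addr0 normrN1 mul1r => <-; rewrite -/(normal_prob _ _).
  congr (normal_prob _ _ _); apply/seteqP; split => x /=;
    by rewrite /preimage/= !in_itv/= andbT mulN1r addr0 lerNr.
have hth : 0 <= (2^-1 : R) < 1 by apply/andP; split; lra.
have bnd := normal_tail_le hth sd0 b0.
apply: (le_trans (leeD bnd bnd)); rewrite -EFinD lee_fin -mulrDl.
have -> : 2^-1 * b ^+ 2 / (2 * Num.sqrt (t - s) ^+ 2) = b ^+ 2 / (4 * (t - s)).
  rewrite sqr_sqrtr ?subr_ge0 ?ltW//; field.
  by rewrite gt_eqF// subr_gt0.
apply: ler_wpM2r; first exact: expR_ge0.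
have q0 : 0 < Num.sqrt (1 - 2^-1 : R) by rewrite sqrtr_gt0; lra.
suff : (Num.sqrt (1 - 2^-1 : R))^-1 <= 2 by move=> H; lra.
rewrite -[leRHS]invrK lef_pV2 ?posrE ?invr_gt0//.
have h : (2^-1 : R) ^+ 2 <= Num.sqrt (1 - 2^-1) ^+ 2 by rewrite sqr_sqrtr; lra.
by move: h; rewrite ler_sqr ?nnegrE ?invr_ge0// ltW.
Qed.

(** [(9/8)^N >= 1 + N/8], and [24] makes the exponent drop by [3] at each step
    while [exp 3 >= 4]. *)
Let geom (X : R) N : 24 <= X ->
  (2 ^ N)%:R * expR (- (X * (9 / 8) ^+ N)) <= expR (- X) * (2^-1) ^+ N.
Proof.
move=> X24; have bern : 1 + N%:R / 8 <= (9 / 8) ^+ N :> R.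
  elim: N => [|N IH]; first by rewrite mul0r addr0 expr0.
  rewrite exprS; have : 0 <= N%:R :> R by []. 
  by rewrite -natr1; move: IH; move: ((9 / 8) ^+ N) (N%:R : R) => p q; lra.
apply: (@le_trans _ _ ((2 ^ N)%:R * (expR (- X) * (4^-1) ^+ N))).
  apply: ler_wpM2l => //.
  apply: (@le_trans _ _ (expR (- X) * expR (- 3) ^+ N)).
    rewrite -expRM_natl -expRD ler_expR.
    have : X * (1 + N%:R / 8) <= X * (9 / 8) ^+ N by apply: ler_wpM2l => //; lra.
    have : 24 * N%:R <= X * N%:R by apply: ler_wpM2r.
    by move: (N%:R : R) ((9 / 8) ^+ N) => p q; lra.
  apply: ler_wpM2l; first exact: expR_ge0.
  apply: lerXn2r; rewrite ?nnegrE ?expR_ge0//; try lra.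
  rewrite expRN lef_pV2 ?posrE ?expR_gt0//.
  have := expR_ge1Dx (3 : R); lra.
rewrite mulrCA; apply: ler_wpM2l; first exact: expR_ge0.
by rewrite natrX -exprMn (_ : 2 * 4^-1 = 2^-1 :> R)//; lra.
Qed.

(** Allow increments of [a/4 * (3/4)^N] over the [2^N] cells of length [h/2^N]: they
    add up to at most [a], and the union bound over the cells and over [N] converges
    because [2 * (3/4)^2 = 9/8 > 1]. *)
Lemma brownian_sup_tail r h a : 0 < h -> 0 < a -> 24 <= a ^+ 2 / (64 * h) ->
  exists E : set T, [/\ measurable E,
    (P E <= (8 * expR (- (a ^+ 2 / (64 * h))))%:E)%E &
    forall w, ~ E w -> forall t, 0 <= t <= h -> `|B (r + t) w - B r w| <= a].
Proof.
move=> h0 a0 X24; set X := a ^+ 2 / (64 * h).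
pose b N := a / 4 * (3 / 4) ^+ N.
pose pt N i := r + h * i%:R / (2 ^ N)%:R.
have n0 N : 0 < (2 ^ N)%:R :> R by rewrite ltr0n expn_gt0.
have b0 N : 0 <= b N by rewrite mulr_ge0 ?exprn_ge0 ?divr_ge0// ltW.
pose F N i := [set w | (b N <= `|B (pt N i.+1) w - B (pt N i) w|)%R].
have mF N i : measurable (F N i).
  rewrite (_ : F N i = (fun w => `|B (pt N i.+1) w - B (pt N i) w|) @^-1` `[b N, +oo[).
    apply: measurable_preimage => //; apply: measurableT_comp => //.
    exact: measurable_funB.
  by apply/seteqP; split => w; rewrite /F /preimage/= in_itv/= andbT.
pose U N := \bigcup_(i in `I_(2 ^ N)) F N i.
have mU N : measurable (U N) by apply: bigcup_measurable => i _; exact: mF.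
have PU N : (P (U N) <= (4 * expR (- X) * (2^-1) ^+ N)%:E)%E.
  have sub : U N `<=` \big[setU/set0]_(i < 2 ^ N) F N i by rewrite /U bigcup_mkord.
  apply: (@le_trans _ _ (\sum_(i < 2 ^ N) P (F N i))%E).
    by apply: content_subadditive => // i _; exact: mF.
  have cell i : (P (F N i) <= (4 * expR (- (X * (9 / 8) ^+ N)))%:E)%E.
    have step : pt N i.+1 - pt N i = h / (2 ^ N)%:R.
      by rewrite /pt -natr1; field; rewrite gt_eqF.
    have lt : pt N i < pt N i.+1 by rewrite -subr_gt0 step divr_gt0.
    apply: (le_trans (brownian_incr_tail lt (b0 N))).
    rewrite step lee_fin (_ : b N ^+ 2 / (4 * (h / (2 ^ N)%:R)) = X * (9 / 8) ^+ N)//.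
    rewrite /b /X exprMn -exprM natrX.
    have -> : (9 / 8) ^+ N = (3 / 4) ^+ (N * 2) * 2 ^+ N :> R.
      by rewrite mulnC exprM -exprMn; congr (_ ^+ N); lra.
    by field; rewrite ?expf_neq0 ?(gt_eqF h0).
  apply: (@le_trans _ _ (\sum_(i < 2 ^ N) (4 * expR (- (X * (9 / 8) ^+ N)))%:E)%E).
    by apply: lee_sum => i _; exact: cell.
  rewrite sumEFin lee_fin sumr_const card_ord -[leLHS]mulr_natl mulrCA -mulrA.
  by apply: ler_wpM2l => //; exact: geom.
exists (\bigcup_N U N); split.
- exact: bigcupT_measurable.
- apply: (@le_trans _ _ (\sum_(N <oo) P (U N))%E).
    by apply: measure_sigma_subadditive => //; exact: bigcupT_measurable.
  apply: lime_le; first exact: is_cvg_nneseries.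
  apply: nearW => n.
  apply: (@le_trans _ _ (\sum_(0 <= k < n) (4 * expR (- X) * (2^-1) ^+ k)%:E)%E).
    by apply: lee_sum => k _; exact: PU.
  rewrite sumEFin lee_fin -mulr_sumr.
  have E M : (\sum_(0 <= k < M) (2^-1) ^+ k : R) = 2 * (1 - (2^-1) ^+ M).
    elim: M => [|M IH]; first by rewrite big_geq// expr0 subrr mulr0.
    by rewrite big_nat_recr//= IH exprS; lra.
  rewrite E; have : 0 <= (2^-1) ^+ n :> R by rewrite exprn_ge0// invr_ge0.
  have := expR_ge0 (- X).
  by move: ((2^-1) ^+ n) (expR _) => p q q0 p0; nra.
move=> w Ew t tin.
have [i [iN _ it]] := dyadic_approx h0 tin.
pose f s := B (r + s) w - B r w.
have fc : continuous f.
  move=> s; apply: cvgB; last exact: cvg_cst.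
  case: hB => _ cB _ _; apply: (@cvg_comp _ _ _ (fun s => r + s) (fun s => B s w)).
    by apply: cvgD; [exact: cvg_cst|exact: cvg_id].
  exact: cB.
have fb N i' : (i' < 2 ^ N)%N ->
    `|f (h * i'.+1%:R / (2 ^ N)%:R) - f (h * i'%:R / (2 ^ N)%:R)| <= b N.
  move=> iN'; rewrite /f opprB addrA subrK leNgt; apply/negP => hb; apply: Ew.
  by exists N => //; exists i' => //; exact: ltW.
have f0 : f 0 = 0 by rewrite /f addr0 subrr.
have sumb N : \sum_(0 <= k < N.+1) b k <= a.
  rewrite /b -mulr_sumr.
  have E M : (\sum_(0 <= k < M) (3 / 4) ^+ k : R) = 4 * (1 - (3 / 4) ^+ M).
    elim: M => [|M IH]; first by rewrite big_geq// expr0 subrr mulr0.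
    by rewrite big_nat_recr//= IH exprS; lra.
  rewrite E; have : 0 <= (3 / 4) ^+ N.+1 :> R by rewrite exprn_ge0.
  by move: ((3 / 4) ^+ N.+1) => p p0; nra.
have ft : (fun N => f (h * (i N)%:R / (2 ^ N)%:R)) @ \oo --> f t.
  by apply: (cvg_comp _ _ it); exact: fc.
have nft : (fun N => `|f (h * (i N)%:R / (2 ^ N)%:R)|) @ \oo --> `|f t| by exact: cvg_norm.
rewrite -(cvg_lim _ nft)//; apply: limr_le; first by apply/cvg_ex; eexists; exact: nft.
by apply: nearW => N; apply: le_trans (@dyadic_chaining R f b h f0 fb N _ (iN N)) (sumb N).
Qed.

End oscillation.

Section restarted_paths.
Context d (T : measurableType d) (R : realType) (P : probability T R).
Variables (B J : R -> {RV P >-> R}) (delta : R).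
Hypotheses (delta0 : 0 <= delta) (hB : brownian_motion B).
Hypothesis hJ : wiener_integral_process B (fun s => expR (- (delta * s))) J.

Lemma riem_le (f : R -> R) (t a : R) N : 0 <= t -> f 0 = 0 ->
  (forall s, 0 <= s <= t -> `|f s| <= a) -> `|riem delta f t N| <= a.
Proof.
move=> t0 f0 fa; have n0 : 0 < (2 ^ N)%:R :> R by rewrite ltr0n expn_gt0.
pose w k := expR (- (delta * (t * k%:R / (2 ^ N)%:R))).
pose g k := f (t * k%:R / (2 ^ N)%:R).
have pos k : 0 <= t * k%:R / (2 ^ N)%:R by rewrite divr_ge0 ?mulr_ge0// ltW.
apply: (@abel_sum_le R w g a (2 ^ N)).
- move=> k; rewrite expR_ge0 ler_expR lerN2; apply: ler_wpM2l => //.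
  by rewrite ler_pM2r ?invr_gt0// ler_wpM2l// ler_nat.
- by rewrite -[leRHS]expR0 ler_expR oppr_le0 mulr_ge0.
- by rewrite /g mulr0 mul0r.
- move=> k kN; apply: fa; rewrite pos/= ler_pdivrMr//.
  by apply: ler_wpM2l => //; rewrite ler_nat.
Qed.

Lemma restarted_within r w : 0 <= r ->
  {within `[0, +oo[, continuous (fun t => restarted J delta r t w)}.
Proof.
move=> r0; apply/subspace_continuousP => t /=; rewrite in_itv/= andbT => t0.
case: hJ => _ /(_ w)/subspace_continuousP/(_ (r + t)) cJ _.
have rt : `[0, +oo[%classic (r + t) by rewrite /= in_itv/= andbT addr_ge0.
apply: cvgM; first exact: cvg_cst.
apply: cvgB; last exact: cvg_cst.
move=> V /(cJ rt) /= h; rewrite /within/= in h *.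
have sh : (fun s => r + s) @ nbhs t --> nbhs (r + t).
  by apply: cvgD; [exact: cvg_cst|exact: cvg_id].
have Q : nbhs t [set s | `[0, +oo[%classic (r + s) -> V (J (r + s) w)] := sh _ h.
apply: (filterS _ Q) => s /= hs.
by rewrite in_itv/= andbT => s0; apply: hs; rewrite in_itv/= andbT addr_ge0.
Qed.

(** [abel_sum_le] bounds the Riemann sums by the supremum of the Brownian path, and
    the bound passes to the limit at dyadic times, then to all times by continuity. *)
Lemma restarted_sup_tail r h a : 0 <= r -> 0 < h -> 0 < a -> 24 <= a ^+ 2 / (64 * h) ->
  exists E : set T, [/\ measurable E,
    (P E <= (8 * expR (- (a ^+ 2 / (64 * h))))%:E)%E &
    forall w, ~ E w -> forall t, 0 <= t <= h -> `|restarted J delta r t w| <= a].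
Proof.
move=> r0 h0 a0 X24.
have [E [mE PE Ew]] := brownian_sup_tail hB r h0 a0 X24.
pose pt N i : R := h * i%:R / (2 ^ N)%:R.
have pt0 N i : 0 <= pt N i by rewrite divr_ge0 ?mulr_ge0// ltW.
have ae : {ae P, forall w, forall N i,
    riem delta (fun s => B (r + s) w - B r w) (pt N i) @ \oo --> restarted J delta r (pt N i) w}.
  apply: ae_foralln => N; apply: ae_foralln => i.
  exact: (ae_riem_restarted delta0 hB hJ r0 (pt0 N i)).
case: ae => Z [mZ PZ Zw].
exists (E `|` Z); split; first exact: measurableU.
  apply: (@le_trans _ _ (P E + P Z)%E); first exact: measureU2.
  suff -> : P Z = 0%E by rewrite adde0.
  exact: PZ.
move=> w EZ.
have En : ~ E w by move=> ?; apply: EZ; left.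
have Zn : forall N i, riem delta (fun s => B (r + s) w - B r w) (pt N i) @ \oo -->
    restarted J delta r (pt N i) w.
  by apply: contrapT => H; apply: EZ; right; apply: Zw.
have grid N i : pt N i <= h -> `|restarted J delta r (pt N i) w| <= a.
  move=> ph; have nr : (fun M => `|riem delta (fun s => B (r + s) w - B r w) (pt N i) M|) @ \oo -->
    `|restarted J delta r (pt N i) w| by apply: cvg_norm; exact: Zn.
  rewrite -(cvg_lim _ nr)//; apply: limr_le; first by apply/cvg_ex; eexists; exact: nr.
  apply: nearW => M; apply: riem_le => //; first by rewrite addr0 subrr.
  by move=> s /andP[s0 sp]; apply: (Ew w En); rewrite s0 (le_trans sp ph).
move=> t tin; have [i [iN it ct]] := dyadic_approx h0 tin.
have /andP[t0 th] := tin.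
have cr : (fun N => restarted J delta r (pt N (i N)) w) @ \oo --> restarted J delta r t w.
  apply: (@within_continuous_cvg R `[0, +oo[%classic _ (fun N => pt N (i N)) t
    (@restarted_within r w r0) _ _ ct).
    by rewrite /= in_itv/= andbT.
  by move=> N; rewrite /= in_itv/= andbT.
have nr : (fun N => `|restarted J delta r (pt N (i N)) w|) @ \oo -->
  `|restarted J delta r t w| by exact: cvg_norm.
rewrite -(cvg_lim _ nr)//; apply: limr_le; first by apply/cvg_ex; eexists; exact: nr.
by apply: nearW => N; apply: grid; exact: le_trans (it N) th.
Qed.

End restarted_paths.

(** * Windows below zero *)

Section discount_integral.
Context {R : realType}.
Implicit Types lambda t : R.

Lemma is_derive_exp_primitive lambda t :
  is_derive t 1 (exp_primitive lambda) (expR (- (lambda * t))).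
Proof.
rewrite /exp_primitive; have [->|ln0] := eqVneq lambda 0.
  by rewrite mul0r oppr0 expR0; exact: is_derive_id.
rewrite (_ : (fun s => (1 - expR (- (lambda * s))) / lambda) =
  (fun s => lambda^-1 * (1 - expR (- lambda * s)))); last first.
  by apply/funext => s; rewrite mulrC mulNr.
apply: is_derive_eq.
rewrite /GRing.scale/= mulNr; move: (expR _) => e; by field.
Qed.

Lemma continuous_exp_primitive lambda : continuous (exp_primitive lambda).
Proof.
move=> t; apply: differentiable_continuous; apply/derivable1_diffP.
by have [] := is_derive_exp_primitive lambda t.
Qed.

Lemma Rintegral_discount lambda t : 0 <= t ->
  \int[lebesgue_measure]_(s in `[0, t]) expR (- (lambda * s)) = exp_primitive lambda t.
Proof.
rewrite le_eqVlt => /predU1P[<-|t0].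
  by rewrite exp_primitive0 set_itv1 Rintegral_set1.
have ct := @continuous_exp_primitive lambda.
rewrite /Rintegral (@continuous_FTC2 _ _ (exp_primitive lambda))//=.
- by rewrite exp_primitive0 subr0.
- apply: continuous_subspaceT => s.
  apply: (@continuous_comp _ _ _ (fun s => - (lambda * s)) expR); last exact: continuous_expR.
  by apply: cvgN; apply: cvgM; [exact: cvg_cst|exact: cvg_id].
- split.
  + by move=> s _; have [] := is_derive_exp_primitive lambda s.
  + exact/cvg_at_right_filter/ct.
  + exact/cvg_at_left_filter/ct.
- by move=> s _; rewrite derive1E; have [] := is_derive_exp_primitive lambda s.
Qed.

End discount_integral.

Section excursions.
Context {R : realType}.
Implicit Types (y : R -> R) (s tau t : R).

Definition has_window (s tau : R) y : Prop :=
  exists2 t0, 0 <= t0 < s & forall t, t0 <= t <= t0 + tau -> y t < 0.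

Let right_neg y t : {within `[0, +oo[, continuous y} -> 0 <= t -> y t < 0 ->
  exists2 e, 0 < e & forall s, 0 <= s -> `|s - t| < e -> y s < 0.
Proof.
move=> /subspace_continuousP cy t0 yt.
have /cy : `[0, +oo[%classic t by rewrite /= in_itv/= andbT.
move/cvgrPdist_lt => /(_ (- y t)); rewrite oppr_gt0 => /(_ yt).
rewrite /within/= => -[e /= e0 h]; exists e => // s s0 st.
have := h s; rewrite /ball_/= distrC => /(_ st); rewrite in_itv/= andbT => /(_ s0).
by rewrite distrC ltr_distl => /andP[_]; rewrite subrr.
Qed.

(** The excursion may start at a zero exactly [tau] before the current time;
    since the path stays negative for a short while, the window can be moved to the
    right, off that zero. Conversely, after a window the last nonnegative value lies
    before its start. *)
Lemma parisian_ruin_timeP tau y s : 0 <= tau -> 0 <= y 0 ->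
  {within `[0, +oo[, continuous y} ->
  (parisian_ruin_time tau y < (s + tau)%:E)%E <-> has_window s tau y.
Proof.
move=> tau0 y0 cy; split.
  case/ereal_inf_ltP => _ [t [taut tk yt] <-]; rewrite lte_fin => ts.
  have t0 : 0 <= t by exact: le_trans taut.
  have neg s' : t - tau < s' -> s' <= t -> y s' < 0.
    move=> h1 h2; rewrite ltNge; apply/negP => ys'.
    have s'0 : 0 <= s' by rewrite (le_trans _ (ltW h1))// subr_ge0.
    have : s' <= kappa y t.
      apply: ub_le_sup; first by exists t => x [].
      by split.
    by move: tk; lra.
  have [e e0 eneg] := right_neg cy t0 yt.
  pose d := Num.min (e / 2) ((s + tau - t) / 2).
  have d0 : 0 < d by rewrite lt_min; apply/andP; split; lra.
  have d1 : d <= e / 2 by rewrite ge_min lexx.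
  have d2 : d <= (s + tau - t) / 2 by rewrite ge_min lexx orbT.
  exists (t - tau + d); first by apply/andP; split; lra.
  move=> x /andP[h1 h2]; have [xt|tx] := leP x t.
    by apply: neg => //; lra.
  by apply: eneg; [lra|rewrite ger0_norm; lra].
case=> t0 /andP[t00 t0s] h; apply/ereal_inf_ltP.
exists (t0 + tau)%:E; last by rewrite lte_fin ltrD2r.
exists (t0 + tau) => //; split; first by rewrite lerDr.
  suff : kappa y (t0 + tau) <= t0 by move=> ?; lra.
  apply: ge_sup; first by exists 0; split => //; rewrite addr_ge0.
  move=> x [x0 xt yx]; rewrite leNgt; apply/negP => t0x.
  have : y x < 0 by apply: h; rewrite (ltW t0x).
  by rewrite ltNge yx.
by apply: h; rewrite lexx lerDl tau0.
Qed.

(** A window can be moved to the right to start at a dyadic time, and on it the path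
    stays away from [0] by compactness; this describes windows by countably many
    conditions. *)
Lemma has_window_dyad s tau y : 0 <= tau -> {within `[0, +oo[, continuous y} ->
  has_window s tau y <->
  exists N i, (dyad N i : R) < s /\ exists n, forall M j,
    (dyad N i : R) <= dyad M j <= dyad N i + tau -> y (dyad M j) <= - (n.+1%:R^-1).
Proof.
move=> tau0 cy; split.
  case=> t0 /andP[t00 t0s] h.
  have tt0 : 0 <= t0 + tau by rewrite addr_ge0.
  have yend : y (t0 + tau) < 0 by apply: h; rewrite lexx lerDl tau0.
  have [e e0 eneg] := right_neg cy tt0 yend.
  pose b := Num.min (e / 2) ((s - t0) / 2).
  have b0 : 0 < b by rewrite lt_min; apply/andP; split; lra.
  have b1 : b <= e / 2 by rewrite ge_min lexx.
  have b2 : b <= (s - t0) / 2 by rewrite ge_min lexx orbT.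
  have tb0 : 0 <= t0 + b by lra.
  have [i [le _ cv]] := dyad_floor tb0.
  move/cvgrPdist_lt : cv => /(_ b b0)[N _ /(_ N (leqnn N))] /= hN.
  have leN := le N; rewrite ger0_norm ?subr_ge0// in hN.
  exists N, (i N); set dd := dyad N (i N); split; first by rewrite /dd; lra.
  have cI : {within `[dd, dd + tau], continuous y}.
    apply: continuous_subspaceW cy => x /=; rewrite !in_itv/= andbT => /andP[h1 _].
    by rewrite (le_trans _ h1)// /dd; lra.
  have ddt : dd <= dd + tau by rewrite lerDl.
  have [c cin cmax] := EVT_max ddt cI.
  have cI' : dd <= c <= dd + tau by move: cin; rewrite in_itv.
  have ddt0 : t0 < dd by move: hN; rewrite -/dd; lra.
  have ddle : dd <= t0 + b by rewrite /dd.
  have yc : y c < 0.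
    have [ct|tc] := leP c (t0 + tau); first by apply: h; lra.
    by apply: eneg; [lra|rewrite ger0_norm; lra].
  exists (Num.truncn (- y c)^-1) => M j Mj.
  have yj : y (dyad M j) <= y c by apply: cmax; rewrite in_itv.
  have g : (- y c)^-1 < (Num.truncn (- y c)^-1).+1%:R by exact: truncnS_gt.
  apply: (le_trans yj); rewrite lerNr -[leRHS]invrK lef_pV2 ?posrE ?ltr0n//.
    exact: ltW.
  by rewrite invr_gt0 oppr_gt0.
case=> N [i [id [n h]]]; exists (dyad N i); first by rewrite dyad_ge0.
move=> t /andP[h1 h2]; have t0 : 0 <= t by rewrite (le_trans _ h1)// dyad_ge0.
have [k [le lt cv]] := dyad_floor t0.
have ge' p : (dyad N i : R) <= dyad (N + p) (k (N + p)%N).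
  rewrite (dyad_refine N p i).
  have : (dyad (N + p) (i * 2 ^ p) : R) < dyad (N + p) (k (N + p)%N).+1.
    by rewrite -dyad_refine; exact: le_lt_trans h1 (lt _).
  rewrite /dyad ltr_pM2r ?invr_gt0 ?ltr0n ?expn_gt0// ltr_nat ltnS => jk.
  by rewrite ler_pM2r ?invr_gt0 ?ltr0n ?expn_gt0// ler_nat.
have ge M : (N <= M)%N -> (dyad N i : R) <= dyad M (k M).
  by move=> NM; have := ge' (M - N)%N; rewrite (subnKC NM).
have cvy : (y \o (fun M => dyad M (k M))) @ \oo --> y t.
  apply: (within_continuous_cvg cy) => //; first by rewrite /= in_itv/= andbT.
  by move=> M; rewrite /= in_itv/= andbT dyad_ge0.
have : y t <= - (n.+1%:R^-1).
  rewrite -(cvg_lim _ cvy)//; apply: limr_le; first by apply/cvg_ex; eexists; exact: cvy.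
  exists N => // M /= NM; apply: h; rewrite ge//=.
  exact: le_trans (le M) h2.
by move=> /le_lt_trans; apply; rewrite oppr_lt0 invr_gt0 ltr0n.
Qed.

End excursions.

Section window_set.
Context {R : realType}.
Variables (delta c sigma : R).

Lemma measurable_path_riem (M j k : nat) :
  measurable_fun [set: path_space R] (fun f => riem delta f (dyad M j) k).
Proof.
apply: measurable_sum => i; apply: measurable_funM => //.
have E l : dyad M j * l%:R / (2 ^ k)%:R = dyad (M + k) (j * l) :> R.
  rewrite /dyad expnD !natrM; field.
  by rewrite !pnatr_eq0 -!lt0n !expn_gt0.
rewrite !E.
rewrite (_ : (fun f => _) = (fun f : path_space R =>
   (f (dyad (M + k) (j * i.+1)) - f 0) - (f (dyad (M + k) (j * i)) - f 0))).
  by apply: measurable_funB; exact: measurable_path_incr.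
by apply/funext => f; rewrite opprB addrA subrK.
Qed.

(** Ruin after a restart at the position [p.1], driven by the Brownian path [p.2].
    Reading the driving integral off the path as a limit of Riemann sums, at dyadic
    times only, makes this a measurable set of the product of the line with the path
    space, to be measured by the joint law of the past and of the future. The slack
    [1 / n.+1] absorbs the passage to the limit in the Riemann sums. *)
Definition window_set (K h tau : R) : set (R * path_space R) :=
  [set p | `|p.1| <= K /\ exists N i, (dyad N i : R) < h /\ exists n, forall M j,
    (dyad N i : R) <= dyad M j <= dyad N i + tau -> exists k0, forall k, (k0 <= k)%N ->
    p.1 + c * exp_primitive delta (dyad M j) - sigma * riem delta p.2 (dyad M j) k
      <= - (n.+1%:R^-1)].

Lemma measurable_window_set K h tau : measurable (window_set K h tau).
Proof.
pose g M j k (p : R * path_space R) :=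
  p.1 + c * exp_primitive delta (dyad M j) - sigma * riem delta p.2 (dyad M j) k.
have mg M j k : measurable_fun [set: R * path_space R] (g M j k).
  apply: measurable_funB; first exact: measurable_funD.
  apply: measurable_funM => //.
  exact: (measurableT_comp (measurable_path_riem M j k) measurable_snd).
have mG n M j k : measurable [set p | g M j k p <= - (n.+1%:R^-1)].
  rewrite (_ : [set p | _] = g M j k @^-1` `]-oo, (- (n.+1%:R^-1))]).
    exact: measurable_preimage.
  by apply/seteqP; split => p; rewrite /preimage/= in_itv.
have mK : measurable [set p : R * path_space R | `|p.1| <= K].
  rewrite (_ : [set p | _] = (fun p : R * path_space R => `|p.1|) @^-1` `]-oo, K]).
    apply: measurable_preimage => //.
    by apply: measurableT_comp => //; exact: measurable_fst.
  by apply/seteqP; split => p; rewrite /preimage/= in_itv.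
rewrite (_ : window_set K h tau = [set p | `|p.1| <= K] `&`
  \bigcup_N \bigcup_(i in [set i | (dyad N i : R) < h]) \bigcup_n \bigcap_M
  \bigcap_(j in [set j | (dyad N i : R) <= dyad M j <= dyad N i + tau])
   \bigcup_k0 \bigcap_(k in [set k | (k0 <= k)%N]) [set p | g M j k p <= - (n.+1%:R^-1)]); last first.
  apply/seteqP; split => p.
    move=> [h1 [N [i [h2 [n h3]]]]]; split => //; exists N => //; exists i => //.
    exists n => // M _ j /= Mj; have [k0 h4] := h3 M j Mj.
    by exists k0 => // k /= kk; exact: h4.
  move=> [h1 [N _ [i /= h2 [n _ h3]]]]; split => //; exists N, i; split => //.
  exists n => M j Mj; have [k0 _ h4] := h3 M I j Mj.
  by exists k0 => k kk; exact: h4.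
apply: measurableI => //; apply: bigcup_measurable => N _.
apply: bigcup_measurable => i _; apply: bigcup_measurable => n _.
apply: bigcap_measurableType => M _; apply: bigcap_measurableType => j _.
by apply: bigcup_measurable => k0 _; apply: bigcap_measurableType => k _.
Qed.

Lemma window_setP K h tau z (f : path_space R) (Y : R -> R) : 0 <= tau ->
  (forall M j, riem delta f (dyad M j) @ \oo --> Y (dyad M j)) ->
  {within `[0, +oo[, continuous Y} ->
  window_set K h tau (z, f) <->
  `|z| <= K /\ has_window h tau (fun t => z + c * exp_primitive delta t - sigma * Y t).
Proof.
move=> tau0 fY cY; set y := fun t => _.
have cy : {within `[0, +oo[, continuous y}.
  apply/subspace_continuousP => t t0; apply: cvgB.
    apply: cvgD; first exact: cvg_cst.
    apply: cvgM; first exact: cvg_cst.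
    by apply: cvg_within_filter; exact: continuous_exp_primitive.
  apply: cvgM; first exact: cvg_cst.
  by move/subspace_continuousP : cY; apply.
have lim M j : (fun k => z + c * exp_primitive delta (dyad M j) -
    sigma * riem delta f (dyad M j) k) @ \oo --> y (dyad M j).
  apply: cvgB; first exact: cvg_cst.
  by apply: cvgM; [exact: cvg_cst|exact: fY].
split.
  move=> [zK [N [i [Nh [n H]]]]]; split => //; apply/(has_window_dyad _ tau0 cy).
  exists N, i; split => //; exists n => M j Mj; have [k0 Hk] := H M j Mj.
  rewrite -(cvg_lim _ (lim M j))//; apply: limr_le; first by apply/cvg_ex; eexists; exact: lim.
  by exists k0.
move=> [zK /(has_window_dyad _ tau0 cy)[N [i [Nh [n H]]]]]; split => //.
exists N, i; split => //; exists n.+1 => M j Mj.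
have {}H := H M j Mj.
have gap : 0 < n.+1%:R^-1 - n.+2%:R^-1 :> R.
  by rewrite subr_gt0 ltf_pV2 ?posrE ?ltr0n// ltr_nat.
have /cvgrPdist_lt /(_ _ gap)[k0 _ Hk] := lim M j.
exists k0 => k kk /=; have := Hk k kk; rewrite distrC => /ltr_distlDr /ltW h'.
apply: le_trans h' _; rewrite addrA -[leRHS]add0r lerD2r.
by rewrite -[leRHS](addNr (n.+1%:R^-1)) lerD2r.
Qed.

End window_set.

(** * Ruin seen from an intermediate time *)

Section ruin_events.
Context d (T : measurableType d) (R : realType) (P : probability T R).
Variables (B J : R -> {RV P >-> R}) (delta c sigma : R).
Hypotheses (delta0 : 0 <= delta) (c0 : 0 < c) (sigma0 : 0 < sigma).
Hypothesis hB : brownian_motion B.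
Hypothesis hJ : wiener_integral_process B (fun s => expR (- (delta * s))) J.
Notation m := (exp_primitive delta).
Notation v := (exp_primitive (2 * delta)).

(** The discounted risk process, which has the sign of the risk process. *)
Definition discounted_risk (u t : R) (w : T) : R := u + c * m t - sigma * J t w.

Definition ruin (u s tau : R) : set T :=
  [set w | has_window s tau (fun t => discounted_risk u t w)].

(** The risk process at time [r], as an affine function of [J r]. *)
Definition position (u r : R) (w : T) : R :=
  - (expR (delta * r) * sigma) * J r w + expR (delta * r) * (u + c * m r).

Definition position_mean (u r : R) : R := expR (delta * r) * (u + c * m r).
Definition position_sd (r : R) : R := expR (delta * r) * sigma * Num.sqrt (v r).

Let J_within w : {within `[0, +oo[, continuous (fun t => J t w)}.
Proof. by case: hJ => _ + _; apply. Qed.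

Lemma discounted_risk_within u w :
  {within `[0, +oo[, continuous (fun t => discounted_risk u t w)}.
Proof.
apply/subspace_continuousP => t t0; apply: cvgB.
  apply: cvgD; first exact: cvg_cst.
  apply: cvgM; first exact: cvg_cst.
  by apply: cvg_within_filter; exact: continuous_exp_primitive.
apply: cvgM; first exact: cvg_cst.
by move/subspace_continuousP : (@J_within w); apply.
Qed.

Lemma measurable_ruin u s tau : 0 <= tau -> measurable (ruin u s tau).
Proof.
move=> tau0; pose y t w := discounted_risk u t w.
have my t : measurable_fun [set: T] (y t).
  by apply: measurable_funB => //; exact: measurable_funM.
have mG n M j : measurable [set w | y (dyad M j) w <= - (n.+1%:R^-1)].
  rewrite (_ : [set w | _] = y (dyad M j) @^-1` `]-oo, (- (n.+1%:R^-1))]).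
    exact: measurable_preimage.
  by apply/seteqP; split => p; rewrite /preimage/= in_itv.
rewrite (_ : ruin u s tau =
  \bigcup_N \bigcup_(i in [set i | (dyad N i : R) < s]) \bigcup_n \bigcap_M
  \bigcap_(j in [set j | (dyad N i : R) <= dyad M j <= dyad N i + tau])
   [set w | y (dyad M j) w <= - (n.+1%:R^-1)]); last first.
  apply/seteqP; split => w.
    move=> /(has_window_dyad _ tau0 (@discounted_risk_within u w))[N [i [h2 [n h3]]]].
    exists N => //; exists i => //; exists n => // M _ j /= Mj; exact: h3.
  move=> [N _ [i /= h2 [n _ h3]]].
  apply/(has_window_dyad _ tau0 (@discounted_risk_within u w)).
  by exists N, i; split => //; exists n => M j Mj; exact: (h3 M I j Mj).
apply: bigcup_measurable => N _.
apply: bigcup_measurable => i _; apply: bigcup_measurable => n _.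
by apply: bigcap_measurableType => M _; apply: bigcap_measurableType => j _.
Qed.

(** The process restarts at time [r] from its position, with the same premium and
    an integral driven by the path after [r]. *)
Lemma discounted_riskD u r t w : discounted_risk u (r + t) w =
  expR (- (delta * r)) *
    (position u r w + c * m t - sigma * restarted J delta r t w).
Proof.
rewrite /discounted_risk /position /restarted exp_primitiveD.
have E : expR (- (delta * r)) * expR (delta * r) = 1 by rewrite -expRD addNr expR0.
move: E; set e := expR (- _); set e' := expR _ => E.
rewrite [RHS](_ : _ = e * e' * (u + c * m r - sigma * J r w) + c * (e * m t) -
   sigma * (e * e') * (J (r + t) w - J r w)); last by ring.
by rewrite E; ring.
Qed.

(** Ruin after time [r], as a function of the position at time [r] and of the path
    after [r] only. *)
Definition local_ruin (u r K h tau : R) : set T :=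
  (fun w => (position u r w, future B r w)) @^-1` window_set delta c sigma K h tau.

Lemma measurable_local_ruin u r K h tau : measurable (local_ruin u r K h tau).
Proof.
apply: measurable_preimage; last exact: measurable_window_set.
apply: measurable_fun_pair; last exact: measurable_future.
by apply: measurable_funD => //; exact: measurable_funM.
Qed.

(** Almost surely the integral after [r] is the limit of its Riemann sums at all
    dyadic times simultaneously. *)
Lemma local_ruinP u r K h tau : 0 <= r -> 0 <= tau ->
  exists Z : set T, [/\ measurable Z, P Z = 0%E & forall w, ~ Z w ->
    local_ruin u r K h tau w <-> `|position u r w| <= K /\
     has_window h tau
       (fun t => position u r w + c * m t - sigma * restarted J delta r t w)].
Proof.
move=> r0 tau0.
have : {ae P, forall w, forall M j,
    riem delta (future B r w) (dyad M j) @ \oo --> restarted J delta r (dyad M j) w}.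
  apply: ae_foralln => M; apply: ae_foralln => j.
  exact: (ae_riem_restarted delta0 hB hJ r0 (dyad_ge0 M j)).
case=> Z [mZ PZ Zw]; exists Z; split => // w nZ.
have H : forall M j, riem delta (future B r w) (dyad M j) @ \oo -->
    restarted J delta r (dyad M j) w.
  by apply: contrapT => H; apply: nZ; apply: Zw.
exact: (window_setP _ _ _ _ _ tau0 H (restarted_within hJ (w:=w) r0)).
Qed.

Lemma local_ruin_le u r K h tau : 0 <= r -> 0 <= tau ->
  (P (local_ruin u r K h tau) <= P (ruin u (r + h) tau))%E.
Proof.
move=> r0 tau0; have [Z [mZ PZ HZ]] := local_ruinP u K h r0 tau0.
have mruin := measurable_ruin u (r + h) tau0.
apply: (@le_trans _ _ (P (ruin u (r + h) tau `|` Z))).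
  apply: le_measure; rewrite ?inE//; first exact: measurable_local_ruin.
    exact: measurableU.
  move=> w Lw; have [Zw|nZ] := pselect (Z w); [by right|left].
  have [_ [t0 /andP[t00 t0h] neg]] := (HZ w nZ).1 Lw.
  exists (r + t0); first by rewrite addr_ge0//= ltrD2l.
  move=> t /andP[t1 t2]; have -> : t = r + (t - r) by rewrite subrKC.
  rewrite discounted_riskD pmulr_rlt0 ?expR_gt0//; apply: neg.
  by apply/andP; split; lra.
apply: (@le_trans _ _ (P (ruin u (r + h) tau) + P Z)%E); first exact: measureU2.
by rewrite PZ adde0.
Qed.

(** Off [E1] there is no ruin before [r] and the position at [r] is nonnegative;
    off [E2] the process cannot descend from above [K] to [0] within a time [h]. *)
Lemma ruin_le_local u r K h tau E1 E2 : 0 <= r -> 0 <= K -> 0 <= tau ->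
  measurable E1 -> measurable E2 ->
  (forall w, ~ E1 w -> forall t, 0 <= t <= r -> sigma * J t w <= u) ->
  (forall w, ~ E2 w -> forall t, 0 <= t <= h -> `|restarted J delta r t w| <= K / sigma) ->
  (P (ruin u (r + h) tau) <= P (local_ruin u r K h tau) + (P E1 + P E2))%E.
Proof.
move=> r0 K0 tau0 mE1 mE2 H1 H2.
have [Z [mZ PZ HZ]] := local_ruinP u K h r0 tau0.
have mL := measurable_local_ruin u r K h tau.
have mruin := measurable_ruin u (r + h) tau0.
apply: (@le_trans _ _ (P (local_ruin u r K h tau `|` ((E1 `|` E2) `|` Z)))).
  apply: le_measure; rewrite ?inE//.
    by apply: measurableU => //; apply: measurableU => //; exact: measurableU.
  move=> w [t0 /andP[t00 t0h] neg].
  have [Zw|nZ] := pselect (Z w); first by right; right.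
  have [E1w|nE1] := pselect (E1 w); first by right; left; left.
  have [E2w|nE2] := pselect (E2 w); first by right; left; right.
  left; apply/(HZ w nZ).
  have neg0 : discounted_risk u t0 w < 0 by apply: neg; rewrite lexx lerDl tau0.
  have rt0 : r <= t0.
    rewrite leNgt; apply/negP => t0r.
    have := H1 w nE1 t0; rewrite t00 (ltW t0r) => /(_ isT) Jt0.
    have : 0 <= c * m t0 by rewrite mulr_ge0 ?exp_primitive_ge0// ltW.
    by move: neg0; rewrite /discounted_risk; lra.
  have posge : - K <= position u r w.
    apply: (@le_trans _ _ 0); first by rewrite oppr_le0.
    have -> : position u r w = expR (delta * r) * (u + c * m r - sigma * J r w).
      by rewrite /position; ring.
    rewrite mulr_ge0 ?expR_ge0//; have := H1 w nE1 r; rewrite r0 lexx => /(_ isT).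
    have : 0 <= c * m r by rewrite mulr_ge0 ?exp_primitive_ge0// ltW.
    by lra.
  have shift t : t0 - r <= t <= t0 - r + tau ->
      position u r w + c * m t - sigma * restarted J delta r t w < 0.
    move=> /andP[t1 t2]; have := neg (r + t); rewrite discounted_riskD.
    by rewrite pmulr_rlt0 ?expR_gt0//; apply; apply/andP; split; lra.
  have t0h' : 0 <= t0 - r < h by apply/andP; split; lra.
  split; last by exists (t0 - r).
  rewrite ler_norml posge/= leNgt; apply/negP => Kpos.
  have := H2 w nE2 (t0 - r); have /andP[-> /ltW ->] := t0h' => /(_ isT) bnd.
  have := shift (t0 - r); rewrite lexx lerDl tau0 => /(_ isT).
  have : 0 <= c * m (t0 - r).
    by rewrite mulr_ge0 ?exp_primitive_ge0 ?(ltW c0)//; case/andP: t0h'.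
  have : sigma * restarted J delta r (t0 - r) w <= K.
    rewrite mulrC -ler_pdivlMr//; apply: le_trans bnd; exact: ler_norm.
  by lra.
apply: (@le_trans _ _ (P (local_ruin u r K h tau) + P ((E1 `|` E2) `|` Z))%E).
  by apply: measureU2 => //; apply: measurableU => //; exact: measurableU.
apply: leeD => //.
apply: (@le_trans _ _ (P (E1 `|` E2) + P Z)%E).
  by apply: measureU2 => //; exact: measurableU.
by rewrite PZ adde0; exact: measureU2.
Qed.

(** Conditionally on the position at the intermediate time, the probability of
    local ruin is the same for [r] and [r'] by the Markov property; only the density
    of the position changes. *)
Lemma local_ruin_compare u r r' K h tau k : 0 < r -> 0 < r' -> 0 <= k ->
  (forall z, `|z| <= K ->
    normal_pdf (position_mean u r) (position_sd r) z <=
    k * normal_pdf (position_mean u r') (position_sd r') z) ->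
  (P (local_ruin u r K h tau) <= k%:E * P (local_ruin u r' K h tau))%E.
Proof.
move=> r0 r'0 k0 hk; pose D := window_set delta c sigma K h tau.
have mD : measurable D by exact: measurable_window_set.
have key s : 0 < s -> P (local_ruin u s K h tau) =
    (\int[lebesgue_measure]_z (path_law B (xsection D z) *
       (normal_pdf (position_mean u s) (position_sd s) z)%:E))%E.
  move=> s0.
  have a0 : - (expR (delta * s) * sigma) != 0.
    by rewrite oppr_eq0 mulf_neq0// gt_eqF// expR_gt0.
  have -> := joint_past_future_law delta0 hB hJ (expR (delta * s) * (u + c * m s)) s0 a0 mD.
  rewrite normrN gtr0_norm ?mulr_gt0 ?expR_gt0// /product_measure1/=.
  rewrite ge0_integral_normal_prob//.
  exact: measurable_fun_xsection.
rewrite (key _ r0) (key _ r'0).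
have mf s : measurable_fun [set: R] (fun z => (path_law B (xsection D z) *
       (normal_pdf (position_mean u s) (position_sd s) z)%:E)%E).
  apply: emeasurable_funM; first exact: measurable_fun_xsection.
  by apply/measurable_EFinP; exact: measurable_normal_pdf.
have f0 s z : (0 <= path_law B (xsection D z) *
       (normal_pdf (position_mean u s) (position_sd s) z)%:E)%E.
  by rewrite mule_ge0// lee_fin normal_pdf_ge0.
rewrite -ge0_integralZl_EFin//; last exact: mf.
apply: ge0_le_integral => //.
- exact: mf.
- by apply: measurable_funeM; exact: mf.
move=> z _; have [zK|Kz] := leP `|z| K.
  rewrite muleCA; apply: lee_wpmul2l => //.
  by rewrite -EFinM lee_fin hk.
have -> : xsection D z = set0.
  rewrite -subset0 => f; rewrite /xsection/= inE => -[/= zK _].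
  by move: Kz; rewrite ltNge zK.
by rewrite measure0 !mul0e mule0.
Qed.

End ruin_events.

(** * Exponential bounds *)

Section exponential_bounds.
Context d (T : measurableType d) (R : realType) (P : probability T R).
Variables (B J : R -> {RV P >-> R}) (delta c sigma : R).
Hypotheses (delta0 : 0 <= delta) (c0 : 0 < c) (sigma0 : 0 < sigma).
Hypothesis hB : brownian_motion B.
Hypothesis hJ : wiener_integral_process B (fun s => expR (- (delta * s))) J.
Notation m := (exp_primitive delta).
Notation v := (exp_primitive (2 * delta)).

Let d20 : 0 <= 2 * delta. Proof. by rewrite mulr_ge0. Qed.

Lemma integral_process_law r C : 0 < r -> measurable C ->
  P (J r @^-1` C) = normal_prob 0 (Num.sqrt (v r)) C.
Proof.
move=> r0 mC; have := past_future_law delta0 hB hJ r0 mC (@measurableT _ (path_space R)).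
by rewrite !preimage_setT setIT probability_setT mule1.
Qed.

Lemma integral_process_tail theta r s y : 0 <= theta < 1 -> 0 < r <= s -> 0 <= y ->
  (P [set w | (y <= J r w)%R] <=
   ((Num.sqrt (1 - theta))^-1 * expR (- (theta * y ^+ 2 / (2 * v s))))%:E)%E.
Proof.
move=> hth /andP[r0 rs] y0; have vr0 : 0 < v r by exact: exp_primitive_gt0.
have vs0 : 0 < v s by apply: lt_le_trans vr0 _; exact: exp_primitive_le.
have -> : [set w | (y <= J r w)%R] = J r @^-1` `[y, +oo[.
  by apply/seteqP; split => w; rewrite /preimage/= in_itv/= andbT.
rewrite (integral_process_law r0 (measurable_itv _)).
have sv0 : 0 < Num.sqrt (v r) by rewrite sqrtr_gt0.
apply: (le_trans (normal_tail_le hth sv0 y0)); rewrite lee_fin.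
apply: ler_wpM2l; first by rewrite invr_ge0 sqrtr_ge0.
rewrite ler_expR lerN2 sqr_sqrtr ?(ltW vr0)//; apply: ler_wpM2l.
  by rewrite mulr_ge0 ?sqr_ge0//; case/andP: hth.
by rewrite lef_pV2 ?posrE ?mulr_gt0// ler_pM2l//; exact: exp_primitive_le.
Qed.

(** The supremum of the integral process over [[0, s]] has, on the exponential
    scale, no heavier a tail than its value at [s]: cut [[0, s]] into pieces so
    short that the oscillation over each of them is negligible. *)
Lemma early_ruin_bound s e : 0 < s -> 0 <= e -> e < (2 * sigma ^+ 2 * v s)^-1 ->
  exists2 C, 0 <= C & \forall u \near +oo, exists E : set T, [/\ measurable E,
    (P E <= (C * expR (- (e * u ^+ 2)))%:E)%E &
    forall w, ~ E w -> forall t, 0 <= t <= s -> sigma * J t w <= u].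
Proof.
move=> s0 e0 elt; have vs0 : 0 < v s by exact: exp_primitive_gt0.
set A := (_)^-1 in elt.
have A0 : 0 < A by rewrite invr_gt0 !mulr_gt0// exprn_gt0.
(* [theta = 1 - k] and the fraction [1 - k] of the level leave the exponent
   above [e] *)
have [k [k0 k1 hk3]] : exists k, [/\ 0 < k, k < 1 & e <= (1 - k) * (1 - k) ^+ 2 * A].
  have q1 : e / A < 1 by rewrite ltr_pdivrMr// mul1r.
  have q0 : 0 <= e / A by rewrite divr_ge0// ltW.
  exists ((1 - e / A) / 3); split; [lra|lra|].
  rewrite -ler_pdivrMr//; move: q0 q1; move: (e / A) => q q0 q1.
  have [x [xE x0 x1]] : exists x, [/\ (1 - q) / 3 = x, 0 < x & x < 1].
    by exists ((1 - q) / 3); split; [by []|lra|lra].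
  have -> : q = 1 - 3 * x by rewrite -xE; lra.
  rewrite (_ : (1 - (1 - 3 * x)) / 3 = x); last by lra.
  by have := sqr_ge0 x; nra.
(* pieces of length [s / n], over which an oscillation of [k * u] has an exponent of
   at least [e] *)
pose n := (Num.truncn (64 * sigma ^+ 2 * e * s / k ^+ 2)).+1.
have nR : 0 < n%:R :> R by rewrite ltr0n.
have n1 : 1 <= n%:R :> R by rewrite ler1n.
have hn : 64 * sigma ^+ 2 * e * s / k ^+ 2 <= n%:R by exact/ltW/truncnS_gt.
have [h [h0 hE]] : exists h, 0 < h /\ h = s / n%:R by exists (s / n%:R); rewrite divr_gt0.
pose C1 := (Num.sqrt (1 - (1 - k)))^-1.
have C10 : 0 <= C1 by rewrite invr_ge0 sqrtr_ge0.
exists (n%:R * (C1 + 8)); first by rewrite mulr_ge0// addr_ge0.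
pose u0 := 1 + 24 * 64 * sigma ^+ 2 * s / k ^+ 2.
have c00 : 0 <= 24 * 64 * sigma ^+ 2 * s / k ^+ 2.
  apply: divr_ge0; last exact: sqr_ge0.
  apply: mulr_ge0; last exact: ltW.
  by apply: mulr_ge0; [lra|exact: sqr_ge0].
apply: filterS (nbhs_pinfty_ge (num_real u0)) => u uu0.
have u1 : 1 <= u by apply: le_trans uu0; rewrite /u0 lerDl.
have u_gt0 : 0 < u by exact: lt_le_trans u1.
have uu : u <= u ^+ 2 by rewrite expr2 ler_peMl// ltW.
have a0 : 0 < k * u / sigma by rewrite divr_gt0 ?mulr_gt0//.
have XE : (k * u / sigma) ^+ 2 / (64 * h) = k ^+ 2 * n%:R / (64 * sigma ^+ 2 * s) * u ^+ 2.
  by rewrite hE; field; rewrite !gt_eqF.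
have den0 : 0 < 64 * sigma ^+ 2 * s by rewrite !mulr_gt0// exprn_gt0.
have k20 : 0 < k ^+ 2 by rewrite exprn_gt0.
have X24 : 24 <= (k * u / sigma) ^+ 2 / (64 * h).
  rewrite XE mulrAC ler_pdivlMr//.
  apply: (@le_trans _ _ (k ^+ 2 * u ^+ 2)); last first.
    by rewrite -(mulrA (k ^+ 2)) ler_pM2l//; apply: ler_peMl => //; exact: sqr_ge0.
  rewrite -ler_pdivrMl// mulrC; apply: le_trans uu; apply: le_trans uu0.
  by rewrite /u0 (_ : _ / _ = 24 * 64 * sigma ^+ 2 * s / k ^+ 2) ?lerDr//; ring.
have Xe : e * u ^+ 2 <= (k * u / sigma) ^+ 2 / (64 * h).
  rewrite XE; apply: ler_wpM2r; first exact: sqr_ge0.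
  rewrite ler_pdivlMr//; move: hn; rewrite ler_pdivrMr// => hn.
  by rewrite (mulrC (k ^+ 2)); apply: le_trans hn; rewrite le_eqVlt; apply/orP; left; apply/eqP; ring.
have r0 (i : nat) : 0 <= i%:R * h by rewrite mulr_ge0// ltW.
have osc (i : nat) : exists E : set T, [/\ measurable E,
    (P E <= (8 * expR (- (e * u ^+ 2)))%:E)%E &
    forall w, ~ E w -> forall t, 0 <= t <= h ->
      `|restarted J delta (i%:R * h) t w| <= k * u / sigma].
  have [E [mE PE HE]] := restarted_sup_tail delta0 hB hJ (r0 i) h0 a0 X24.
  exists E; split => //; apply: (le_trans PE); rewrite lee_fin ler_pM2l//.
  by rewrite ler_expR lerN2.
have [E HE] := choice osc.
pose F (i : nat) := [set w | ((1 - k) * u / sigma < J (i%:R * h) w)%R].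
have mF i : measurable (F i).
  rewrite (_ : F i = J (i%:R * h) @^-1` `](1 - k) * u / sigma, +oo[).
    exact: measurable_preimage.
  by apply/seteqP; split => w; rewrite /F /preimage/= in_itv/= andbT.
have k1' : 0 < 1 - k by rewrite subr_gt0.
have y0 : 0 <= (1 - k) * u / sigma by rewrite divr_ge0 ?mulr_ge0// ltW.
have PF i : (i < n)%N -> (P (F i) <= (C1 * expR (- (e * u ^+ 2)))%:E)%E.
  case: i => [|i] iN.
    rewrite (_ : F 0%N = set0) ?measure0 ?lee_fin ?mulr_ge0 ?expR_ge0//.
    rewrite -subset0 => w; rewrite /F /= mul0r; case: hJ => J0 _ _.
    by rewrite J0 => /(le_lt_trans y0); rewrite ltxx.
  have ri : 0 < i.+1%:R * h <= s.
    rewrite mulr_gt0 ?ltr0n//= hE mulrA ler_pdivrMr// mulrC.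
    by rewrite ler_pM2l// ler_nat ltnW.
  have hth : 0 <= 1 - k < 1 by apply/andP; split; lra.
  apply: (@le_trans _ _ (P [set w | ((1 - k) * u / sigma <= J (i.+1%:R * h) w)%R])).
    apply: le_measure; rewrite ?inE//.
      rewrite (_ : [set w | _] = J (i.+1%:R * h) @^-1` `[(1 - k) * u / sigma, +oo[).
        exact: measurable_preimage.
      by apply/seteqP; split => w; rewrite /preimage/= in_itv/= andbT.
    by move=> w /ltW.
  apply: (le_trans (integral_process_tail hth ri y0)); rewrite lee_fin.
  apply: ler_wpM2l => //; rewrite ler_expR lerN2.
  have -> : (1 - k) * ((1 - k) * u / sigma) ^+ 2 / (2 * v s) =
    (1 - k) * (1 - k) ^+ 2 * A * u ^+ 2.
    by rewrite /A; field; rewrite !gt_eqF.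
  by apply: ler_wpM2r => //; exact: sqr_ge0.
pose G i := E i `|` F i.
have mG i : measurable (G i) by apply: measurableU => //; case: (HE i).
exists (\big[setU/set0]_(i < n) G i); split.
- by apply: bigsetU_measurable => i _; exact: mG.
- apply: (@le_trans _ _ (\sum_(i < n) P (G i))%E).
    by apply: content_subadditive => //; apply: bigsetU_measurable => i _; exact: mG.
  apply: (@le_trans _ _ (\sum_(i < n) ((C1 + 8) * expR (- (e * u ^+ 2)))%:E)%E).
    apply: lee_sum => i _; have [mE PE _] := HE i.
    apply: (@le_trans _ _ (P (E i) + P (F i))%E); first exact: measureU2.
    by rewrite mulrDl addrC EFinD; apply: leeD => //; exact: PF.
  by rewrite sumEFin lee_fin sumr_const card_ord -[leLHS]mulr_natl mulrA.
move=> w nG t /andP[t0 ts].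
have nG' i : (i < n)%N -> ~ G i w.
  by move=> iN Gi; apply: nG; rewrite -bigcup_mkord; exists i.
pose i := Num.truncn (t / h).
have th0 : 0 <= t / h by rewrite divr_ge0// ltW.
have /andP[i1 i2] := truncn_itv th0; rewrite -/i in i1 i2.
have step j : (j < n)%N -> j%:R * h <= t -> t <= j%:R * h + h -> sigma * J t w <= u.
  move=> jn j1 j2; have nGj := nG' j jn.
  have nE : ~ E j w by move=> ?; apply: nGj; left.
  have nF : ~ F j w by move=> ?; apply: nGj; right.
  have [_ _ Hj] := HE j.
  have := Hj w nE (t - j%:R * h); rewrite subr_ge0 j1 lerBlDl => /(_ j2) bnd.
  have JF : sigma * J (j%:R * h) w <= (1 - k) * u.
    by rewrite mulrC -ler_pdivlMr// leNgt; apply/negP.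
  have -> : J t w = J (j%:R * h) w + expR (- (delta * (j%:R * h))) * restarted J delta (j%:R * h) (t - j%:R * h) w.
    rewrite /restarted subrKC mulrA -expRD addNr expR0 mul1r.
    by rewrite addrC subrK.
  rewrite mulrDr.
  suff : sigma * (expR (- (delta * (j%:R * h))) * restarted J delta (j%:R * h) (t - j%:R * h) w) <= k * u by lra.
  rewrite mulrC -ler_pdivlMr//; apply: le_trans bnd.
  have e1 : expR (- (delta * (j%:R * h))) <= 1.
    by rewrite -[leRHS]expR0 ler_expR oppr_le0 mulr_ge0.
  apply: le_trans (ler_norm _) _; rewrite normrM ger0_norm ?expR_ge0//.
  by rewrite ler_piMl.
have [iN|iN] := ltnP i n.
  apply: (step i) => //; first by rewrite -ler_pdivlMr.
  by rewrite -[X in _ + X]mul1r -mulrDl -ler_pdivrMr// natr1 ltW.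
have nt : n%:R * h <= t.
  by rewrite -ler_pdivlMr//; apply: le_trans i1; rewrite ler_nat.
have sE : n%:R * h = s by rewrite hE mulrC divfK// gt_eqF.
have tE : t = s by apply/eqP; rewrite eq_le ts -sE nt.
have nE : n = (n.-1).+1 by [].
have n'h : n.-1%:R * h + h = s by rewrite -sE -[X in _ + X]mul1r -mulrDl natr1.
apply: (step n.-1) => //; rewrite tE -?n'h//; lra.
Qed.

End exponential_bounds.

Section lower_bound.
Context d (T : measurableType d) (R : realType) (P : probability T R).
Variables (B J : R -> {RV P >-> R}) (delta c sigma : R).
Hypotheses (delta0 : 0 <= delta) (c0 : 0 < c) (sigma0 : 0 < sigma).
Hypothesis hB : brownian_motion B.
Hypothesis hJ : wiener_integral_process B (fun s => expR (- (delta * s))) J.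
Notation m := (exp_primitive delta).
Notation v := (exp_primitive (2 * delta)).

(** Ruin already occurs, over a window of vanishing length, when the integral
    process exceeds the level slightly at a fixed time and then does not move
    much. *)
Lemma ruin_lower_bound r e (tau : R -> R) : 0 < r -> (2 * sigma ^+ 2 * v r)^-1 < e ->
  (\forall u \near +oo, 0 <= tau u) -> tau @ +oo --> 0 ->
  \forall u \near +oo, forall s, r < s ->
    ((expR (- (e * u ^+ 2)))%:E <= P (ruin J delta c sigma u s (tau u)))%E.
Proof.
move=> r0 elt tau_ge0 tau0.
have d20 : 0 <= 2 * delta by rewrite mulr_ge0.
have v0 : 0 < v r by exact: exp_primitive_gt0.
set A := (_)^-1 in elt.
have A0 : 0 < A by rewrite invr_gt0 !mulr_gt0// exprn_gt0.
have e0 : 0 < e by exact: lt_trans elt.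
have [k [k0 kA]] : exists k, 0 < k /\ (1 + 3 * k) ^+ 2 * A < e.
  have q1 : 1 < e / A by rewrite ltr_pdivlMr// mul1r.
  move: q1; set q := e / A => q1.
  pose k := Num.min 1 ((q - 1) / 30).
  have [x [x0 x1 xq]] : exists x, [/\ 0 < x, x <= 1 & x <= (q - 1) / 30].
    exists k; split; rewrite /k ?ge_min ?lexx ?orbT//.
    by rewrite lt_min ltr01/=; lra.
  exists x; split => //; rewrite -ltr_pdivlMr// -/q.
  by nra.
set e1 := _ * A in kA.
(* over a time [h] an oscillation of [k * u] has the exponent [2 * e] *)
have [h [h0 hE]] : exists h, 0 < h /\ h = k ^+ 2 / (128 * sigma ^+ 2 * e).
  by exists (k ^+ 2 / (128 * sigma ^+ 2 * e)); rewrite divr_gt0 ?mulr_gt0 ?exprn_gt0.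
have sv0 : 0 < Num.sqrt (v r) by rewrite sqrtr_gt0.
have p0 : 0 < normal_peak (Num.sqrt (v r)) by rewrite normal_peak_gt0// gt_eqF.
set p := normal_peak _ in p0.
have ee1 : 0 < e - e1 by rewrite subr_gt0.
pose u0 := 1 + 12 / e + (c * (r + h) + 1) / k + sigma / k + 9 / p / (e - e1).
have z1 : 0 <= 12 / e by rewrite divr_ge0// ltW.
have z2 : 0 <= (c * (r + h) + 1) / k.
  by rewrite divr_ge0 ?addr_ge0 ?mulr_ge0 ?addr_ge0// ltW.
have z3 : 0 <= sigma / k by rewrite divr_ge0// ltW.
have z4 : 0 <= 9 / p / (e - e1) by rewrite !divr_ge0// ltW.
have tauh : \forall u \near +oo, tau u <= h.
  by move/cvgrPdist_le : tau0 => /(_ _ h0); apply: filterS => u;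
    rewrite sub0r normrN => /(le_trans (ler_norm _)).
near=> u.
have uu0 : u0 <= u by near: u; exact: nbhs_pinfty_ge (num_real u0).
have th : tau u <= h by near: u.
have t0 : 0 <= tau u by near: u.
move=> s rs.
have u1 : 1 <= u by apply: le_trans uu0; rewrite /u0; lra.
have u_gt0 : 0 < u by exact: lt_le_trans u1.
have uu : u <= u ^+ 2 by rewrite expr2 ler_peMl// ltW.
have a0 : 0 < k * u / sigma by apply: divr_gt0 => //; exact: mulr_gt0.
have XE : (k * u / sigma) ^+ 2 / (64 * h) = 2 * e * u ^+ 2.
  by rewrite hE; field; rewrite !gt_eqF.
have X24 : 24 <= (k * u / sigma) ^+ 2 / (64 * h).
  have : 12 / e <= u by apply: le_trans uu0; rewrite /u0; lra.
  move=> /le_trans/(_ uu); rewrite ler_pdivrMr// => h12.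
  by rewrite XE; lra.
have lvl : c * (r + h) + 1 <= k * u.
  have : (c * (r + h) + 1) / k <= u by apply: le_trans uu0; rewrite /u0; lra.
  by rewrite ler_pdivrMr// (mulrC u).
have sgk : sigma <= k * u.
  have : sigma / k <= u by apply: le_trans uu0; rewrite /u0; lra.
  by rewrite ler_pdivrMr// (mulrC u).
have exps : 9 <= p * expR ((e - e1) * u ^+ 2).
  rewrite mulrC -ler_pdivrMr//; apply: le_trans (ltW (expR_gt1Dx _)); last first.
    by rewrite gt_eqF// mulr_gt0// exprn_gt0.
  have : 9 / p / (e - e1) <= u by apply: le_trans uu0; rewrite /u0; lra.
  move=> /le_trans/(_ uu); rewrite ler_pdivrMr// [leRHS]mulrC => h9.
  by apply: (le_trans h9); rewrite lerDr.
have [E [mE PE HE]] := restarted_sup_tail delta0 hB hJ (ltW r0) h0 a0 X24.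
rewrite XE in PE.
pose y := (1 + 2 * k) * u / sigma.
have y0 : 0 <= y.
  by apply: divr_ge0; [apply: mulr_ge0; [lra|exact: ltW]|exact: ltW].
pose F := J r @^-1` `[y, +oo[.
have mF : measurable F by exact: measurable_preimage.
have mruin := measurable_ruin c sigma hJ u s t0.
have PF : (P F <= P (ruin J delta c sigma u s (tau u)) + P E)%E.
  apply: (@le_trans _ _ (P (ruin J delta c sigma u s (tau u) `|` E))); last exact: measureU2.
  apply: le_measure; rewrite ?inE//; first exact: measurableU.
  move=> w; rewrite /F/= in_itv/= andbT => Fw.
  have [Ew|nE] := pselect (E w); [by right|left].
  exists r; first by rewrite (ltW r0).
  move=> t /andP[rt trt].
  have tr : 0 <= t - r <= h by apply/andP; split; lra.
  have bnd := HE w nE (t - r) tr.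
  have mt : m t <= r + h.
    apply: le_trans (exp_primitive_id delta0 (le_trans (ltW r0) rt)) _.
    by case/andP: tr => _; rewrite lerBlDl.
  have JE : J t w = J r w + expR (- (delta * r)) * restarted J delta r (t - r) w.
    rewrite /restarted subrKC mulrA -expRD addNr expR0 mul1r.
    by rewrite addrC subrK.
  have cm : c * m t <= c * (r + h) by rewrite ler_pM2l.
  have sJ : (1 + 2 * k) * u <= sigma * J r w by move: Fw; rewrite /y ler_pdivrMr// (mulrC (J r w)).
  have e1' : expR (- (delta * r)) <= 1.
    by rewrite -[leRHS]expR0 ler_expR oppr_le0 mulr_ge0// ltW.
  have sY : - (k * u) <= sigma * (expR (- (delta * r)) * restarted J delta r (t - r) w).
    rewrite lerNl -mulrN -mulrN mulrC -ler_pdivlMr//; apply: le_trans bnd.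
    apply: (@le_trans _ _ `|expR (- (delta * r)) * - restarted J delta r (t - r) w|).
      exact: ler_norm.
    by rewrite normrM normrN ger0_norm ?expR_ge0// ler_piMl.
  by rewrite /discounted_risk JE mulrDr; lra.
have lowF : ((p * expR (- (e1 * u ^+ 2)))%:E <= P F)%E.
  rewrite (integral_process_law delta0 hB hJ r0 (measurable_itv _)).
  apply: le_trans (normal_tail_ge sv0 y0); rewrite lee_fin.
  rewrite normal_pdfE ?gt_eqF//; apply: ler_wpM2l; first exact: ltW.
  rewrite /normal_fun ler_expR mulNr lerN2 subr0 sqr_sqrtr ?(ltW v0)//.
  have le_y : y + 1 <= (1 + 3 * k) * u / sigma.
    rewrite ler_pdivlMr// mulrDl mul1r /y divfK ?gt_eqF//; lra.
  have y1 : (y + 1) ^+ 2 <= ((1 + 3 * k) * u / sigma) ^+ 2.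
    by rewrite ler_sqr ?nnegrE// ?addr_ge0//; apply: le_trans le_y; rewrite addr_ge0.
  have -> : e1 * u ^+ 2 = ((1 + 3 * k) * u / sigma) ^+ 2 / (v r *+ 2).
    by rewrite /e1 /A; field; rewrite !gt_eqF.
  by apply: ler_wpM2r => //; rewrite invr_ge0 mulrn_wge0// ltW.
have Pfin : P (ruin J delta c sigma u s (tau u)) \is a fin_num by exact: fin_num_measure.
have := le_trans lowF (le_trans PF (leeD (lexx _) PE)).
rewrite -(fineK Pfin) -EFinD !lee_fin => fin.
have E2 : expR (- (2 * e * u ^+ 2)) <= expR (- (e * u ^+ 2)).
  rewrite ler_expR lerN2; apply: ler_wpM2r; first exact: sqr_ge0.
  by lra.
have E1 : expR (- (e1 * u ^+ 2)) = expR ((e - e1) * u ^+ 2) * expR (- (e * u ^+ 2)).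
  by rewrite -expRD; congr expR; ring.
have h9 : 9 * expR (- (e * u ^+ 2)) <= p * expR (- (e1 * u ^+ 2)).
  by rewrite E1 (mulrA p); apply: ler_wpM2r => //; exact: expR_ge0.
by lra.
Unshelve. all: by end_near. Qed.

End lower_bound.

(** * Comparison of ruin probabilities at neighbouring horizons *)

Lemma cvg_div_sqr {R : realType} (alpha : R) : alpha / u ^+ 2 @[u --> +oo] --> (0 : R).
Proof.
rewrite -(mulr0 alpha); apply: cvgM; first exact: cvg_cst.
apply/(@gtr0_cvgV0 _ _ (pinfty_nbhs R) _ (fun u : R => u ^+ 2)); last exact: cvgr_expr2.
by near=> u; rewrite exprn_gt0.
Unshelve. all: by end_near. Qed.

Section density_ratio.
Context {R : realType}.
Variables (delta c sigma S : R).
Hypotheses (delta0 : 0 <= delta) (c0 : 0 < c) (sigma0 : 0 < sigma) (S0 : 0 < S).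
Notation m := (exp_primitive delta).
Notation v := (exp_primitive (2 * delta)).

Let d20 : 0 <= 2 * delta. Proof. by rewrite mulr_ge0. Qed.

(** Minus the derivative at [S] of [r |-> 1 / (2 sigma^2 v r)], the constant in the
    exponent [- u^2 / (2 sigma^2 v r)] of the probability of ruin before time [r]. *)
Definition ruin_rate : R := expR (- (2 * delta * S)) / (2 * sigma ^+ 2 * v S ^+ 2).

(** Up to sign, the exponent of the density of the position at time [r]: [q] is the
    discounted distance from [z] to the mean. *)
Let q u z r : R := u + c * m r - expR (- (delta * r)) * z.
Let f u z r : R := q u z r ^+ 2 / (2 * sigma ^+ 2 * v r).

(** For positions at most [k * u] in absolute value and times within [2 * k] of [S],
    the decrease of the exponent per unit of time that comes from the variance lies
    between [lower k] and [upper k] times [u^2]; the last term of [slack] accounts for the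
    variation of the mean. *)
Let upper k : R := (1 + 2 * k) ^+ 2 * expR (- (2 * delta * (S - 2 * k)))
  / (2 * sigma ^+ 2 * v (S - 2 * k) ^+ 2).
Let lower k : R := (1 - k) ^+ 2 * ruin_rate.
Let slack k : R := upper k - lower k + 3 * k * (1 + delta) / (sigma ^+ 2 * v (S / 2)).

Let expR_le1 x : 0 <= x -> expR (- (delta * x)) <= 1.
Proof. by move=> x0; rewrite -[leRHS]expR0 ler_expR oppr_le0 mulr_ge0. Qed.

Let exp_primitive_lip x y : 0 <= x -> 0 <= y -> `|m x - m y| <= `|x - y|.
Proof.
wlog xy : x y / x <= y.
  move=> hw x0 y0; have [xy|/ltW yx] := leP x y; first exact: hw.
  by rewrite distrC (distrC x); exact: hw.
move=> x0 y0; rewrite distrC (distrC x) !ger0_norm ?subr_ge0 ?exp_primitive_le//.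
exact: exp_primitiveB.
Qed.

Let ruin_rate_ge0 : 0 <= ruin_rate.
Proof.
by apply: divr_ge0; [exact: expR_ge0|apply: mulr_ge0; [apply: mulr_ge0|]; rewrite // sqr_ge0].
Qed.

(** [q] is [u] up to a relative error of order [k] and varies slowly in time; the
    leading variation comes from [1 / v]. The sign of [r - r'] decides which of
    [lower] and [upper] is used. *)
Let exponent_gap k u z r r' : 0 < k -> k <= 2^-1 -> 4 * k <= S ->
  0 < u -> c <= k * u -> c * S <= k * u -> `|z| <= k * u ->
  S - 2 * k <= r <= S -> S - 2 * k <= r' <= S ->
  f u z r' - f u z r <= ruin_rate * ((r - r') * u ^+ 2) + `|(r - r') * u ^+ 2| * slack k.
Proof.
move=> k0 k2 kS u0 cu cSu zku /andP[r1 r2] /andP[r'1 r'2].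
have kge0 := ltW k0.
have Sk : S / 2 <= S - 2 * k by lra.
have Sh0 : 0 < S / 2 by lra.
have r0 : 0 < r by lra.
have r'0 : 0 < r' by lra.
have V0 : 0 < v (S / 2) by exact: exp_primitive_gt0.
have VSk : v (S / 2) <= v (S - 2 * k) by exact: exp_primitive_le.
have VSk0 : 0 < v (S - 2 * k) by exact: lt_le_trans VSk.
have vr1 : v (S - 2 * k) <= v r by exact: exp_primitive_le.
have vr2 : v r <= v S by exact: exp_primitive_le.
have vr'1 : v (S - 2 * k) <= v r' by exact: exp_primitive_le.
have vr'2 : v r' <= v S by exact: exp_primitive_le.
have vr0 : 0 < v r by exact: lt_le_trans vr1.
have vr'0 : 0 < v r' by exact: lt_le_trans vr'1.
have vS0 : 0 < v S by exact: lt_le_trans vr2.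
have s20 : 0 < sigma ^+ 2 by rewrite exprn_gt0.
have qb x : S - 2 * k <= x <= S -> (1 - k) * u <= q u z x <= (1 + 2 * k) * u.
  move=> /andP[x1 x2]; have x0 : 0 <= x by lra.
  have m0 : 0 <= c * m x by rewrite mulr_ge0 ?exp_primitive_ge0// ltW.
  have mS : c * m x <= k * u.
    apply: le_trans cSu; rewrite ler_pM2l//.
    exact: le_trans (exp_primitive_id delta0 x0) x2.
  have ez : `|expR (- (delta * x)) * z| <= k * u.
    rewrite normrM ger0_norm ?expR_ge0//; apply: le_trans zku.
    by rewrite ler_piMl// expR_le1.
  move: ez; rewrite ler_norml => /andP[e1 e2]; rewrite /q.
  by apply/andP; split; lra.
have /andP[q1 q2] : (1 - k) * u <= q u z r <= (1 + 2 * k) * u by apply: qb; rewrite r1 r2.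
have /andP[q'1 q'2] : (1 - k) * u <= q u z r' <= (1 + 2 * k) * u by apply: qb; rewrite r'1 r'2.
have ku : 0 <= (1 - k) * u by rewrite mulr_ge0 ?ltW//; lra.
set Q := q u z r in q1 q2 *; set Q' := q u z r' in q'1 q'2 *.
have Q0 : 0 <= Q by exact: le_trans q1.
have Q'0 : 0 <= Q' by exact: le_trans q'1.
set g := (r - r') * u ^+ 2.
have gE : `|g| = `|r - r'| * u ^+ 2 by rewrite normrM (ger0_norm (sqr_ge0 u)).
(* variation of the mean *)
have dQ : `|Q' - Q| <= k * u * (1 + delta) * `|r - r'|.
  have -> : Q' - Q = c * (m r' - m r) + (expR (- (delta * r)) - expR (- (delta * r'))) * z.
    by rewrite /Q /Q' /q; ring.
  apply: le_trans (ler_normD _ _) _; rewrite !normrM (gtr0_norm c0).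
  have h1 : c * `|m r' - m r| <= k * u * `|r - r'|.
    rewrite distrC; apply: ler_pM => //; first exact: ltW.
    by apply: exp_primitive_lip; exact: ltW.
  have h2 : `|expR (- (delta * r)) - expR (- (delta * r'))| * `|z| <=
      (delta * `|r - r'|) * (k * u).
    by apply: ler_pM => //; apply: discount_lip => //; exact: ltW.
  by apply: le_trans (lerD h1 h2) _; rewrite le_eqVlt; apply/orP; left; apply/eqP; ring.
have dQ2 : Q' ^+ 2 - Q ^+ 2 <= 6 * k * (1 + delta) * `|g|.
  have -> : Q' ^+ 2 - Q ^+ 2 = (Q' - Q) * (Q' + Q) by ring.
  apply: (@le_trans _ _ (`|Q' - Q| * (Q' + Q))).
    by apply: ler_wpM2r; [exact: addr_ge0|exact: ler_norm].
  apply: (@le_trans _ _ ((k * u * (1 + delta) * `|r - r'|) * (6 * u))).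
    apply: ler_pM => //; first exact: addr_ge0.
    apply: le_trans (lerD q'2 q2) _; rewrite -mulrDl ler_pM2r//; lra.
  by rewrite gE le_eqVlt; apply/orP; left; apply/eqP; ring.
have T1 : (Q' ^+ 2 - Q ^+ 2) / (2 * sigma ^+ 2 * v r') <=
    `|g| * (3 * k * (1 + delta) / (sigma ^+ 2 * v (S / 2))).
  rewrite ler_pdivrMr ?mulr_gt0//; apply: (le_trans dQ2).
  have -> : `|g| * (3 * k * (1 + delta) / (sigma ^+ 2 * v (S / 2))) * (2 * sigma ^+ 2 * v r')
     = 6 * k * (1 + delta) * `|g| * (v r' / v (S / 2)).
    by field; rewrite !gt_eqF.
  apply: ler_peMr; last by rewrite ler_pdivlMr// mul1r; exact: le_trans vr'1.
  by rewrite !mulr_ge0// addr_ge0.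
(* variation of the variance *)
have T2 : Q ^+ 2 * (v r - v r') / (2 * sigma ^+ 2 * (v r * v r')) <=
    ruin_rate * g + `|g| * (upper k - lower k).
  have D0 x : 0 < x -> 0 < 2 * sigma ^+ 2 * x ^+ 2.
    by move=> x0; rewrite mulr_gt0 ?exprn_gt0// mulr_gt0.
  have lu : lower k <= ruin_rate.
    have h1 : (1 - k) ^+ 2 <= 1 by nra.
    by rewrite /lower -[leRHS]mul1r; apply: ler_wpM2r => //; exact: ruin_rate_ge0.
  have ul : ruin_rate <= upper k.
    rewrite /ruin_rate /upper; apply: ler_pM.
    - exact: expR_ge0.
    - by rewrite invr_ge0; apply/ltW; exact: D0.
    - rewrite -[leLHS]mul1r; apply: ler_pM; [by []|exact: expR_ge0|by nra|].
      by rewrite ler_expR lerN2; apply: ler_wpM2l => //; lra.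
    - rewrite lef_pV2 ?posrE ?mulr_gt0 ?exprn_gt0//.
      apply: ler_wpM2l; first by rewrite mulr_ge0// ltW.
      by rewrite ler_sqr ?nnegrE ?(ltW VSk0) ?(ltW vS0)//; exact: le_trans vr1 vr2.
  have den0 : 0 < 2 * sigma ^+ 2 * (v r * v r') by rewrite !mulr_gt0.
  have u20 : 0 < u ^+ 2 by rewrite exprn_gt0.
  have [rr|rr] := leP r' r.
    have g0 : 0 <= g by rewrite mulr_ge0 ?subr_ge0 ?sqr_ge0.
    rewrite (ger0_norm g0); apply: (@le_trans _ _ (upper k * g)); last first.
      have : 0 <= g * (ruin_rate - lower k) by rewrite mulr_ge0// subr_ge0.
      by lra.
    have /andP[dv0 dv] := exp_primitive_bounds d20 rr.
    have dv' : v r - v r' <= expR (- (2 * delta * (S - 2 * k))) * (r - r').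
      apply: (le_trans dv); apply: ler_wpM2r; first by rewrite subr_ge0.
      by rewrite ler_expR lerN2; apply: ler_wpM2l.
    have dvge : 0 <= v r - v r' by rewrite subr_ge0; exact: exp_primitive_le.
    have -> : upper k * g = ((1 + 2 * k) ^+ 2 * expR (- (2 * delta * (S - 2 * k))) * g)
        / (2 * sigma ^+ 2 * v (S - 2 * k) ^+ 2) by rewrite /upper mulrAC.
    apply: ler_pM.
    + exact: mulr_ge0 (sqr_ge0 _) dvge.
    + by rewrite invr_ge0 ltW.
    + apply: (@le_trans _ _ (((1 + 2 * k) * u) ^+ 2 * (expR (- (2 * delta * (S - 2 * k))) * (r - r')))).
        apply: ler_pM (sqr_ge0 _) dvge _ dv'.
        by rewrite ler_sqr ?nnegrE//; apply: le_trans q2.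
      by rewrite /g le_eqVlt; apply/orP; left; apply/eqP; ring.
    + rewrite lef_pV2 ?posrE//; last by rewrite !mulr_gt0 ?exprn_gt0.
      by rewrite ler_pM2l ?mulr_gt0// expr2; apply: ler_pM => //; exact: ltW.
  have g0 : g < 0 by rewrite /g nmulr_rlt0// subr_lt0.
  rewrite (ltr0_norm g0); apply: (@le_trans _ _ (lower k * g)); last first.
    have : 0 <= - g * (upper k - ruin_rate) by rewrite mulr_ge0 ?subr_ge0// oppr_ge0 ltW.
    by lra.
  have /andP[dv _] := exp_primitive_bounds d20 (ltW rr).
  have dv' : expR (- (2 * delta * S)) * (r' - r) <= v r' - v r.
    apply: le_trans dv; apply: ler_wpM2r; first by rewrite subr_ge0 ltW.
    by rewrite ler_expR lerN2; apply: ler_wpM2l.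
  have -> : Q ^+ 2 * (v r - v r') = - (Q ^+ 2 * (v r' - v r)) by rewrite -mulrN opprB.
  rewrite -lerN2 mulNr opprK -(mulrN (lower k)).
  have -> : lower k * - g = (((1 - k) * u) ^+ 2 * (expR (- (2 * delta * S)) * (r' - r)))
      / (2 * sigma ^+ 2 * v S ^+ 2).
    by rewrite /lower /ruin_rate /g; field; rewrite !gt_eqF.
  apply: ler_pM.
  + by rewrite mulr_ge0 ?sqr_ge0// mulr_ge0 ?expR_ge0// subr_ge0 ltW.
  + by rewrite invr_ge0; apply/ltW; exact: D0.
  + apply: ler_pM => //; first exact: sqr_ge0.
      by rewrite mulr_ge0 ?expR_ge0// subr_ge0 ltW.
    by rewrite ler_sqr ?nnegrE.
  + rewrite lef_pV2 ?posrE//; last by rewrite !mulr_gt0 ?exprn_gt0.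
    by rewrite ler_pM2l ?mulr_gt0// expr2; apply: ler_pM => //; exact: ltW.
have -> : f u z r' - f u z r = (Q' ^+ 2 - Q ^+ 2) / (2 * sigma ^+ 2 * v r') +
    Q ^+ 2 * (v r - v r') / (2 * sigma ^+ 2 * (v r * v r')).
  by rewrite /f -/Q -/Q'; field; rewrite !gt_eqF.
by apply: le_trans (lerD T1 T2) _; rewrite addrCA -mulrDr [_ / _ + _]addrC.
Qed.

Let slack_cvg0 : slack x @[x --> 0^'+] --> 0.
Proof.
apply: cvg_at_right_filter.
have slack0 : slack 0 = 0.
  by rewrite /slack /upper /lower /ruin_rate !(mulr0, subr0, mul0r, addr0, expr1n, mul1r) subrr.
rewrite -[X in _ --> X]slack0.
have cS : (S - 2 * x) @[x --> (0 : R)] --> S - 2 * 0.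
  by apply: cvgB; [exact: cvg_cst|apply: cvgM; [exact: cvg_cst|exact: cvg_id]].
have cvS : v (S - 2 * x) @[x --> (0 : R)] --> v (S - 2 * 0).
  by apply: continuous_cvg; [exact: continuous_exp_primitive|exact: cS].
have ce : expR (- (2 * delta * (S - 2 * x))) @[x --> (0 : R)] --> expR (- (2 * delta * (S - 2 * 0))).
  apply: continuous_cvg; first exact: continuous_expR.
  by apply: cvgN; apply: cvgM; [exact: cvg_cst|exact: cS].
have csqr (g : R -> R) : g x @[x --> (0 : R)] --> g 0 -> g x ^+ 2 @[x --> (0 : R)] --> g 0 ^+ 2.
  by move=> cg; rewrite expr2; under eq_fun do rewrite expr2; exact: cvgM.
rewrite /slack; apply: cvgD.
  apply: cvgB.
    rewrite /upper; apply: cvgM.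
      apply: cvgM; last exact: ce.
      apply: (csqr (fun x => 1 + 2 * x)); apply: cvgD; first exact: cvg_cst.
      by apply: cvgM; [exact: cvg_cst|exact: cvg_id].
    apply: cvgV.
      by rewrite mulr0 subr0 gt_eqF// !mulr_gt0// exp_primitive_gt0.
    apply: cvgM; first exact: cvg_cst.
    by apply: (csqr (fun x => v (S - 2 * x))).
  rewrite /lower; apply: cvgM; last exact: cvg_cst.
  by apply: (csqr (fun x => 1 - x)); apply: cvgB; [exact: cvg_cst|exact: cvg_id].
apply: cvgM; last exact: cvg_cst.
by apply: cvgM; [apply: cvgM; [exact: cvg_cst|exact: cvg_id]|exact: cvg_cst].
Qed.

Notation mean := (position_mean delta c).
Notation sd := (position_sd delta sigma).

Let sd_gt0 r : 0 < r -> 0 < sd r.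
Proof.
move=> r0; rewrite /position_sd mulr_gt0 ?sqrtr_gt0 ?exp_primitive_gt0//.
by rewrite mulr_gt0// expR_gt0.
Qed.

Let continuous_sd : continuous sd.
Proof.
move=> r; apply: cvgM.
  apply: cvgM; last exact: cvg_cst.
  apply: continuous_cvg; first exact: continuous_expR.
  by apply: cvgM; [exact: cvg_cst|exact: cvg_id].
by apply: continuous_cvg; [exact: sqrt_continuous|exact: continuous_exp_primitive].
Qed.

Let normal_pdf_position u r z : 0 < r ->
  normal_pdf (mean u r) (sd r) z = normal_peak (sd r) * expR (- f u z r).
Proof.
move=> r0; have s0 := sd_gt0 r0; have v0 : 0 < v r by exact: exp_primitive_gt0.
rewrite normal_pdfE ?gt_eqF// /normal_fun; congr (_ * expR _).
rewrite /f /q /position_mean /position_sd expRN !exprMn sqr_sqrtr ?ltW//.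
have e0 := expR_gt0 (delta * r).
by field; rewrite !gt_eqF.
Qed.

(** The two times differ by a multiple of [1 / u^2] while the exponent varies at the
    rate [u^2 * ruin_rate], up to [slack k], which is small with [k]; the standard
    deviations have the same limit. *)
Lemma position_density_ratio alpha beta eps : 0 < eps ->
  exists k : R, [/\ 0 < k, k <= 2^-1, 4 * k <= S &
   forall h, 0 < h -> h <= k -> \forall u \near +oo, forall z, `|z| <= k * u ->
    normal_pdf (mean u (S - h + alpha / u ^+ 2)) (sd (S - h + alpha / u ^+ 2)) z <=
    expR (ruin_rate * (alpha - beta) + eps) *
    normal_pdf (mean u (S - h + beta / u ^+ 2)) (sd (S - h + beta / u ^+ 2)) z].
Proof.
move=> eps0; pose D := `|alpha - beta| + 1.
have D0 : 0 < D by rewrite /D ltr_wpDl.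
have [k [k0 k2 kS sk]] : exists k, [/\ 0 < k, k <= 2^-1, 4 * k <= S & D * slack k <= eps / 2].
  have : \forall k \near 0^'+, [/\ 0 < k, k <= 2^-1, 4 * k <= S & D * slack k <= eps / 2].
    near=> k; split.
    - by [].
    - by near: k; apply: nbhs_right_le.
    - by rewrite -ler_pdivlMl//; near: k; apply: nbhs_right_le; rewrite mulr_gt0.
    - rewrite -ler_pdivlMl//; near: k.
      apply: (cvgr_le 0 slack_cvg0); rewrite mulr_gt0 ?invr_gt0 ?divr_gt0//.
  by move=> H; have [k kP] := @filter_ex _ _ (at_right_proper_filter (0 : R)) _ H; exists k.
exists k; split => // h h0 hk.
have Sh : 0 < S - h by lra.
have cr a : S - h + a / u ^+ 2 @[u --> +oo] --> S - h.
  by rewrite -[X in _ --> X]addr0; apply: cvgD; [exact: cvg_cst|exact: cvg_div_sqr].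
have inr a : \forall u \near +oo, S - 2 * k <= S - h + a / u ^+ 2 <= S.
  have h1 : S - h < S by lra.
  have h2 : S - 2 * k < S - h by lra.
  near=> u; apply/andP; split; near: u.
    exact: (cvgr_ge _ (cr a)).
  exact: (cvgr_le _ (cr a)).
have csd a : sd (S - h + a / u ^+ 2) @[u --> +oo] --> sd (S - h).
  by apply: continuous_cvg; [exact: continuous_sd|exact: cr].
have sd_ratio : \forall u \near +oo,
    sd (S - h + beta / u ^+ 2) <= expR (eps / 2) * sd (S - h + alpha / u ^+ 2).
  have h1 : 0 < expR (eps / 2) * sd (S - h) - sd (S - h).
    rewrite subr_gt0 ltr_pMl; last exact: sd_gt0.
    by rewrite -[ltLHS]expR0 ltr_expR divr_gt0.
  near=> u; rewrite -subr_ge0; near: u.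
  apply: (cvgr_ge _ _ _ h1); apply: cvgB; last exact: csd.
  by apply: cvgM; [exact: cvg_cst|exact: csd].
near=> u => z zk.
have u0 : 0 < u by [].
have rP : S - 2 * k <= S - h + alpha / u ^+ 2 <= S by near: u; exact: inr.
have r'P : S - 2 * k <= S - h + beta / u ^+ 2 <= S by near: u; exact: inr.
have sdP : sd (S - h + beta / u ^+ 2) <= expR (eps / 2) * sd (S - h + alpha / u ^+ 2).
  by near: u; exact: sd_ratio.
have cku : c <= k * u by rewrite -ler_pdivrMl//; near: u; exact: nbhs_pinfty_ge.
have cSku : c * S <= k * u by rewrite -ler_pdivrMl//; near: u; exact: nbhs_pinfty_ge.
have gap := exponent_gap k0 k2 kS u0 cku cSku zk rP r'P.
have gE : (S - h + alpha / u ^+ 2 - (S - h + beta / u ^+ 2)) * u ^+ 2 = alpha - beta.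
  by field; rewrite gt_eqF.
rewrite gE in gap.
move: (S - h + alpha / u ^+ 2) (S - h + beta / u ^+ 2) rP r'P sdP gap => r r' /andP[r1 _] /andP[r'1 _] sdP gap.
have r0 : 0 < r by lra.
have r'0 : 0 < r' by lra.
have sl : `|alpha - beta| * slack k <= eps / 2.
  have [sk0|/ltW sk0] := leP (slack k) 0.
    by apply: (@le_trans _ _ 0); [exact: mulr_ge0_le0|rewrite divr_ge0// ltW].
  by apply: le_trans sk; apply: ler_wpM2r => //; rewrite /D lerDl.
rewrite !normal_pdf_position//.
have -> : expR (ruin_rate * (alpha - beta) + eps) =
    expR (eps / 2) * expR (ruin_rate * (alpha - beta) + eps / 2).
  by rewrite -expRD; congr expR; field.
rewrite mulrACA; apply: ler_pM; [exact: normal_peak_ge0|exact: expR_ge0| |].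
  have [s0 s'0] := (sd_gt0 r0, sd_gt0 r'0).
  rewrite !normal_peakE// mulrA; apply: ler_wpM2r; first by rewrite invr_ge0.
  by rewrite ler_pdivlMr// ler_pdivrMl// mulrC.
by rewrite -expRD ler_expR; move: gap sl; lra.
Unshelve. all: by end_near. Qed.

End density_ratio.

Section ruin_ratio.
Context d (T : measurableType d) (R : realType) (P : probability T R).
Variables (B J : R -> {RV P >-> R}) (delta c sigma S : R) (tau : R -> R).
Hypotheses (delta0 : 0 <= delta) (c0 : 0 < c) (sigma0 : 0 < sigma) (S0 : 0 < S).
Hypothesis hB : brownian_motion B.
Hypothesis hJ : wiener_integral_process B (fun s => expR (- (delta * s))) J.
Hypothesis tau_ge0 : forall u, 0 <= u -> 0 <= tau u.
Hypothesis tau_cvg0 : tau @ +oo --> 0.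
Notation m := (exp_primitive delta).
Notation v := (exp_primitive (2 * delta)).
Notation rate := (ruin_rate delta sigma S).
Notation ruin := (ruin J delta c sigma).
Notation local_ruin := (local_ruin B J delta c sigma).

(** Stop at a time [h] before each horizon. The two local ruin events are compared by
    their position densities, and what [ruin_le_local] leaves out is exponentially
    smaller than the probability of ruin itself: [h] is small enough for the
    oscillation over it, and ruin before [S - 3 h / 4] has the exponent [A1], larger
    than the exponent [A2] of ruin before [S - h / 2]. *)
Lemma ruin_ratio alpha beta eps : 0 < eps ->
  \forall u \near +oo, (P (ruin u (S + alpha / u ^+ 2) (tau u)) <=
    (expR (rate * (alpha - beta)) + eps)%:E * P (ruin u (S + beta / u ^+ 2) (tau u)))%E.
Proof.
move=> eps0; have d20 : 0 <= 2 * delta by rewrite mulr_ge0.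
set x := rate * (alpha - beta).
have [eps1 [eps10 eps1E]] : exists y, 0 < y /\ expR (x + y) = expR x + eps / 2.
  exists (ln (1 + eps / 2 / expR x)).
  have t0 : 0 < eps / 2 / expR x by rewrite !divr_gt0 ?expR_gt0.
  split; first by rewrite ln_gt0// ltrDl.
  rewrite expRD lnK ?posrE; last by rewrite addr_gt0.
  by rewrite mulrDr mulr1; congr (_ + _); field; rewrite gt_eqF ?expR_gt0.
have [k [k0 k2 kS ratio]] :=
  position_density_ratio delta0 c0 sigma0 S0 alpha beta eps10.
have vS2 : 0 < v (S / 2) by rewrite exp_primitive_gt0// divr_gt0.
have s20 : 0 < sigma ^+ 2 by rewrite exprn_gt0.
(* [e2] is the exponent required of an oscillation of [k * u] over the time [h]: the
   first condition gives [h <= k], the second places it above [A1] *)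
have [e2 [e20 e2k e2v]] : exists y, [/\ 0 < y, k <= 64 * sigma ^+ 2 * y & (sigma ^+ 2 * v (S / 2))^-1 <= y].
  exists ((sigma ^+ 2 * v (S / 2))^-1 + k / (64 * sigma ^+ 2)).
  have t0 : 0 < (sigma ^+ 2 * v (S / 2))^-1 by rewrite invr_gt0 mulr_gt0.
  have t1 : 0 < k / (64 * sigma ^+ 2) by rewrite divr_gt0// mulr_gt0.
  split; [exact: addr_gt0| |by rewrite lerDl ltW].
  rewrite mulrDr [X in _ <= _ + X](_ : _ = k); last by field; rewrite gt_eqF.
  by rewrite lerDr; apply/ltW; rewrite !mulr_gt0.
have [h [h0 hE]] : exists h, 0 < h /\ h = k ^+ 2 / (64 * sigma ^+ 2 * e2).
  by exists (k ^+ 2 / (64 * sigma ^+ 2 * e2)); rewrite divr_gt0 ?exprn_gt0 ?mulr_gt0.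
have hk : h <= k.
  rewrite hE ler_pdivrMr ?mulr_gt0// expr2.
  by apply: ler_wpM2l => //; exact: ltW.
have {}ratio := ratio h h0 hk.
have Sh : 0 < S - h by lra.
pose s1 := S - 3 * h / 4; pose s2 := S - h / 2.
have s10 : 0 < s1 by rewrite /s1; lra.
have s12 : s1 < s2 by rewrite /s1 /s2; lra.
have s2_0 : 0 < s2 by exact: lt_trans s12.
have s2S : s2 < S by rewrite /s2; lra.
have vs1 : 0 < v s1 by exact: exp_primitive_gt0.
have vs12 : v s1 < v s2 by exact: exp_primitive_lt.
have vs2 : 0 < v s2 by exact: lt_trans vs12.
have D0 y : 0 < y -> 0 < 2 * sigma ^+ 2 * y by move=> y0; rewrite !mulr_gt0.
have A12 : (2 * sigma ^+ 2 * v s2)^-1 < (2 * sigma ^+ 2 * v s1)^-1.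
  by rewrite ltf_pV2 ?posrE ?D0// ltr_pM2l// mulr_gt0.
have A1e2 : (2 * sigma ^+ 2 * v s1)^-1 <= e2.
  apply: le_trans e2v; rewrite lef_pV2 ?posrE ?D0 ?mulr_gt0//.
  have : v (S / 2) <= v s1 by apply: exp_primitive_le => //; rewrite ?/s1; lra.
  by move=> vv; rewrite -mulrA mulrCA ler_pM2l//; move: vv vS2; lra.
have A20 : 0 < (2 * sigma ^+ 2 * v s2)^-1 by rewrite invr_gt0 D0.
move: A12 A1e2 A20; set A1 := (2 * _ * v s1)^-1; set A2 := (2 * _ * v s2)^-1 => A12 A1e2 A20.
have [e0 [e1 [e0A e01 e1A]]] : exists e0 e1, [/\ A2 < e0, e0 < e1 & e1 < A1].
  by exists ((2 * A2 + A1) / 3), ((A2 + 2 * A1) / 3); split; lra.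
have e10 : 0 <= e1 by lra.
have [C C0 early] := early_ruin_bound delta0 sigma0 hB hJ s10 e10 e1A.
have tau_near : \forall u \near +oo, 0 <= tau u by near=> u; apply: tau_ge0.
have lower := ruin_lower_bound delta0 c0 sigma0 hB hJ s2_0 e0A tau_near tau_cvg0.
have cr (a y : R) : y + a / u ^+ 2 @[u --> +oo] --> y.
  by rewrite -[X in _ --> X]addr0; apply: cvgD; [exact: cvg_cst|exact: cvg_div_sqr].
have C8 : 0 < C + 8 by rewrite ltr_wpDl.
near=> u.
have u0 : 0 < u by [].
have u2 : 0 < u ^+ 2 by rewrite exprn_gt0.
have tu : 0 <= tau u by exact/tau_ge0/ltW.
set r := S - h + alpha / u ^+ 2; set r' := S - h + beta / u ^+ 2.
have r0 : 0 < r by rewrite /r; near: u; exact: (cvgr_gt _ (cr _ _) _ Sh).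
have r'0 : 0 < r' by rewrite /r'; near: u; exact: (cvgr_gt _ (cr _ _) _ Sh).
have rs1 : r <= s1 by rewrite /r; near: u; apply: (cvgr_le _ (cr _ _)); rewrite /s1; lra.
have s2b : s2 < S + beta / u ^+ 2 by near: u; exact: (cvgr_gt _ (cr _ _) _ s2S).
have [E1 [mE1 PE1 E1w]] : exists E : set T, [/\ measurable E,
    (P E <= (C * expR (- (e1 * u ^+ 2)))%:E)%E &
    forall w, ~ E w -> forall t, 0 <= t <= s1 -> sigma * J t w <= u].
  by near: u; exact: early.
have aE : (k * u / sigma) ^+ 2 / (64 * h) = e2 * u ^+ 2.
  rewrite hE; field.
  by rewrite !gt_eqF.
have u24 : 24 <= (k * u / sigma) ^+ 2 / (64 * h).
  rewrite aE -ler_pdivrMl//.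
  have u1 : 1 <= u by near: u; apply: nbhs_pinfty_ge; exact: num_real.
  apply: (@le_trans _ _ u); last by rewrite expr2; apply: ler_peMr => //; exact: ltW.
  by near: u; apply: nbhs_pinfty_ge; exact: num_real.
have a0 : 0 < k * u / sigma by rewrite divr_gt0// mulr_gt0.
have [E2 [mE2 PE2 E2w]] := restarted_sup_tail delta0 hB hJ (ltW r0) h0 a0 u24.
have lowu : forall s, s2 < s -> ((expR (- (e0 * u ^+ 2)))%:E <= P (ruin u s (tau u)))%E.
  by near: u; exact: lower.
have {}lowu := lowu _ s2b.
have ratu z : `|z| <= k * u -> normal_pdf (position_mean delta c u r) (position_sd delta sigma r) z <=
    (expR x + eps / 2) * normal_pdf (position_mean delta c u r') (position_sd delta sigma r') z.
  by rewrite -eps1E /x /r /r'; move: z; near: u; exact: ratio.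
have E1r w : ~ E1 w -> forall t, 0 <= t <= r -> sigma * J t w <= u.
  by move=> nE t /andP[t0 tr]; apply: (E1w w nE); rewrite t0 (le_trans tr).
have ku0 : 0 <= k * u by rewrite mulr_ge0// ltW.
have xe0 : 0 <= expR x + eps / 2 by rewrite addr_ge0 ?expR_ge0// divr_ge0// ltW.
have step1 := ruin_le_local delta0 c0 sigma0 hB hJ (ltW r0) ku0 tu mE1 mE2 E1r E2w.
have step2 := local_ruin_compare delta0 sigma0 hB hJ h (tau u) r0 r'0 xe0 ratu.
have step3 := local_ruin_le c sigma delta0 hB hJ u (k * u) h (ltW r'0) tu.
have rh : r + h = S + alpha / u ^+ 2 by rewrite /r; ring.
have r'h : r' + h = S + beta / u ^+ 2 by rewrite /r'; ring.
rewrite rh in step1; rewrite r'h in step3.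
have err : (P E1 + P E2 <= (eps / 2)%:E * P (ruin u (S + beta / u ^+ 2) (tau u)))%E.
  have small : (C + 8) * expR (- (e1 * u ^+ 2)) <= eps / 2 * expR (- (e0 * u ^+ 2)).
    have -> : - (e1 * u ^+ 2) = - ((e1 - e0) * u ^+ 2) - e0 * u ^+ 2 by ring.
    rewrite expRD mulrA ler_pM2r ?expR_gt0// -ler_pdivlMl// expRN invf_ple ?posrE ?expR_gt0 ?mulr_gt0 ?invr_gt0 ?divr_gt0//.
    apply: le_trans (expR_ge1Dx _); apply: ler_wpDl => //.
    rewrite -ler_pdivrMl ?subr_gt0//.
    have u1 : 1 <= u by near: u; apply: nbhs_pinfty_ge; exact: num_real.
    apply: (@le_trans _ _ u); last by rewrite expr2; apply: ler_peMr => //; exact: ltW.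
    by near: u; apply: nbhs_pinfty_ge; exact: num_real.
  apply: (@le_trans _ _ ((eps / 2)%:E * (expR (- (e0 * u ^+ 2)))%:E)%E); last first.
    by apply: lee_wpmul2l => //; rewrite lee_fin divr_ge0// ltW.
  apply: (@le_trans _ _ ((C * expR (- (e1 * u ^+ 2)))%:E + (8 * expR (- (e1 * u ^+ 2)))%:E)%E).
    apply: leeD => //; apply: (le_trans PE2); rewrite lee_fin ler_pM2l// aE ler_expR lerN2.
    by apply: ler_wpM2r; [exact: ltW|exact: le_trans (ltW e1A) A1e2].
  by rewrite -EFinD -EFinM lee_fin -mulrDl.
have -> : expR x + eps = (expR x + eps / 2) + eps / 2 by field.
rewrite EFinD ge0_muleDl ?lee_fin ?divr_ge0 ?(ltW eps0)//.
apply: (le_trans step1); apply: leeD => //.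
apply: (le_trans step2); apply: lee_wpmul2l => //.
Unshelve. all: by end_near. Qed.

End ruin_ratio.

(** * The law of the ruin time *)

Section ruin_time_law.
Context d (T : measurableType d) (R : realType) (P : probability T R).
Variables (B J : R -> {RV P >-> R}) (delta c sigma S : R) (tau : R -> R).
Hypotheses (delta0 : 0 <= delta) (c0 : 0 < c) (sigma0 : 0 < sigma) (S0 : 0 < S).
Hypothesis hB : brownian_motion B.
Hypothesis hJ : wiener_integral_process B (fun s => expR (- (delta * s))) J.
Hypothesis tau_ge0 : forall u, 0 <= u -> 0 <= tau u.
Hypothesis tau_cvg0 : tau @ +oo --> 0.
Notation m := (exp_primitive delta).
Notation v := (exp_primitive (2 * delta)).
Notation rate := (ruin_rate delta sigma S).
Notation ruin := (ruin J delta c sigma).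
Notation eta u w := (parisian_ruin_time (tau u)
  (fun t => risk_process c sigma delta J u t w)).

Lemma ruin_rate_gt0 : 0 < rate.
Proof.
apply: divr_gt0; first exact: expR_gt0.
by rewrite !mulr_gt0 ?exprn_gt0// exp_primitive_gt0// mulr_ge0.
Qed.

Lemma risk_process_discounted u t w : 0 <= t ->
  risk_process c sigma delta J u t w =
  expR (delta * t) * discounted_risk J delta c sigma u t w.
Proof. by move=> t0; rewrite /risk_process Rintegral_discount. Qed.

(** The risk process and the discounted one have the same sign. *)
Lemma ruin_timeP u s w : 0 <= u ->
  (eta u w < (s + tau u)%:E)%E <-> ruin u s (tau u) w.
Proof.
move=> u0; have tu := tau_ge0 u0.
have E t : 0 <= t -> risk_process c sigma delta J u t w =
    expR (delta * t) * discounted_risk J delta c sigma u t w.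
  exact: risk_process_discounted.
have cy : {within `[0, +oo[, continuous (fun t => risk_process c sigma delta J u t w)}.
  apply: (@subspace_eq_continuous _ _ _
    (fun t => expR (delta * t) * discounted_risk J delta c sigma u t w)).
    by move=> t; rewrite inE/= in_itv/= andbT => t0; rewrite /from_subspace E.
  apply/subspace_continuousP => t t0; apply: cvgM.
    apply: cvg_within_filter; apply: continuous_cvg; first exact: continuous_expR.
    by apply: cvgM; [exact: cvg_cst|exact: cvg_id].
  by move/subspace_continuousP : (discounted_risk_within hJ (c := c) (sigma := sigma) (u := u) (w := w)); apply.
have y0 : 0 <= risk_process c sigma delta J u 0 w.
  rewrite E// mulr_ge0 ?expR_ge0// /discounted_risk exp_primitive0 mulr0 addr0.
  by case: hJ => -> _ _; rewrite mulr0 subr0.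
have -> : ruin u s (tau u) w <->
    has_window s (tau u) (fun t => risk_process c sigma delta J u t w).
  split => -[t0 /andP[t00 t0s] neg]; exists t0; rewrite ?t00// => t /[dup] /andP[t1 _] /neg.
    by rewrite E ?(le_trans t00)// pmulr_rlt0 ?expR_gt0.
  by rewrite E ?(le_trans t00)// pmulr_rlt0 ?expR_gt0.
exact: parisian_ruin_timeP.
Qed.

Lemma ruin_time_gap u x w : 0 < u ->
  (x%:E < (u ^+ 2)%:E * ((S + tau u)%:E - eta u w))%E <->
  ruin u (S + (- x) / u ^+ 2) (tau u) w.
Proof.
move=> u0; rewrite -ruin_timeP ?ltW//.
have u2 : 0 < u ^+ 2 by rewrite exprn_gt0.
case: (eta u w) => [y| |].
- rewrite -EFinB -EFinM !lte_fin mulrC -ltr_pdivrMr// mulNr.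
  by split; lra.
- by rewrite /= gt0_muleNy ?lte_fin.
- by rewrite /= gt0_muley ?lte_fin// ltNyr ltry.
Qed.

Lemma measurable_ruin_time_le u : 0 <= u ->
  measurable [set w | (eta u w <= (S + tau u)%:E)%E].
Proof.
move=> u0.
rewrite (_ : [set w | _] = \bigcap_n ruin u (S + n.+1%:R^-1) (tau u)).
  apply: bigcap_measurableType => n _; apply: (measurable_ruin c sigma hJ).
  exact: tau_ge0.
apply/seteqP; split => w /= H.
  move=> n _; apply/ruin_timeP => //; apply: (le_lt_trans H).
  by rewrite lte_fin ltrD2r ltrDl.
apply/lee_addgt0Pr => e e0.
have [n ne] : exists n, n.+1%:R^-1 < e.
  have /cvgr_lt /(_ _ e0)[n _ /(_ n (leqnn n))/= ne] := @cvg_harmonic R.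
  by exists n.
have h : (eta u w < (S + n.+1%:R^-1 + tau u)%:E)%E by apply/ruin_timeP => //; exact: H.
apply: (le_trans (ltW h)).
by rewrite -EFinD lee_fin addrAC lerD2l ltW.
Qed.

(** The conditioning event lies between ruin before [S] and ruin before
    [S + g / u^2] for every [g > 0]. Comparing ruin before [S - x / u^2] with either of
    them by [ruin_ratio] bounds the conditional probability on both sides. *)
Lemma cond_ruin_time_cvg x : 0 < x ->
  (fun u => cond_prob P
     [set w | (x%:E < (u ^+ 2)%:E * ((S + tau u)%:E - eta u w))%E]
     [set w | (eta u w <= (S + tau u)%:E)%E]) @ +oo --> expR (- (rate * x)).
Proof.
move=> x0; have a0 := ruin_rate_gt0.
set L := expR _; have L0 : 0 < L by exact: expR_gt0.
pose M := expR (rate * x); have ML : M = L^-1 by rewrite /M /L expRN invrK.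
apply/cvgrPdist_le => eps eps0.
(* bounds with factors [L + eps] and [L^-1 + et] give the ratio within [eps] of [L],
   as [(L - eps) * (L^-1 + et) = 1 - (L * et)^2] for [eps = L^2 * et] *)
have [et [et0 etE]] : exists y, 0 < y /\ eps = L ^+ 2 * y.
  exists (eps / L ^+ 2); split; first by rewrite divr_gt0// exprn_gt0.
  by field; rewrite gt_eqF.
have [g [g0 gE]] : exists g, 0 < g /\ expR (rate * (g - - x)) = M + et / 2.
  have M0 : 0 < M by exact: expR_gt0.
  have t0 : 0 < et / 2 / M by rewrite !divr_gt0.
  exists (ln (1 + et / 2 / M) / rate); split; first by rewrite divr_gt0// ln_gt0// ltrDl.
  rewrite opprK mulrDr mulrCA divff ?gt_eqF// mulr1 expRD lnK ?posrE ?addr_gt0//.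
  by rewrite -/M; field; rewrite gt_eqF.
have up := ruin_ratio delta0 c0 sigma0 S0 hB hJ tau_ge0 tau_cvg0 (- x) 0 eps0.
rewrite subr0 mulrN -/L in up.
have et20 : 0 < et / 2 by rewrite divr_gt0.
have lo := ruin_ratio delta0 c0 sigma0 S0 hB hJ tau_ge0 tau_cvg0 g (- x) et20.
have [e elt] : exists e, (2 * sigma ^+ 2 * v (S / 2))^-1 < e.
  by exists ((2 * sigma ^+ 2 * v (S / 2))^-1 + 1); rewrite ltrDl.
have S20 : 0 < S / 2 by rewrite divr_gt0.
have tau_near : \forall u \near +oo, 0 <= tau u by near=> u; apply: tau_ge0.
have pos := ruin_lower_bound delta0 c0 sigma0 hB hJ S20 elt tau_near tau_cvg0.
near=> u.
have u0 : 0 < u by [].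
have u2 : 0 < u ^+ 2 by rewrite exprn_gt0.
set D := [set w | (eta u w <= _)%E].
have mD : measurable D by exact/measurable_ruin_time_le/ltW.
have -> : [set w | (x%:E < (u ^+ 2)%:E * ((S + tau u)%:E - eta u w))%E] =
    ruin u (S + (- x) / u ^+ 2) (tau u).
  by apply/seteqP; split => w /ruin_time_gap; apply.
have mr a : measurable (ruin u (S + a / u ^+ 2) (tau u)).
  by apply: (measurable_ruin c sigma hJ); exact/tau_ge0/ltW.
have ruinD : ruin u (S + 0 / u ^+ 2) (tau u) `<=` D.
  by move=> w; rewrite mul0r addr0 => h; apply/ltW/ruin_timeP => //; exact: ltW.
have Druin : D `<=` ruin u (S + g / u ^+ 2) (tau u).
  move=> w /= Dw; apply/ruin_timeP; first exact: ltW.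
  by apply: (le_lt_trans Dw); rewrite lte_fin ltrD2r ltrDl divr_gt0.
have ruin_mono : ruin u (S + (- x) / u ^+ 2) (tau u) `<=` ruin u (S + 0 / u ^+ 2) (tau u).
  move=> w [t0 /andP[t00 t0s] neg]; exists t0 => //; rewrite t00/=.
  by apply: (lt_le_trans t0s); rewrite mul0r lerD2l mulNr oppr_le0; apply: divr_ge0; exact: ltW.
rewrite /cond_prob (setIidl (subset_trans ruin_mono ruinD)).
have h1 : fine (P (ruin u (S + (- x) / u ^+ 2) (tau u))) <= (L + eps) * fine (P D).
  rewrite -lee_fin EFinM !fineK ?fin_num_measure//.
  apply: (@le_trans _ _ ((L + eps)%:E * P (ruin u (S + 0 / u ^+ 2) (tau u)))%E).
    by near: u; exact: up.
  apply: lee_wpmul2l; first by rewrite lee_fin addr_ge0 ?ltW.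
  by apply: le_measure; rewrite ?inE.
have h2 : fine (P D) <= (M + et) * fine (P (ruin u (S + (- x) / u ^+ 2) (tau u))).
  rewrite -lee_fin EFinM !fineK ?fin_num_measure//.
  apply: (@le_trans _ _ (P (ruin u (S + g / u ^+ 2) (tau u)))).
    by apply: le_measure; rewrite ?inE.
  have -> : M + et = expR (rate * (g - - x)) + et / 2 by rewrite gE; field.
  near: u; exact: lo.
have h3 : 0 < fine (P D).
  rewrite -lte_fin fineK ?fin_num_measure//.
  apply: (@lt_le_trans _ _ (P (ruin u S (tau u)))); last first.
    by apply: le_measure; rewrite ?inE//; move: ruinD (mr 0); rewrite mul0r addr0.
  have lowu : forall s, S / 2 < s -> ((expR (- (e * u ^+ 2)))%:E <= P (ruin u s (tau u)))%E.
    by near: u; exact: pos.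
  apply: (lt_le_trans _ (lowu S _)); first by rewrite lte_fin expR_gt0.
  by lra.
move: (fine (P D)) (fine _) (fine_ge0 (measure_ge0 P (ruin u (S + - x / u ^+ 2) (tau u)))) h1 h2 h3.
move=> D' p p0 h1 h2 h3.
have Let : (L - eps) * (M + et) <= 1.
  rewrite ML etE (_ : _ * _ = 1 - (L * et) ^+ 2); first by rewrite lerBlDr lerDl sqr_ge0.
  by field; rewrite gt_eqF.
have lowp : (L - eps) * D' <= p.
  have [Le|Le] := leP 0 (L - eps); last first.
    by apply: (@le_trans _ _ 0) => //; rewrite mulr_le0_ge0// ltW.
  apply: (le_trans (ler_wpM2l Le h2)); rewrite mulrA -[leRHS]mul1r.
  exact: ler_wpM2r.
rewrite ler_distlC; apply/andP; split.
  by rewrite ler_pdivlMr.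
by rewrite ler_pdivrMr.
Unshelve. all: by end_near. Qed.

End ruin_time_law.

Theorem theorem2p3 (R : realType) (d : measure_display) (Omega : measurableType d)
    (P : probability Omega R) (B J : R -> {RV P >-> R})
    (delta S c sigma T : R) (Tu : R -> R)
    (hdelta : 0 <= delta) (hS : 0 < S) (hc : 0 < c) (hsigma : 0 < sigma)
    (hT : 0 <= T) (hTu : forall u : R, 0 <= u -> 0 <= Tu u)
    (hTulim : (fun u : R => Tu u * u ^+ 2) @ +oo --> T)
    (hB : brownian_motion B)
    (hJ : wiener_integral_process B (fun s => expR (- (delta * s))) J)
    (x : R) (hx : 0 < x) :
  let eta (u : R) (w : Omega) : \bar R :=
    parisian_ruin_time (Tu u)
      (fun t => risk_process c sigma delta J u t w) in
  let a := 2 * delta ^+ 2 * expR (- (2 * delta * S))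
           / (sigma ^+ 2 * (1 - expR (- (2 * delta * S))) ^+ 2) in
  let b := 1 / (2 * sigma ^+ 2 * S ^+ 2) in
  (fun u : R =>
     cond_prob P
       [set w | (x%:E < (u ^+ 2)%:E * ((S + Tu u)%:E - eta u w))%E]
       [set w | (eta u w <= (S + Tu u)%:E)%E]
     / (if 0 < delta then expR (- (a * x)) else expR (- (b * x))))
    @ +oo --> (1 : R).
Proof.
move=> eta a b.
have tau_cvg0 : Tu @ +oo --> 0.
  have h : Tu u * u ^+ 2 * (1 / u ^+ 2) @[u --> +oo] --> 0.
    by rewrite -(mulr0 T); apply: cvgM => //; exact: cvg_div_sqr.
  apply: (cvg_trans _ h); apply: near_eq_cvg; near=> u.
  have u0 : 0 < u by [].
  by rewrite mulrA mulr1 mulfK// gt_eqF// exprn_gt0.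
pose L := if 0 < delta then expR (- (a * x)) else expR (- (b * x)).
have L0 : L != 0 by rewrite /L; case: ifP => _; rewrite gt_eqF ?expR_gt0.
have LE : L = expR (- (ruin_rate delta sigma S * x)).
  rewrite /L /a /b /ruin_rate; case: ifPn => [d0|].
    have v1 : exp_primitive (2 * delta) S = (1 - expR (- (2 * delta * S))) / (2 * delta).
      by rewrite /exp_primitive gt_eqF// mulr_gt0.
    rewrite v1; congr expR; congr (- (_ * _)).
    have e1 : 0 < 1 - expR (- (2 * delta * S)).
      by rewrite subr_gt0 expR_lt1 oppr_lt0 !mulr_gt0.
    move: (expR _) e1 => y y1.
    by field; rewrite !gt_eqF.
  rewrite -leNgt => d0; have -> : delta = 0 by apply/eqP; rewrite eq_le d0.
  congr expR; congr (- (_ * _)).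
  by rewrite /exp_primitive mulr0 eqxx mul0r oppr0 expR0.
rewrite -/L -(divff L0); apply: cvgM; last exact: cvg_cst.
rewrite LE; exact: (cond_ruin_time_cvg hdelta hc hsigma hS hB hJ hTu tau_cvg0 hx).
Unshelve. all: by end_near. Qed.
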